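(* Let $\mathfrak g$, $m\in\mathbb Z_{>1}$, $Q_m(\mathfrak g)$ and $R_i$ ($i\in S$) be as in the context. (1) The elements $R_i$ of the cluster modular group $\Gamma_{Q_m(\mathfrak g)}$ satisfy $(R_iR_j)^{m_{ij}}=1$ for all $i,j\in S$, so $s_i\mapsto R_i$ defines an action of the Weyl group $W(\mathfrak g)$ on the seed. (2) If $s_{i_p}s_{i_{p-1}}\cdots s_{i_1}$ is a reduced expression of $w\in W(\mathfrak g)$, then $R(w):=R_{i_p}R_{i_{p-1}}\cdots R_{i_1}$ is a green sequence for $Q_m(\mathfrak g)$; if $w$ is the longest element of $W(\mathfrak g)$, then $R(w)$ is a maximal green sequence for $Q_m(\mathfrak g)$.
   Context: Let $\mathfrak g$ be a finite-dimensional complex simple Lie algebra of rank $\ell$, $S=\{1,\dots,\ell\}$, of type $A_\ell$, $B_\ell$, $C_\ell$, $D_\ell$ ($\ell\ge4$), $E_{6,7,8}$, $F_4$ or $G_2$, with simple roots labelled: for $A_\ell,B_\ell,C_\ell$ the chain $1-2-\cdots-\ell$ ($\alpha_\ell$ short in $B_\ell$, long in $C_\ell$); $D_\ell$: chain $1-\cdots-(\ell-1)$ plus edge $(\ell-2)-\ell$; $E_\ell$: chain $1-2-3-5-\cdots-\ell$ plus edge $3-4$; $F_4$: chain $1-2-3-4$, $\alpha_1,\alpha_2$ long; $G_2$: $\alpha_2$ long. $d_i=(\alpha_i,\alpha_i)/2$ normalized: $d_i=1$ in types $A,D,E$; $(1,\dots,1,\frac12)$ for $B_\ell$; $(1,\dots,1,2)$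 for $C_\ell$; $(1,1,\frac12,\frac12)$ for $F_4$; $(1,3)$ for $G_2$; $d=\min d_i$, $d'=\max d_i$; $C_{ij}=2(\alpha_i,\alpha_j)/(\alpha_i,\alpha_i)$. The Weyl group is $W(\mathfrak g)=\langle s_i,\ i\in S\mid (s_is_j)^{m_{ij}}=1\rangle$ with $m_{ii}=1$ and, for $i\ne j$, $m_{ij}=2,3,4,6$ according as $C_{ij}C_{ji}=0,1,2,3$. Quiver $Q(\mathfrak g)$ on $\{v^i_n: i\in S, n\in d\mathbb Z\}$, arrows for all $n$: (simply-laced) orient Dynkin edges from larger to smaller label ($C(\mathfrak g)$); $v^i_n\to v^i_{n+1}$, and for each $i\to j$ in $C(\mathfrak g)$, $v^i_n\to v^j_n$ and $v^j_{n+1}\to v^i_n$. ($B_\ell$) $v^i_n\to v^i_{n+1}$ ($i\le\ell-1$); $v^i_n\to v^{i-1}_n$, $v^{i-1}_{n+1}\to v^i_n$ ($2\le i\le\ell-1$); $v^\ell_n\to v^\ell_{n+1/2}$, $v^\ell_n\to v^{\ell-1}_{n-1/2}$, $v^{\ell-1}_{n+1/2}\to v^\ell_n$. ($C_\ell$) $v^i_n\to v^i_{n+1}$ ($i\le\ell-1$); $v^i_n\to v^{i-1}_n$, $v^{i-1}_{n+1}\to v^i_n$ ($2\le i\le\ell-1$); $v^\ell_n\to v^\ell_{n+2}$, $v^\ell_n\to v^{\ell-1}_n$, $v^{\ell-1}_{n+2}\to v^\ell_n$. ($F_4$) $v^i_n\to v^i_{n+1}$ ($i=1,2$); $v^2_n\to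 v^1_n$, $v^1_{n+1}\to v^2_n$; $v^3_n\to v^3_{n+1/2}$, $v^3_n\to v^2_{n-1/2}$, $v^2_{n+1/2}\to v^3_n$; $v^4_n\to v^4_{n+1/2}$, $v^4_n\to v^3_n$, $v^3_{n+1/2}\to v^4_n$. ($G_2$) $v^1_n\to v^1_{n+1}$, $v^2_n\to v^2_{n+3}$, $v^2_n\to v^1_n$, $v^1_{n+3}\to v^2_n$. For $m\in\mathbb Z_{>1}$, $Q_m(\mathfrak g)$ has vertex set $I=\{v^i_n: n\in d\mathbb Z/d'm\mathbb Z\}$ and the same arrows with $n$ mod $d'm$. $\varepsilon_{uv}=\#\{u\to v\}-\#\{v\to u\}$. Mutation at $k$ of a seed (exchange matrix $\varepsilon$, variables $X_v,A_v$): $\varepsilon'_{ij}=-\varepsilon_{ij}$ if $k\in\{i,j\}$, else $\varepsilon_{ij}+(|\varepsilon_{ik}|\varepsilon_{kj}+\varepsilon_{ik}|\varepsilon_{kj}|)/2$; $X'_k=X_k^{-1}$, $X'_i=X_i(1+X_k^{-\mathrm{sgn}(\varepsilon_{ik})})^{-\varepsilon_{ik}}$; $A'_k=A_k^{-1}(\prod_{\varepsilon_{kj}>0}A_j^{\varepsilon_{kj}}+\prod_{\varepsilon_{kj}<0}A_j^{-\varepsilon_{kj}})$, $A'_i=A_i$. The cluster modular group $\Gamma_Q$ consists of mutation sequences (mutations and vertex permutations) preserving $Q$, modulo those preserving the seed. For each $i$ the arrows $v^i_n\to v^i_{n+d_i}$ form $d_i/d$ oriented cycles $P_{i,\gamma}$;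 for an oriented cycle $P: v_1\to\cdots\to v_p\to v_1$, $R(P)=M(P)^{-1}\circ(v_{p-1},v_p)\circ\mu_{v_p}\mu_{v_{p-1}}\circ M(P)$, $M(P)=\mu_{v_{p-2}}\cdots\mu_{v_1}$, $(v_{p-1},v_p)$ the transposition of labels; $R_i=R(P_{i,1})\circ\cdots\circ R(P_{i,d_i/d})\in\Gamma_{Q_m(\mathfrak g)}$. Green sequences: let $\mathbb P=\mathbb P_{\mathrm{trop}}(\mathbf u)$ be the tropical semifield (Laurent monomials in $\mathbf u=(u_v)_{v\in I}$, $\oplus$ = exponentwise minimum; positive/negative = all exponents $\ge0$/$\le0$), with tropical mutation $x'_k=x_k^{-1}$, $x'_i=x_i(1\oplus x_k^{-\mathrm{sgn}(\varepsilon_{ik})})^{-\varepsilon_{ik}}$. A mutation sequence mutating successively at vertices $i_1,\dots,i_N$ (with vertex permutations interspersed) is green if, starting from $(Q,\mathbf u)$ and writing $\mathbf x[k]$ for the tropical variables after $k$ mutations, $x[k]_{i_{k+1}}$ is positive for $k=0,\dots,N-1$; it is maximal green if moreover all entries of $\mathbf x[N]$ are negative. *)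

(* Defs.v *)
From HB Require Import structures.
From mathcomp Require Import all_boot all_order all_algebra.
From mathcomp Require Import fraction.
From mathcomp Require Import mpoly.
From mathcomp Require Import all_fingroup.

Set Implicit Arguments.
Unset Strict Implicit.
Unset Printing Implicit Defensive.

Import Order.TTheory GRing.Theory Num.Theory.

(* Cartan types.  Simple roots are labelled 1..l (nat labels).              *)
(* Times n in dZ / d'mZ are stored in scaled units t = n/d, i.e. in         *)
(* Z / (r m) Z with r = d'/d.                                              *)

Inductive ctype :=
  | TA of nat | TB of nat | TC of nat | TD of nat
  | TE6 | TE7 | TE8 | TF4 | TG2.

Definition valid_ctype (t : ctype) : bool :=
  match t with
  | TA l => (0 < l)%N | TB l => (1 < l)%N | TC l => (1 < l)%N | TD l => (3 < l)%N
  | _ => true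
  end.

Definition rank (t : ctype) : nat :=
  match t with
  | TA l | TB l | TC l | TD l => l
  | TE6 => 6 | TE7 => 7 | TE8 => 8 | TF4 => 4 | TG2 => 2
  end.

(* s t a = d_a / d  (a = label) *)
Definition sc (t : ctype) (a : nat) : nat :=
  match t with
  | TB l => if (a < l)%N then 2%N else 1%N
  | TC l => if (a < l)%N then 1%N else 2%N
  | TF4 => if (a <= 2)%N then 2%N else 1%N
  | TG2 => if a == 2%N then 3%N else 1%N
  | _ => 1%N
  end.

(* r t = d' / d *)
Definition rr (t : ctype) : nat :=
  match t with
  | TB _ | TC _ | TF4 => 2%N
  | TG2 => 3%N
  | _ => 1%N
  end.

(* Dynkin edges (a,b) with a > b; for simply-laced types this is the
   orientation a -> b of C(g) (from larger to smaller label). *)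
Definition dynkin_edges (t : ctype) : seq (nat * nat) :=
  match t with
  | TA l | TB l | TC l => [seq (i.+1, i) | i <- iota 1 (l - 1)]
  | TD l => [seq (i.+1, i) | i <- iota 1 (l - 2)] ++ [:: (l, l - 2)]
  | TE6 | TE7 | TE8 =>
      [:: (2, 1); (3, 2); (5, 3); (4, 3)] ++
      [seq (k.+1, k) | k <- iota 5 (rank t - 5)]
  | TF4 => [:: (2, 1); (3, 2); (4, 3)]
  | TG2 => [:: (2, 1)]
  end.

Definition adjacent (t : ctype) (a b : nat) : bool :=
  ((a, b) \in dynkin_edges t) || ((b, a) \in dynkin_edges t).

(* Cartan matrix C_ab = 2(alpha_a,alpha_b)/(alpha_a,alpha_a) = (alpha_a,alpha_b)/d_a *)
Definition cartan (t : ctype) (a b : nat) : int :=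
  if a == b then 2%Z
  else if adjacent t a b then (- Posz (maxn (sc t a) (sc t b) %/ sc t a))%R
  else 0%Z.

Definition coxm (t : ctype) (a b : nat) : nat :=
  if a == b then 1%N else
  match `|(cartan t a b * cartan t b a)%R|%N with
  | 0 => 2%N | 1 => 3%N | 2 => 4%N | _ => 6%N
  end.

(* Arrow generators (a, x, b, y): for every time n (scaled) there is an
   arrow v^a_{n+x} -> v^b_{n+y}. *)
Definition gens (t : ctype) : seq (nat * int * nat * int) :=
  let sl (es : seq (nat * nat)) :=
    [seq (i, 0%Z, i, 1%Z) | i <- iota 1 (rank t)] ++
    flatten [seq [:: (e.1, 0%Z, e.2, 0%Z); (e.2, 1%Z, e.1, 0%Z)] | e <- es] in
  match t with
  | TA _ | TD _ | TE6 | TE7 | TE8 => sl (dynkin_edges t)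
  | TB l =>
      [seq (i, 0%Z, i, 2%Z) | i <- iota 1 (l - 1)] ++
      flatten [seq [:: (i, 0%Z, i - 1, 0%Z); (i - 1, 2%Z, i, 0%Z)]
                | i <- iota 2 (l - 2)] ++
      [:: (l, 0%Z, l, 1%Z); (l, 0%Z, l - 1, (-1)%Z); (l - 1, 1%Z, l, 0%Z)]
  | TC l =>
      [seq (i, 0%Z, i, 1%Z) | i <- iota 1 (l - 1)] ++
      flatten [seq [:: (i, 0%Z, i - 1, 0%Z); (i - 1, 1%Z, i, 0%Z)]
                | i <- iota 2 (l - 2)] ++
      [:: (l, 0%Z, l, 2%Z); (l, 0%Z, l - 1, 0%Z); (l - 1, 2%Z, l, 0%Z)]
  | TF4 =>
      [:: (1, 0%Z, 1, 2%Z); (2, 0%Z, 2, 2%Z); (2, 0%Z, 1, 0%Z);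
          (1, 2%Z, 2, 0%Z); (3, 0%Z, 3, 1%Z); (3, 0%Z, 2, (-1)%Z);
          (2, 1%Z, 3, 0%Z); (4, 0%Z, 4, 1%Z); (4, 0%Z, 3, 0%Z);
          (3, 1%Z, 4, 0%Z)]
  | TG2 =>
      [:: (1, 0%Z, 1, 1%Z); (2, 0%Z, 2, 3%Z); (2, 0%Z, 1, 0%Z);
          (1, 3%Z, 2, 0%Z)]
  end.

(* The quiver Q_m(g).  Vertex (i, k) : 'I_l * 'I_(r m) is v^{i+1}_{k d}.   *)

Definition vert (t : ctype) (m : nat) : finType :=
  ('I_(rank t) * 'I_(rr t * m))%type.

Definition is_vert (t : ctype) (m : nat) (a : nat) (x : int) (u : vert t m) : bool :=
  (a == (u.1 : nat).+1) && ((x %% Posz (rr t * m))%Z == Posz (u.2 : nat)).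

Definition narrows (t : ctype) (m : nat) (u v : vert t m) : nat :=
  \sum_(n < rr t * m)
    count (fun g : nat * int * nat * int =>
             is_vert g.1.1.1 (Posz n + g.1.1.2)%R u &&
             is_vert g.1.2 (Posz n + g.2)%R v) (gens t).

Definition epsQ (t : ctype) (m : nat) (u v : vert t m) : int :=
  (Posz (narrows u v) - Posz (narrows v u))%R.

Inductive mstep (V : finType) :=
  | Mu of V
  | Perm of {perm V}.

Record seed (V : finType) (K : fieldType) := Seed {
  seps : V -> V -> int;
  sX : V -> K;
  sA : V -> K }.

Definition mut_eps (V : finType) (e : V -> V -> int) (k : V) : V -> V -> int :=
  fun i j =>
    (if (i == k) || (j == k) then - e i j
    else e i j + ((`|e i k| * e k j + e i k * `|e k j|) %/ 2)%Z)%R.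

Definition mut_seed (V : finType) (K : fieldType) (s : seed V K) (k : V) : seed V K :=
  let e := seps s in
  Seed (mut_eps e k)
    (fun i => if i == k then (sX s k)^-1
              else sX s i * (1 + sX s k ^ (- sgz (e i k))) ^ (- e i k))%R
    (fun i => if i == k then
                (sA s k)^-1 * (\prod_(j | 0 < e k j) sA s j ^ e k j +
                               \prod_(j | e k j < 0) sA s j ^ (- e k j))
              else sA s i)%R.

(* relabelling: the data of vertex u is moved to vertex (p u) *)
Definition perm_seed (V : finType) (K : fieldType) (s : seed V K) (p : {perm V}) :
  seed V K :=
  Seed (fun i j => seps s ((p^-1)%g i) ((p^-1)%g j)) (fun i => sX s ((p^-1)%g i))
       (fun i => sA s ((p^-1)%g i)).

Definition step_seed (V : finType) (K : fieldType) (s : seed V K) (st : mstep V) :=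
  match st with Mu k => mut_seed s k | Perm p => perm_seed s p end.

(* steps are listed in the order in which they are performed *)
Definition apply_seq (V : finType) (K : fieldType) (s : seed V K) (ss : seq (mstep V)) :=
  foldl (@step_seed V K) s ss.

Definition seed_equal (V : finType) (K : fieldType) (s1 s2 : seed V K) : Prop :=
  [/\ forall i j, seps s1 i j = seps s2 i j,
      forall i, sX s1 i = sX s2 i & forall i, sA s1 i = sA s2 i].

(* The initial seed of Q with generic (algebraically independent) cluster
   variables: X_v and A_v are distinct indeterminates of the field of
   rational functions Q(X_v, A_v : v in V). *)
Definition nvars (V : finType) := (#|V| + #|V|)%N.
Definition ratfun (V : finType) : fieldType := {fraction {mpoly rat[nvars V]}}.

Definition generic_seed (V : finType) (e : V -> V -> int) : seed V (ratfun V) :=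
  Seed e (fun v => @FracField.tofrac _ ('X_(lshift #|V| (enum_rank v)) : {mpoly rat[nvars V]}))
         (fun v => @FracField.tofrac _ ('X_(rshift #|V| (enum_rank v)) : {mpoly rat[nvars V]})).

(* a mutation sequence represents the identity of the cluster modular group:
   it preserves the seed (exchange matrix and all cluster variables). *)
Definition trivial_in_Gamma (V : finType) (e : V -> V -> int) (ss : seq (mstep V)) : Prop :=
  seed_equal (apply_seq (generic_seed e) ss) (generic_seed e).

Definition same_in_Gamma (V : finType) (e : V -> V -> int) (s1 s2 : seq (mstep V)) : Prop :=
  seed_equal (apply_seq (generic_seed e) s1) (apply_seq (generic_seed e) s2).

(* R(P) for an oriented cycle P = [v_1; ...; v_p], as a list of steps in the
   order performed: mu_{v_1},...,mu_{v_{p-2}}, mu_{v_{p-1}}, mu_{v_p},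
   (v_{p-1},v_p), mu_{v_{p-2}},...,mu_{v_1}. *)
Definition RP (V : finType) (P : seq V) : seq (mstep V) :=
  match rev P with
  | vp :: vp1 :: rM =>
      let M := rev rM in
      [seq Mu x | x <- M] ++ [:: Mu vp1; Mu vp; Perm (tperm vp1 vp)] ++
      [seq Mu x | x <- rev M]
  | _ => [::]
  end.

(* The oriented cycle P_{i,g+1} (0 <= g < d_i/d): v^i_{g d} -> v^i_{g d + d_i}
   -> ... of length p = r m / s_i. *)
Definition cycleP (t : ctype) (m : nat) (i : 'I_(rank t)) (g : nat) : seq (vert t m) :=
  let s := sc t i.+1 in
  [seq (i, k) | k <- pmap (fun n => insub ((g + n * s) %% (rr t * m)))
                          (iota 0 ((rr t * m) %/ s))].

(* R_i = R(P_{i,1}) o ... o R(P_{i,d_i/d}) (so R(P_{i,d_i/d}) is performed first) *)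
Definition Ri (t : ctype) (m : nat) (i : 'I_(rank t)) : seq (mstep (vert t m)) :=
  flatten [seq RP (cycleP m i g) | g <- rev (iota 0 (sc t i.+1))].

(* (R_i R_j)^{m_ij}: R_j performed first *)
Definition RiRj_pow (t : ctype) (m : nat) (i j : 'I_(rank t)) : seq (mstep (vert t m)) :=
  flatten (nseq (coxm t i.+1 j.+1) (Ri m j ++ Ri m i)).

(* A word ws = [:: i_p; ...; i_1] stands for s_{i_p} ... s_{i_1};
   R(ws) = R_{i_p} ... R_{i_1} (R_{i_1} performed first). *)
Definition Rword (t : ctype) (m : nat) (ws : seq 'I_(rank t)) : seq (mstep (vert t m)) :=
  flatten [seq Ri m i | i <- rev ws].

Definition coxrel (t : ctype) (i j : 'I_(rank t)) : seq 'I_(rank t) :=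
  flatten (nseq (coxm t i.+1 j.+1) [:: i; j]).

Inductive wequiv (t : ctype) : seq 'I_(rank t) -> seq 'I_(rank t) -> Prop :=
  | we_refl u : wequiv u u
  | we_sym u v : wequiv u v -> wequiv v u
  | we_trans u v w : wequiv u v -> wequiv v w -> wequiv u w
  | we_rel u v i j : wequiv (u ++ coxrel i j ++ v) (u ++ v).

Definition reduced (t : ctype) (ws : seq 'I_(rank t)) : Prop :=
  forall ws', wequiv ws' ws -> size ws <= size ws'.

(* the element represented by the reduced word ws has maximal length, i.e.
   it is the longest element of W(g) *)
Definition is_longest (t : ctype) (ws : seq 'I_(rank t)) : Prop :=
  forall u : seq 'I_(rank t), exists2 u', wequiv u' u & size u' <= size ws.

(* a tropical variable is a Laurent monomial in (u_v)_v, i.e. its exponent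
   vector; multiplication = +, (+) = componentwise min. *)
Definition trop (V : finType) := V -> int.

Definition trop_pos (V : finType) (x : trop V) : bool := [forall v, (0 <= x v)%R].
Definition trop_neg (V : finType) (x : trop V) : bool := [forall v, (x v <= 0)%R].

Record tseed (V : finType) := TSeed { teps : V -> V -> int; tx : V -> trop V }.

(* x'_k = x_k^{-1};  x'_i = x_i (1 (+) x_k^{-sgn e_ik})^{-e_ik} *)
Definition tmut (V : finType) (s : tseed V) (k : V) : tseed V :=
  let e := teps s in
  TSeed (mut_eps e k)
    (fun i => if i == k then (fun w => - tx s k w)%R
              else (fun w => tx s i w +
                      (- e i k) * Num.min 0 (- sgz (e i k) * tx s k w))%R).

Definition tperm_seed (V : finType) (s : tseed V) (p : {perm V}) : tseed V :=
  TSeed (fun i j => teps s ((p^-1)%g i) ((p^-1)%g j)) (fun i => tx s ((p^-1)%g i)).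

Fixpoint green_run (V : finType) (s : tseed V) (ss : seq (mstep V)) : option (tseed V) :=
  match ss with
  | [::] => Some s
  | Mu k :: ss' => if trop_pos (tx s k) then green_run (tmut s k) ss' else None
  | Perm p :: ss' => green_run (tperm_seed s p) ss'
  end.

Definition trop_init (V : finType) (e : V -> V -> int) : tseed V :=
  TSeed e (fun v w => Posz (v == w)).

Definition green (V : finType) (e : V -> V -> int) (ss : seq (mstep V)) : Prop :=
  green_run (trop_init e) ss <> None.

Definition maximal_green (V : finType) (e : V -> V -> int) (ss : seq (mstep V)) : Prop :=
  exists2 s, green_run (trop_init e) ss = Some s & forall v, trop_neg (tx s v).

(* Main.v *)
(* Each R_i is a product of moves R(P) along oriented cycles P, and all relations between these
   moves follow from involutivity of mutations, commutation at disconnected vertices and the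
   pentagon relation. The pentagon shows that R(P) does not depend on where P is started, so R(P)
   is the conjugate mu_v R(P - v) mu_v for every vertex v of P. Conjugating vertex by vertex, the
   braid relation for two linked cycles reduces to two cycles of length 2, and then to commuting
   mutations and transpositions. The cycles of Q_m(g) thus satisfy the Coxeter relations of the
   simply-laced unfolding of g, which imply those of g by folding.

   For part (2), valuations on the field of fractions transport the relations to tropical seeds,
   so the tropical variables after R(w) only depend on w. If they are nonnegative along P then
   R(P) is green and acts linearly on them. That the tropical variables of row i are nonnegative
   whenever i is an ascent of w is proved by Deodhar's induction: strip the maximal left factor of
   w in a rank two parabolic subgroup, and check the dihedral case. *)
Require Import Defs.
From HB Require Import structures.
From mathcomp Require Import all_boot all_order all_algebra.
From mathcomp Require Import fraction mpoly all_fingroup zify ring.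
From Stdlib Require Import FunctionalExtensionality Classical.
Import Defs.

Set Implicit Arguments.
Unset Strict Implicit.
Unset Printing Implicit Defensive.

Import Order.TTheory GRing.Theory Num.Theory.

(** * Mutation of matrices and seeds *)

Definition pos_part (n : int) : int := Num.max n 0%R.
Notation "[ n ]_+" := (pos_part n) (at level 0, n at level 99, format "[ n ]_+") : ring_scope.

Section PositivePart.
Local Open Scope ring_scope.
Implicit Types n : int.

Lemma pos_part_id n : 0 <= n -> [n]_+ = n.
Proof. by rewrite /pos_part; lia. Qed.

Lemma pos_part_eq0 n : n <= 0 -> [n]_+ = 0.
Proof. by rewrite /pos_part; lia. Qed.

Lemma pos_partB n : [n]_+ - [- n]_+ = n.
Proof. by rewrite /pos_part; lia. Qed.

Lemma pos_part_units :
  (pos_part 1 = 1) * (pos_part (-1) = 0) * (pos_part (- -1) = 1) *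
  (pos_part 0 = 0) * (pos_part (- 0) = 0).
Proof. by []. Qed.

Lemma pos_part_min n n' :
  ([n - n']_+ = n - Num.min n n') * ([- (n - n')]_+ = n' - Num.min n n').
Proof. by split; rewrite /pos_part; lia. Qed.

Lemma pos_part_indicators (b c : bool) : ~~ (b && c) ->
  [b%:Z - c%:Z]_+ = b%:Z /\ [- (b%:Z - c%:Z)]_+ = c%:Z.
Proof. by case: b c => [] []. Qed.

End PositivePart.

(* A subset of a field closed under sums, products and inverses that avoids 0: on seeds with
   variables in it no denominator of a mutation formula vanishes. *)
Record pos_cone (K : fieldType) := PosCone {
  in_cone :> K -> Prop;
  cone1 : in_cone 1%R;
  coneD : forall x y, in_cone x -> in_cone y -> in_cone (x + y)%R;
  coneM : forall x y, in_cone x -> in_cone y -> in_cone (x * y)%R;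
  coneV : forall x, in_cone x -> in_cone (x^-1)%R;
  cone_neq0 : forall x, in_cone x -> (x != 0)%R }.

Definition monomial (K : fieldType) (I : finType) (A : I -> K) (f : I -> int) : K :=
  (\prod_i A i ^ f i)%R.

Section PosCone.
Local Open Scope ring_scope.
Variables (K : fieldType) (C : pos_cone K).

Lemma coneX x (n : int) : C x -> C (x ^ n).
Proof.
move=> Cx; have CX k : C (x ^+ k).
  by elim: k => [|k IH]; [apply: cone1 | rewrite exprS; apply: coneM].
by case: n => n; [apply: CX | apply/coneV/CX].
Qed.

Lemma cone_1D_neq0 x : C x -> 1 + x != 0.
Proof. by move=> Cx; apply: (@cone_neq0 _ C); apply: coneD => //; apply: cone1. Qed.

Lemma cone_monomial (I : finType) (A : I -> K) f : (forall i, C (A i)) -> C (monomial A f).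
Proof.
by move=> CA; apply: big_ind => [|x y|i _]; [apply: cone1 | apply: coneM | apply: coneX].
Qed.

End PosCone.

Lemma eq_monomial (K : fieldType) (I : finType) (A B : I -> K) (f g : I -> int) :
  (forall i, f i = g i) -> (forall i, f i != 0%R -> A i = B i) -> monomial A f = monomial B g.
Proof.
move=> fg AB; apply: eq_bigr => i _; rewrite -fg.
by have [->|/AB->] := eqVneq (f i) 0%R; rewrite ?expr0z.
Qed.

Section MatrixMutation.
Local Open Scope ring_scope.
Variables (V : finType).
Implicit Types (e : V -> V -> int) (i j k l : V).

Definition skewsym e := forall i j, e i j = - e j i.

Lemma eq_matrix e e' : (forall i j, e i j = e' i j) -> e = e'.
Proof.
by move=> ee; apply: functional_extensionality => i; apply: functional_extensionality => j.
Qed.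

Lemma skewsym_diag e i : skewsym e -> e i i = 0.
Proof. by move=> sk; have := sk i i; lia. Qed.

Lemma mut_epsE e k i j : mut_eps e k i j =
  if (i == k) || (j == k) then - e i j
  else e i j + ([e i k]_+ * [e k j]_+ - [- e i k]_+ * [- e k j]_+).
Proof.
rewrite /mut_eps; case: ifP => // _; congr (_ + _).
move: (e i k) (e k j) => a b.
have half n n' : n + n = n' -> (n' %/ 2)%Z = n by move=> <-; lia.
have nonneg n : 0 <= n -> ([n]_+ = n) * ([- n]_+ = 0) * (`|n| = n).
  by move=> n0; rewrite pos_part_id // pos_part_eq0 ?oppr_le0 // ger0_norm.
have nonpos n : n <= 0 -> ([n]_+ = 0) * ([- n]_+ = - n) * (`|n| = - n).
  by move=> n0; rewrite pos_part_eq0 // pos_part_id ?oppr_ge0 // ler0_norm.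
by have [/nonneg aE|/ltW/nonpos aE] := lerP 0 a; have [/nonneg bE|/ltW/nonpos bE] := lerP 0 b;
  rewrite !aE !bE; apply: half; ring.
Qed.

Lemma mut_eps_neq e k i l : i != k -> l != k ->
  mut_eps e k i l = e i l + ([e i k]_+ * [e k l]_+ - [- e i k]_+ * [- e k l]_+).
Proof. by move=> /negPf ik /negPf lk; rewrite mut_epsE ik lk. Qed.

Lemma mut_eps_row e k l : mut_eps e k k l = - e k l.
Proof. by rewrite mut_epsE eqxx. Qed.

Lemma mut_eps_col e k l : mut_eps e k l k = - e l k.
Proof. by rewrite mut_epsE eqxx orbT. Qed.

Lemma mut_eps_row0 e k i l : i != k -> e i k = 0 -> mut_eps e k i l = e i l.
Proof.
move=> ik eik; have [->|lk] := eqVneq l k; first by rewrite mut_eps_col eik.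
by rewrite mut_eps_neq // eik !pos_part_units; ring.
Qed.

Lemma skewsym_mut e k : skewsym e -> skewsym (mut_eps e k).
Proof.
move=> sk i j; rewrite !mut_epsE orbC; case: ifP => _; first by rewrite sk.
rewrite (sk i j) (sk i k) (sk k j) !opprK; ring.
Qed.

Lemma mut_eps_col0 e k i l : skewsym e -> i != k -> e k i = 0 -> mut_eps e k l i = e l i.
Proof.
by move=> sk ik eki; rewrite skewsym_mut // mut_eps_row0 // -?sk // sk eki oppr0.
Qed.

Lemma mut_epsK e k : mut_eps (mut_eps e k) k = e.
Proof.
apply: eq_matrix => i j; rewrite !mut_epsE !eqxx !orbT /=.
by case: ifP => ijk; rewrite ?ijk ?opprK //; ring.
Qed.

Lemma mut_epsC e i j : skewsym e -> i != j -> e i j = 0 ->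
  mut_eps (mut_eps e i) j = mut_eps (mut_eps e j) i.
Proof.
move=> sk ij eij; have eji : e j i = 0 by rewrite sk eij oppr0.
have ji : j != i by rewrite eq_sym.
apply: eq_matrix => k l.
have [->|ki] := eqVneq k i; first by rewrite mut_eps_row0 ?mut_eps_row ?eij // mut_eps_row0.
have [->|kj] := eqVneq k j.
  by rewrite mut_eps_row [RHS]mut_eps_row0 ?mut_eps_row ?eji // mut_eps_row0.
have [->|li] := eqVneq l i.
  by rewrite mut_eps_col0 ?mut_eps_col ?mut_eps_col0 //; [apply: skewsym_mut | rewrite eji].
have [->|lj] := eqVneq l j.
  by rewrite mut_eps_col [RHS]mut_eps_col0 ?mut_eps_col ?mut_eps_col0 ?eij //; apply: skewsym_mut.
rewrite !(mut_eps_neq _ kj lj, mut_eps_neq _ ki li).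
rewrite (mut_eps_col0 k sk ij eji) (mut_eps_row0 l ij eij).
by rewrite (mut_eps_col0 k sk ji eij) (mut_eps_row0 l ji eji); ring.
Qed.

Definition step_eps e (st : mstep V) : V -> V -> int :=
  match st with
  | Mu k => mut_eps e k
  | Perm p => fun i j => e ((p^-1)%g i) ((p^-1)%g j)
  end.

Definition eps_seq e (w : seq (mstep V)) : V -> V -> int := foldl step_eps e w.

Lemma eps_seq_cat e u v : eps_seq e (u ++ v) = eps_seq (eps_seq e u) v.
Proof. exact: foldl_cat. Qed.

Lemma skewsym_seq e w : skewsym e -> skewsym (eps_seq e w).
Proof.
elim: w e => [|[k|p] w IH] e sk //=; apply: IH; first exact: skewsym_mut.
by move=> i j; apply: sk.
Qed.

End MatrixMutation.

#[local] Hint Resolve skewsym_mut skewsym_seq : core.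

Section SeedMutation.
Local Open Scope ring_scope.
Variables (V : finType) (K : fieldType) (C : pos_cone K).
Implicit Types (s : seed V K) (i j k : V) (w : seq (mstep V)).

Definition pos_seed s := (forall i, C (sX s i)) /\ (forall i, C (sA s i)).

Lemma eq_seed s s' : seps s = seps s' -> (forall i, sX s i = sX s' i) ->
  (forall i, sA s i = sA s' i) -> s = s'.
Proof.
case: s => e X A; case: s' => e' X' A' /= -> eX eA.
by congr Seed; apply: functional_extensionality.
Qed.

Definition exchange_sum s k : K :=
  monomial (sA s) (fun j => [seps s k j]_+) + monomial (sA s) (fun j => [- seps s k j]_+).

Lemma cone_exchange_sum s k : pos_seed s -> C (exchange_sum s k).
Proof. by case=> _ CA; apply: coneD; apply: cone_monomial. Qed.

Lemma mutX_eq s k : sX (mut_seed s k) k = (sX s k)^-1.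
Proof. by rewrite /= eqxx. Qed.

Lemma mutX_neq s k i : pos_seed s -> i != k -> sX (mut_seed s k) i =
  sX s i * (sX s k ^ [seps s i k]_+ * (1 + sX s k) ^ (- seps s i k)).
Proof.
move=> [CX _] ik /=; rewrite (negPf ik); congr (_ * _).
have Ck := CX k; move: (sX s k) (seps s i k) Ck => x n Cx.
have x0 := cone_neq0 Cx; have x10 := cone_1D_neq0 Cx.
have [n0|n0|->] := ltrgtP n 0; last by rewrite oppr0 pos_part_units !expr0z mulr1.
  by rewrite ltr0_sgz // pos_part_eq0 ?ltW // opprK expr1z expr0z mul1r.
rewrite gtr0_sgz // pos_part_id ?ltW //.
have -> : 1 + x ^ (-1) = (1 + x) * x^-1.
  by rewrite -invr_expz expr1z mulrDl divff // mul1r addrC.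
by rewrite expfzMl exprz_inv opprK mulrC.
Qed.

Lemma mutX_eps0 s k i : pos_seed s -> i != k -> seps s i k = 0 -> sX (mut_seed s k) i = sX s i.
Proof.
by move=> ps ik eik; rewrite mutX_neq // eik oppr0 pos_part_units !expr0z !mulr1.
Qed.

Lemma mutA_eq s k : sA (mut_seed s k) k = (sA s k)^-1 * exchange_sum s k.
Proof.
rewrite /= eqxx /exchange_sum /monomial; congr (_ * (_ + _)); rewrite big_mkcond /=;
  apply: eq_bigr => j _.
  by rewrite /pos_part; case: ltrP.
by rewrite /pos_part -oppr_gt0; case: ltrP.
Qed.

Lemma mutA_neq s k i : i != k -> sA (mut_seed s k) i = sA s i.
Proof. by move=> /negPf /= ->. Qed.

Lemma pos_seed_step s st : pos_seed s -> pos_seed (step_seed s st).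
Proof.
case: st => [k|p] ps; last by case: ps => CX CA; split => v /=.
have [CX CA] := ps; split=> v; have [->|vk] := eqVneq v k.
- by rewrite mutX_eq; apply: coneV.
- rewrite mutX_neq //; apply: coneM => //; apply: coneM; apply: coneX => //.
  by apply: coneD => //; apply: cone1.
- by rewrite mutA_eq; apply: coneM; [apply: coneV | apply: cone_exchange_sum].
- by rewrite mutA_neq.
Qed.

Lemma pos_seed_seq s w : pos_seed s -> pos_seed (apply_seq s w).
Proof. by elim: w s => //= st w IH s ps; apply/IH/pos_seed_step. Qed.

Lemma seps_seq s w : seps (apply_seq s w) = eps_seq (seps s) w.
Proof. by elim: w s => //= -[k|p] w IH s; rewrite IH. Qed.

Lemma exchange_sum_mut_eq s k : skewsym (seps s) ->
  exchange_sum (mut_seed s k) k = exchange_sum s k.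
Proof.
move=> sk; have mutA f : f k = 0 -> monomial (sA (mut_seed s k)) f = monomial (sA s) f.
  move=> fk; apply: eq_monomial => // j fj; rewrite mutA_neq //.
  by apply: contraNneq fj => ->; rewrite fk.
rewrite /exchange_sum !mutA /= ?mut_eps_row ?skewsym_diag ?oppr0 ?pos_part_units // addrC.
by congr (_ + _); apply: eq_monomial => // j; rewrite mut_eps_row ?opprK.
Qed.

Lemma exchange_sum_mut_eps0 s i j : i != j -> seps s i j = 0 ->
  exchange_sum (mut_seed s j) i = exchange_sum s i.
Proof.
move=> ij eij; congr (_ + _); apply: eq_monomial => l;
  rewrite /= mut_eps_row0 //; case: (l =P j) => // ->; by rewrite eij.
Qed.

Lemma mut_seedK s k : skewsym (seps s) -> pos_seed s -> mut_seed (mut_seed s k) k = s.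
Proof.
move=> sk ps; have ps' : pos_seed (mut_seed s k) := pos_seed_step (Mu k) ps.
have Xk := cone_neq0 (ps.1 k); have Xk1 := cone_1D_neq0 (ps.1 k).
apply: eq_seed => [|i|i]; first by rewrite /= mut_epsK.
  have [->|ik] := eqVneq i k; first by rewrite !mutX_eq invrK.
  rewrite mutX_neq // mutX_neq // mutX_eq /= mut_eps_col opprK.
  move: (sX s k) (seps s i k) Xk Xk1 => x n x0 x10.
  have -> : 1 + x^-1 = (1 + x) * x^-1 by rewrite mulrDl divff // mul1r addrC.
  rewrite expfzMl !exprz_inv; transitivity (sX s i * ((x ^ [n]_+ * x ^ (- [- n]_+ - n)) *
      ((1 + x) ^ (- n) * (1 + x) ^ n))); first by rewrite [x ^ (_ - n)]expfzDr //; ring.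
  rewrite -!expfzDr // addNr (_ : [n]_+ + _ = 0) ?expr0z ?mulr1 //.
  by rewrite -[n in _ - n]pos_partB; ring.
have [->|ik] := eqVneq i k; last by rewrite !mutA_neq.
rewrite mutA_eq exchange_sum_mut_eq // mutA_eq invfM invrK -mulrA mulVf ?mulr1 //.
exact: cone_neq0 (cone_exchange_sum k ps).
Qed.

Lemma mut_seedC s i j : skewsym (seps s) -> pos_seed s -> i != j -> seps s i j = 0 ->
  mut_seed (mut_seed s i) j = mut_seed (mut_seed s j) i.
Proof.
move=> sk ps ij eij; have eji : seps s j i = 0 by rewrite sk eij oppr0.
have ji : j != i by rewrite eq_sym.
have pi : pos_seed (mut_seed s i) := pos_seed_step (Mu i) ps.
have pj : pos_seed (mut_seed s j) := pos_seed_step (Mu j) ps.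
apply: eq_seed => [|k|k]; first by rewrite /= mut_epsC.
  have [->|ki] := eqVneq k i.
    by rewrite mutX_eps0 ?mutX_eq ?mutX_eps0 //= mut_eps_row eij.
  have [->|kj] := eqVneq k j.
    by rewrite [RHS]mutX_eps0 ?mutX_eq ?mutX_eps0 //= mut_eps_row eji.
  rewrite (mutX_neq pi kj) (mutX_neq pj ki) (mutX_eps0 ps ij eij) (mutX_eps0 ps ji eji).
  by rewrite (mutX_neq ps ki) (mutX_neq ps kj) /= !mut_eps_col0 //; ring.
have [->|ki] := eqVneq k i.
  by rewrite mutA_neq // !mutA_eq exchange_sum_mut_eps0 // mutA_neq.
have [->|kj] := eqVneq k j; last by rewrite !mutA_neq.
by rewrite [RHS]mutA_neq // !mutA_eq exchange_sum_mut_eps0 // mutA_neq.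
Qed.

End SeedMutation.

(** * The pentagon relation *)

Section Pentagon.
Local Open Scope ring_scope.
Variables (V : finType) (K : fieldType) (C : pos_cone K) (s : seed V K) (i j : V).
Hypotheses (sk : skewsym (seps s)) (ps : pos_seed C s) (ij : i != j) (eij : seps s i j = 1).

Let ji : j != i. Proof. by rewrite eq_sym. Qed.
Let eji : seps s j i = -1. Proof. by rewrite sk eij. Qed.

Let si := mut_seed s i.
Let sij := mut_seed si j.
Let sj := mut_seed s j.

Let sijE : seps sij = mut_eps (seps si) j. Proof. by []. Qed.
Let psi : pos_seed C si. Proof. exact: (pos_seed_step (Mu i) ps). Qed.
Let psij : pos_seed C sij. Proof. exact: (pos_seed_step (Mu j) psi). Qed.
Let psj : pos_seed C sj. Proof. exact: (pos_seed_step (Mu j) ps). Qed.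
Let ski : skewsym (seps si). Proof. exact: skewsym_mut. Qed.
Let skij : skewsym (seps sij). Proof. exact: skewsym_mut. Qed.
Let skj : skewsym (seps sj). Proof. exact: skewsym_mut. Qed.

Let y k := seps s i k.
Let z k := seps s j k.
Let w k : int := z k - [- y k]_+.
Let v k : int := - y k - [- w k]_+.
Let h k : int := y k + [z k]_+.

Let pos_parts k :
  [/\ [h k]_+ = [y k]_+ + [w k]_+, [- y k]_+ = [- h k]_+ + [v k]_+,
      [z k]_+ = [w k]_+ + [v k]_+, [- w k]_+ = [- z k]_+ + [- h k]_+ &
      [- v k]_+ = [- z k]_+ + [y k]_+].
Proof. by rewrite /h /v /w /pos_part; split; lia. Qed.

Let exponents k :
  [/\ [- y k]_+ - [- v k]_+ - v k = [- h k]_+, y k + [- w k]_+ + v k = 0,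
      w k + [- v k]_+ = h k, v k = z k - [h k]_+ & v k = z k - [- h k]_+ - h k].
Proof. by rewrite /h /v /w /pos_part; split; lia. Qed.

Let arrows : (seps si i j = -1) * (seps si j i = 1) * (seps sij i j = 1) *
  (seps sij j i = -1) * (seps sj i j = -1) * (seps sj j i = 1).
Proof. by rewrite /= !(mut_eps_row, mut_eps_col) eij eji. Qed.

Let rows k : k != i -> k != j ->
  (seps si i k = - y k) * (seps si j k = w k) * (seps sij i k = v k) *
  (seps sij j k = - w k) * (seps sj i k = h k) * (seps sj j k = - z k).
Proof.
move=> ki kj; have yi : seps si i k = - y k by rewrite /= mut_eps_row.
have wj : seps si j k = w k by rewrite /= mut_eps_neq // eji !pos_part_units /w /y /z; ring.
have zj : seps sj j k = - z k by rewrite /= mut_eps_row.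
rewrite yi wj zj sijE; do !split => //.
- by rewrite mut_eps_neq // yi wj arrows !pos_part_units /v; ring.
- by rewrite mut_eps_row wj.
- by rewrite /= mut_eps_neq // eij !pos_part_units /h /y /z; ring.
Qed.

Lemma pentagon_eps : mut_eps (seps sij) i =
  (fun k l => mut_eps (seps sj) i (tperm i j k) (tperm i j l)).
Proof.
have skL := skewsym_mut i skij; have skR := skewsym_mut i skj.
have row_i x : x != i -> x != j -> mut_eps (seps sij) i i x = mut_eps (seps sj) i j x.
  move=> xi xj; rewrite mut_eps_row mut_eps_neq // !arrows !rows // !pos_part_units.
  by have [_ _ _ -> _] := exponents x; ring.
have row_j x : x != i -> x != j -> mut_eps (seps sij) i j x = mut_eps (seps sj) i i x.
  move=> xi xj; rewrite mut_eps_row mut_eps_neq // !arrows !rows // !pos_part_units.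
  by have [_ _ <- _ _] := exponents x; ring.
apply: eq_matrix => k l.
case: (tpermP i j k) => [->|->|/eqP ki /eqP kj];
  case: (tpermP i j l) => [->|->|/eqP li /eqP lj].
- by rewrite !skewsym_diag.
- by rewrite !(mut_eps_row, mut_eps_col) !arrows.
- by rewrite row_i.
- by rewrite !(mut_eps_row, mut_eps_col) !arrows.
- by rewrite !skewsym_diag.
- by rewrite row_j.
- by rewrite skL row_i // -skR.
- by rewrite skL row_j // -skR.
rewrite mut_eps_neq // [RHS]mut_eps_neq // [seps sij k l]mut_eps_neq //.
rewrite [seps si k l]mut_eps_neq // [seps sj k l]mut_eps_neq //.
rewrite (skij k i) (ski k j) (skj k i) (sk k i) (sk k j) !opprK !rows // -!/(y _) -!/(z _).
have [-> -> -> -> ->] := pos_parts k.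
by have [-> -> -> -> ->] := pos_parts l; ring.
Qed.

Let X := sX s i.
Let Y := sX s j.
Let X_neq0 : X != 0. Proof. exact: cone_neq0 (ps.1 i). Qed.
Let Y_neq0 : Y != 0. Proof. exact: cone_neq0 (ps.1 j). Qed.
Let X1_neq0 : 1 + X != 0. Proof. exact: cone_1D_neq0 (ps.1 i). Qed.
Let Y1_neq0 : 1 + Y != 0. Proof. exact: cone_1D_neq0 (ps.1 j). Qed.
Let YX1_neq0 : 1 + Y * (1 + X) != 0.
Proof.
apply: (@cone_1D_neq0 _ C); apply: coneM (ps.1 j) _.
by apply: coneD (cone1 C) (ps.1 i).
Qed.

Let pentagon_X_pair : [/\ sX si j = Y * (1 + X), sX sij i = X^-1 * (1 + Y * (1 + X)) &
  sX sj i = X * (Y / (1 + Y))].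
Proof.
have sij_j : sX si j = Y * (1 + X).
  by rewrite (mutX_neq ps ji) eji !pos_part_units opprK expr0z expr1z mul1r.
split=> //; last by rewrite (mutX_neq ps ij) eij !pos_part_units expr1z -invr_expz expr1z.
by rewrite (mutX_neq psi ij) !arrows mutX_eq sij_j !pos_part_units opprK expr0z expr1z mul1r.
Qed.

Lemma pentagon_X k : sX (mut_seed sij i) k = sX (mut_seed sj i) (tperm i j k).
Proof.
have [si_j sij_i sj_i] := pentagon_X_pair.
case: (tpermP i j k) => [->|->|/eqP ki /eqP kj].
- rewrite mutX_eq sij_i (mutX_neq psj ji) !arrows mutX_eq sj_i !pos_part_units.
  rewrite expr1z -invr_expz expr1z -/Y; field.
  rewrite X_neq0 Y_neq0 Y1_neq0 !andbT /=.
  by apply: contraNneq YX1_neq0 => <-; apply/eqP; ring.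
- rewrite [RHS]mutX_eq (mutX_neq psij ji) !arrows mutX_eq si_j sij_i sj_i !pos_part_units.
  rewrite opprK expr0z expr1z mul1r.
  by field; rewrite X_neq0 Y_neq0 X1_neq0 Y1_neq0.
rewrite (mutX_neq psij ki) sij_i (mutX_neq psi kj) si_j (mutX_neq ps ki) -/X.
rewrite (mutX_neq psj ki) sj_i (mutX_neq ps kj) -/Y.
rewrite (skij k i) (ski k j) (skj k i) (sk k i) (sk k j) !opprK !rows // -/(y k) -/(z k).
have -> : 1 + X^-1 * (1 + Y * (1 + X)) = (1 + X) * (1 + Y) * X^-1 by field.
have -> : 1 + X * (Y / (1 + Y)) = (1 + Y * (1 + X)) * (1 + Y)^-1 by field.
rewrite !expfzMl !exprz_inv -!mulrA; congr (_ * _).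
move: (1 + Y * (1 + X)) YX1_neq0 => D D0.
move: (1 + X) (1 + Y) X1_neq0 Y1_neq0 => X1 Y1 X10 Y10.
transitivity (X ^ ([- y k]_+ - [- v k]_+ - v k) * X1 ^ (y k + [- w k]_+ + v k) *
    Y ^ [- w k]_+ * D ^ (w k + [- v k]_+) * Y1 ^ v k).
  by rewrite !expfzDr //; ring.
have [-> -> -> _ ->] := exponents k; have [_ _ _ -> _] := pos_parts k.
by rewrite !expfzDr // expr0z; ring.
Qed.

Let M (f : V -> int) := \prod_(k | (k != i) && (k != j)) sA s k ^ f k.
Let Mp f := M (fun k => [f k]_+).
Let Mn f := M (fun k => [- f k]_+).

Let M_mul f g f' : (forall k, f' k = f k + g k) -> M f' = M f * M g.
Proof.
move=> fE; rewrite /M -big_split /=; apply: eq_bigr => k _.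
by rewrite fE expfzDr // (cone_neq0 (ps.2 k)).
Qed.

Let cone_M f : C (M f).
Proof. by apply: big_ind => [|a b|k _]; [apply: cone1 | apply: coneM | apply/coneX/ps.2]. Qed.

Let M_pos_parts : [/\ Mp h = Mp y * Mp w, Mn y = Mn h * Mp v, Mp z = Mp w * Mp v,
  Mn w = Mn z * Mn h & Mn v = Mn z * Mp y].
Proof. by split; apply: M_mul => k; case: (pos_parts k). Qed.

Let monomial_split (A : V -> K) f f' : (forall k, k != i -> k != j -> A k = sA s k) ->
  (forall k, k != i -> k != j -> f k = f' k) -> monomial A f = A i ^ f i * A j ^ f j * M f'.
Proof.
move=> AE fE; rewrite /monomial (bigD1 i) //= (bigD1 j) //= mulrA; congr (_ * _).
by apply: eq_bigr => k /andP [ki kj]; rewrite AE // fE.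
Qed.

Let exchange_sum_split s' p rho : (forall k, k != i -> k != j -> sA s' k = sA s k) ->
  (forall k, k != i -> k != j -> seps s' p k = rho k) -> exchange_sum s' p =
  sA s' i ^ [seps s' p i]_+ * sA s' j ^ [seps s' p j]_+ * Mp rho +
  sA s' i ^ [- seps s' p i]_+ * sA s' j ^ [- seps s' p j]_+ * Mn rho.
Proof.
move=> AE pE; congr (_ + _); apply: monomial_split => // k ki kj; by rewrite pE.
Qed.

Let A_off k : k != i -> k != j ->
  (sA si k = sA s k) * (sA sij k = sA s k) * (sA sj k = sA s k).
Proof. by move=> ki kj; rewrite /sij !mutA_neq. Qed.

Let exchange_values :
  [/\ sA si i = (sA s i)^-1 * (sA s j * Mp y + Mn y),
      sA sij j = (sA s j)^-1 * (sA si i * Mp w + Mn w),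
      sA (mut_seed sij i) i = (sA si i)^-1 * (sA sij j * Mp v + Mn v),
      sA sj j = (sA s j)^-1 * (Mp z + sA s i * Mn z) &
      sA (mut_seed sj i) i = (sA s i)^-1 * (Mp h + sA sj j * Mn h)].
Proof.
have offE := (A_off, rows); split; rewrite mutA_eq.
- rewrite (exchange_sum_split (rho := y)) // skewsym_diag // eij.
  by rewrite !pos_part_units !expr0z !expr1z !mul1r.
- rewrite (exchange_sum_split (rho := w)) => [||l li lj]; try by move=> *; rewrite offE.
  rewrite skewsym_diag // arrows mutA_neq //.
  by rewrite !pos_part_units !expr0z !expr1z !mul1r mulr1.
- rewrite (exchange_sum_split (rho := v)) => [||l li lj]; try by move=> *; rewrite offE.
  rewrite skewsym_diag // arrows [sA sij i]mutA_neq //.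
  by rewrite !pos_part_units !expr0z !expr1z !mul1r.
- rewrite (exchange_sum_split (rho := z)) // skewsym_diag // eji.
  by rewrite !pos_part_units !expr0z !expr1z !mul1r mulr1.
rewrite (exchange_sum_split (rho := h)) => [||l li lj]; try by move=> *; rewrite offE.
rewrite skewsym_diag // arrows [sA sj i]mutA_neq //.
by rewrite !pos_part_units !expr0z !expr1z !mul1r.
Qed.

Lemma pentagon_A k : sA (mut_seed sij i) k = sA (mut_seed sj i) (tperm i j k).
Proof.
have [si_i sij_j siji_i sj_j sji_i] := exchange_values.
have [hE yE zE wE vE] := M_pos_parts.
have [Ai Aj] := (cone_neq0 (ps.2 i), cone_neq0 (ps.2 j)).
case: (tpermP i j k) => [->|->|/eqP ki /eqP kj]; last by rewrite !mutA_neq.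
  rewrite siji_i sij_j si_i [RHS]mutA_neq // sj_j yE wE vE zE; field.
  rewrite Ai Aj /=; apply: (@cone_neq0 _ C).
  by apply: coneD; apply: coneM; do ?[apply: cone_M | apply: ps.2].
rewrite mutA_neq // sij_j si_i sji_i sj_j hE yE zE wE; field.
by rewrite Ai Aj.
Qed.

Lemma pentagon_seed : mut_seed sij i = perm_seed (mut_seed sj i) (tperm i j).
Proof.
apply: eq_seed => [|k|k] /=; rewrite tpermV.
- exact: pentagon_eps.
- exact: pentagon_X.
- exact: pentagon_A.
Qed.

End Pentagon.

(** * Equivalence of mutation words *)

Record mequiv (V : finType) (K : fieldType) (C : pos_cone K) (e : V -> V -> int)
    (u v : seq (mstep V)) : Prop := Mequiv {
  apply_seq_mequiv : forall s : seed V K,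
    seps s = e -> pos_seed C s -> apply_seq s u = apply_seq s v }.

Section MutationEquivalence.
Local Open Scope ring_scope.
Variables (V : finType) (K : fieldType) (C : pos_cone K).
Implicit Types (e : V -> V -> int) (u v w : seq (mstep V)) (p q : {perm V}).

Local Notation "u ~[ e ] v" := (mequiv C e u v) (at level 70).

Lemma mequiv_refl e u : u ~[e] u. Proof. by []. Qed.

Lemma mequiv_sym e u v : u ~[e] v -> v ~[e] u.
Proof. by case=> uv; split=> s se ps; rewrite uv. Qed.

Lemma mequiv_trans e v u w : u ~[e] v -> v ~[e] w -> u ~[e] w.
Proof. by case=> uv [vw]; split=> s se ps; rewrite uv // vw. Qed.

Lemma apply_seq_cat (s : seed V K) u v : apply_seq s (u ++ v) = apply_seq (apply_seq s u) v.
Proof. exact: foldl_cat. Qed.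

Lemma mequiv_cat e u v u' v' : u ~[e] v -> u' ~[eps_seq e u] v' -> u ++ u' ~[e] v ++ v'.
Proof.
case=> uv [uv']; split=> s se ps; rewrite !apply_seq_cat -uv // uv' ?seps_seq ?se //.
exact: pos_seed_seq.
Qed.

Lemma mequiv_catl e u v v' : v ~[eps_seq e u] v' -> u ++ v ~[e] u ++ v'.
Proof. exact: mequiv_cat. Qed.

Lemma mequiv_catr e v v' w : v ~[e] v' -> v ++ w ~[e] v' ++ w.
Proof. by move=> vv'; apply: mequiv_cat. Qed.

Lemma mequiv_ctx e u v v' w : v ~[eps_seq e u] v' -> u ++ v ++ w ~[e] u ++ v' ++ w.
Proof. by move=> vv'; apply/mequiv_catl/mequiv_catr. Qed.

Lemma mequiv_at n e u u' w w' : u ~[eps_seq e (take n w)] u' ->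
  w = take n w ++ u ++ drop (n + size u) w -> w' = take n w ++ u' ++ drop (n + size u) w ->
  w ~[e] w'.
Proof. by move=> uu' wE ->; rewrite {1}wE; apply: mequiv_ctx. Qed.

Lemma mequiv_eps e u v : u ~[e] v -> eps_seq e u = eps_seq e v.
Proof.
move=> uv; pose s : seed V K := Seed e (fun=> 1) (fun=> 1).
have ps : pos_seed C s by split => x; apply: cone1.
by rewrite -[LHS](seps_seq s) -[RHS](seps_seq s) (apply_seq_mequiv uv).
Qed.

Lemma mequiv_muK e k : skewsym e -> [:: Mu k; Mu k] ~[e] [::].
Proof. by move=> sk; split=> s se ps; apply: mut_seedK ps; rewrite se. Qed.

Lemma mequiv_muC e i j : skewsym e -> i != j -> e i j = 0 ->
  [:: Mu i; Mu j] ~[e] [:: Mu j; Mu i].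
Proof. by move=> sk ij eij; split=> s se ps; apply: mut_seedC ps _ _; rewrite ?se. Qed.

Lemma perm_mut_eps e p k :
  mut_eps (step_eps e (Perm p)) k = step_eps (mut_eps e ((p^-1)%g k)) (Perm p).
Proof.
by apply: eq_matrix => i j; rewrite /mut_eps /= !(inj_eq (@perm_inj _ p^-1%g)).
Qed.

Lemma mut_perm_seed (s : seed V K) p k :
  mut_seed (perm_seed s p) k = perm_seed (mut_seed s ((p^-1)%g k)) p.
Proof.
have pI := inj_eq (@perm_inj _ p^-1%g).
apply: eq_seed => [|i|i] /=; rewrite ?pI //; first exact: perm_mut_eps.
by case: ifP => // _; congr (_ * (_ + _)); rewrite [RHS](reindex_inj (@perm_inj _ p^-1%g)).
Qed.

Lemma mequiv_perm_mu e p k : [:: Perm p; Mu k] ~[e] [:: Mu ((p^-1)%g k); Perm p].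
Proof. by split=> s _ _; rewrite /= mut_perm_seed. Qed.

Lemma mequiv_permM e p q : [:: Perm p; Perm q] ~[e] [:: Perm (p * q)%g].
Proof.
split=> s _ _; apply: eq_seed => [|i|i] /=; rewrite ?invMg ?permM //.
by apply: eq_matrix => i j; rewrite !permM.
Qed.

Lemma mequiv_perm1 e : [:: Perm 1%g] ~[e] [::].
Proof.
split=> s _ _; apply: eq_seed => [|i|i] /=; rewrite ?invg1 ?perm1 //.
by apply: eq_matrix => i j; rewrite !perm1.
Qed.

Lemma mequiv_perm_eq e p q p' q' : (p * q = p' * q')%g ->
  [:: Perm p; Perm q] ~[e] [:: Perm p'; Perm q'].
Proof.
move=> pq; apply: mequiv_trans (mequiv_permM _ _ _) _; rewrite pq.
exact/mequiv_sym/mequiv_permM.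
Qed.

Lemma mequiv_tpermK e a b : [:: Perm (tperm a b); Perm (tperm a b)] ~[e] [::].
Proof.
apply: mequiv_trans (mequiv_permM _ _ _) _; rewrite tperm2; exact: mequiv_perm1.
Qed.

Lemma mequiv_tpermL e a b : [:: Perm (tperm a b); Mu a] ~[e] [:: Mu b; Perm (tperm a b)].
Proof. by have := @mequiv_perm_mu e (tperm a b) a; rewrite tpermV tpermL. Qed.

Lemma mequiv_tpermR e a b : [:: Perm (tperm a b); Mu b] ~[e] [:: Mu a; Perm (tperm a b)].
Proof. by have := @mequiv_perm_mu e (tperm a b) b; rewrite tpermV tpermR. Qed.

Lemma mequiv_tpermD e a b k : a != k -> b != k ->
  [:: Perm (tperm a b); Mu k] ~[e] [:: Mu k; Perm (tperm a b)].
Proof. by move=> ak bk; have := @mequiv_perm_mu e (tperm a b) k; rewrite tpermV tpermD. Qed.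

Lemma mequiv_tpermJ e a b c : a != c -> b != c ->
  [:: Perm (tperm a b); Perm (tperm b c); Perm (tperm a b)] ~[e] [:: Perm (tperm a c)].
Proof.
move=> ac bc; apply: (mequiv_trans (v := [:: Perm (tperm a b * tperm b c); Perm (tperm a b)])).
  exact: (mequiv_at (n := 0) (@mequiv_permM _ (tperm a b) (tperm b c))).
apply: mequiv_trans (mequiv_permM _ _ _) _; rewrite -mulgA -[X in (X * _)%g]tpermV -conjgE.
by rewrite tpermJ tpermR tpermD.
Qed.

Lemma mequiv_pentagon e i j : skewsym e -> i != j -> (e i j == 1) || (e i j == -1) ->
  [:: Mu i; Mu j; Mu i] ~[e] [:: Mu j; Mu i; Perm (tperm i j)].
Proof.
have pos k l e' : skewsym e' -> k != l -> e' k l = 1 ->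
    [:: Mu k; Mu l; Mu k] ~[e'] [:: Mu l; Mu k; Perm (tperm k l)].
  by move=> sk kl ekl; split=> s se ps; apply: pentagon_seed ps kl _; rewrite se.
move=> sk ij /orP [/eqP|/eqP eij]; first exact: pos.
have ji : j != i by rewrite eq_sym.
have eji : e j i = 1 by rewrite sk eij opprK.
apply: mequiv_sym; apply: (mequiv_trans (v := [:: Mu j; Mu i; Mu j; Mu j; Perm (tperm i j)])).
  by apply: mequiv_sym; apply: (mequiv_at (n := 2) (mequiv_muK j _)); auto.
apply: (mequiv_trans (v := [:: Mu i; Mu j; Perm (tperm i j); Mu j; Perm (tperm i j)])).
  by rewrite tpermC; apply: (mequiv_catr [:: _; _] (pos j i e sk ji eji)).
apply: (mequiv_trans (v := [:: Mu i; Mu j; Mu i; Perm (tperm i j); Perm (tperm i j)])).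
  exact: (mequiv_at (n := 2) (@mequiv_tpermR _ i j)).
exact: (mequiv_at (n := 3) (@mequiv_tpermK _ i j)).
Qed.

Lemma mequiv_pentagonV e i j : skewsym e -> i != j -> (e i j == 1) || (e i j == -1) ->
  [:: Mu i; Mu j; Mu i] ~[e] [:: Perm (tperm i j); Mu i; Mu j].
Proof.
move=> sk ij eij; apply: mequiv_trans (mequiv_pentagon sk ij eij) _; apply: mequiv_sym.
apply: (mequiv_trans (v := [:: Mu j; Perm (tperm i j); Mu j])).
  exact: (mequiv_at (n := 0) (@mequiv_tpermL _ i j)).
exact: (mequiv_at (n := 1) (@mequiv_tpermR _ i j)).
Qed.

Lemma mequiv_pentagonK e i j : skewsym e -> i != j -> (e i j == 1) || (e i j == -1) ->
  [:: Mu i; Mu j; Mu i; Perm (tperm i j)] ~[e] [:: Mu j; Mu i].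
Proof.
move=> sk ij eij; apply: mequiv_trans (mequiv_catr [:: _] (mequiv_pentagon sk ij eij)) _.
exact: (mequiv_at (n := 2) (@mequiv_tpermK _ i j)).
Qed.

Lemma mequiv_cancel e u k w : skewsym e -> u ++ Mu k :: Mu k :: w ~[e] u ++ w.
Proof.
by move=> sk; apply: (@mequiv_ctx _ _ [:: _; _] [::]); apply: mequiv_muK; auto.
Qed.

Definition mu_conj k w : seq (mstep V) := Mu k :: w ++ [:: Mu k].

Lemma mequiv_mu_conj e k u v : u ~[mut_eps e k] v -> mu_conj k u ~[e] mu_conj k v.
Proof. exact: (@mequiv_ctx e [:: Mu k] u v [:: Mu k]). Qed.

Lemma mequiv_mu_conjM e k u v : skewsym e ->
  mu_conj k u ++ mu_conj k v ~[e] mu_conj k (u ++ v).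
Proof.
move=> sk; rewrite /mu_conj /= -!catA -!cat_cons; exact: mequiv_cancel.
Qed.

Lemma mequiv_mu_conjK e k u : skewsym e -> mu_conj k (mu_conj k u) ~[e] u.
Proof.
move=> sk; rewrite /mu_conj /= -catA; apply: mequiv_trans (@mequiv_cancel e [::] k _ sk) _.
by have := @mequiv_cancel e u k [::] sk; rewrite cats0.
Qed.

Lemma eps_mu_conj e k u : eps_seq e (mu_conj k u) = e ->
  eps_seq (mut_eps e k) u = mut_eps e k.
Proof. by rewrite /mu_conj -cat1s !eps_seq_cat /= => {2}<-; rewrite mut_epsK. Qed.

Definition supported_step (S : {set V}) (st : mstep V) : bool :=
  match st with Mu k => k \in S | Perm p => perm_on S p end.

Definition supported (S : {set V}) w := all (supported_step S) w.

Lemma supportedS (S S' : {set V}) w : S \subset S' -> supported S w -> supported S' w.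
Proof.
move=> /subsetP SS'; apply: sub_all => -[k|p] /=; first exact: SS'.
by move=> /subsetP pS; apply/subsetP => x /pS /SS'.
Qed.

Definition disconnected e (S S' : {set V}) :=
  forall x y, x \in S -> y \in S' -> (x != y) /\ e x y = 0.

Lemma disconnected_sym e S S' : skewsym e -> disconnected e S S' -> disconnected e S' S.
Proof.
by move=> sk d x y xS' yS; case: (d y x yS xS') => ? exy; rewrite eq_sym sk exy oppr0.
Qed.

Lemma disconnected_step e S S' st : skewsym e -> disconnected e S S' -> supported_step S st ->
  disconnected (step_eps e st) S S'.
Proof.
move=> sk d; case: st => [k|p] /= stS x y xS yS'; have [xy exy] := d x y xS yS'; split=> //.
  have [ky eky] := d k y stS yS'.
  by rewrite mut_eps_col0 // eq_sym.
rewrite (@out_perm _ S _ y) ?perm_onV //; last by apply/negP => /(d y y) []; rewrite ?eqxx.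
by case: (d (p^-1%g x) y); rewrite ?(@perm_closed _ S) ?perm_onV.
Qed.

Lemma perm_on_disconnected e S S' p k : disconnected e S S' -> perm_on S p -> k \in S' ->
  p^-1%g k = k.
Proof.
move=> d pS kS'; apply: (out_perm (perm_onV pS)); apply/negP => kS.
by case: (d k k kS kS'); rewrite eqxx.
Qed.

Lemma mequiv_stepC e S S' st st' : skewsym e -> disconnected e S S' ->
  supported_step S st -> supported_step S' st' -> [:: st; st'] ~[e] [:: st'; st].
Proof.
move=> sk d; have d' := disconnected_sym sk d.
case: st st' => [k|p] [l|q] /= stS stS'.
- by have [kl ekl] := d k l stS stS'; apply: mequiv_muC.
- apply: mequiv_sym; have := @mequiv_perm_mu e q k.
  by rewrite (perm_on_disconnected d' stS').
- by have := @mequiv_perm_mu e p l; rewrite (perm_on_disconnected d stS).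
apply/mequiv_perm_eq/(perm_onC stS stS'); apply/pred0Pn => -[x /andP [xS xS']].
by case: (d x x xS xS'); rewrite eqxx.
Qed.

Lemma mequiv_disconnectedC e S S' u w : skewsym e -> disconnected e S S' ->
  supported S u -> supported S' w -> u ++ w ~[e] w ++ u.
Proof.
have step st : forall e, skewsym e -> disconnected e S S' -> supported_step S st ->
    supported S' w -> st :: w ~[e] w ++ [:: st].
  elim: w => [|st' w IH] e0 sk d stS //= /andP [stS' wS'].
  apply: mequiv_trans (mequiv_catr w (mequiv_stepC sk d stS stS')) _.
  apply: (@mequiv_catl e0 [:: st']); apply: IH => //; first exact: (skewsym_seq [:: st']).
  by apply/disconnected_sym/disconnected_step/stS'/disconnected_sym;
    do ?[exact: (skewsym_seq [:: st']) | done].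
elim: u e => [|st u IH] e sk d; first by rewrite cats0.
move=> /andP [stS uS] wS'; apply: (@mequiv_trans _ ([:: st] ++ (w ++ u))).
  apply: (@mequiv_catl e [:: st]); apply: IH => //; last exact: disconnected_step.
  exact: (skewsym_seq [:: st]).
by rewrite -[st :: u]cat1s !catA; apply: mequiv_catr; apply: step.
Qed.

Lemma mequiv_mu_conj_disconnected e k S w : skewsym e -> disconnected e [set k] S ->
  supported S w -> w ~[e] mu_conj k w.
Proof.
move=> sk d wS; apply: mequiv_sym; apply: mequiv_trans (@mequiv_cancel e [::] k w sk).
apply: (@mequiv_catl e [:: Mu k] (w ++ [:: Mu k]) (Mu k :: w)); apply: mequiv_sym.
have kS : supported_step [set k] (Mu k) by rewrite /= inE.
apply: (@mequiv_disconnectedC _ [set k] S [:: Mu k]) => //; first exact: skewsym_mut.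
  exact: (@disconnected_step _ _ _ (Mu k)).
by rewrite /supported /= inE eqxx.
Qed.

Lemma mequiv_tperm_word e a b S w : supported S w -> a \notin S -> b \notin S ->
  Perm (tperm a b) :: w ~[e] w ++ [:: Perm (tperm a b)].
Proof.
move=> wS aS bS; elim: w e wS => //= st w IH e /andP [stS wS].
suff: [:: Perm (tperm a b); st] ~[e] [:: st; Perm (tperm a b)].
  move=> /(mequiv_catr w) /mequiv_trans; apply.
  by apply: (@mequiv_catl e [:: st] (_ :: w)); apply: IH.
case: st stS => [k|p] /= stS.
  by apply: mequiv_tpermD; [apply: contraNneq aS => -> | apply: contraNneq bS => ->].
by apply: mequiv_perm_eq; rewrite conjgC tpermJ !(out_perm stS).
Qed.

End MutationEquivalence.

(** * The reflection R(P) along an oriented cycle *)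

Section CycleWords.
Variable V : finType.
Implicit Types (P T : seq V) (x z h : V).

Lemma RP2 x y : RP [:: x; y] = [:: Mu x; Mu y; Perm (tperm x y)].
Proof. by []. Qed.

Lemma RP_cons z T : 1 < size T -> RP (z :: T) = mu_conj z (RP T).
Proof.
rewrite -[T]revK size_rev /mu_conj /RP rev_cons !revK; case: (rev T) => [|y [|x M]] //= _.
by rewrite rev_rcons rev_cons revK map_rcons -cats1 /= -?catA /= -?catA.
Qed.

Lemma supported_RP P : supported [set x in P] (RP P).
Proof.
elim: P => [|z [|x [|y T]] IH] //.
  rewrite RP2 /= !inE !eqxx !orbT /= andbT.
  by apply: subset_trans (tperm_on z x) _; apply/subsetP => a; rewrite !inE.
rewrite RP_cons // /supported /mu_conj /= all_cat /= !inE eqxx /= andbT.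
by apply: supportedS IH; apply/subsetP => a; rewrite !inE => ->; rewrite orbT.
Qed.

Lemma next_cons z h x T : uniq (z :: h :: T) -> x \in h :: T ->
  next (z :: h :: T) x = if x == last h T then z else next (h :: T) x.
Proof.
have next_atE y0 y1 z' T' : uniq (z' :: T') -> x \in z' :: T' ->
    next_at x y0 z' T' = if x == last z' T' then y0 else next_at x y1 z' T'.
  elim: T' z' => [|t T' IH] z' /=; first by rewrite inE => _ ->.
  move=> /andP [zt uT]; rewrite inE.
  case: (eqVneq x z') => [-> _|_ /= xT]; last exact: IH.
  by case: eqP => // zl; rewrite {1}zl mem_last in zt.
move=> /= /andP [zn uT] xT; have -> : x == z = false by apply: contraNF zn => /eqP <-.
by rewrite (next_atE z h).
Qed.

Lemma next_last h T : uniq (h :: T) -> next (h :: T) (last h T) = h.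
Proof.
move=> uT; case: T uT => [|t T] uT; first by rewrite /= if_same.
by rewrite [last _ _]/= next_cons ?mem_last // eqxx.
Qed.

Lemma next_head z h T : next (z :: h :: T) z = h.
Proof. by rewrite /= eqxx. Qed.

Lemma next_insert z h h' T x : x != z ->
  next [:: h, z, h' & T] x = if x == h then z else next [:: h, h' & T] x.
Proof. by move=> xz; rewrite /= (negPf xz); case: eqP. Qed.

Lemma next_inserted z h h' T : z != h -> next [:: h, z, h' & T] z = h'.
Proof. by move=> zh; rewrite /= (negPf zh) eqxx. Qed.

Lemma next_eq_head h x T : uniq (h :: T) -> (next (h :: T) x == h) = (x == last h T).
Proof. by move=> uT; rewrite -[X in _ == X](next_last uT) (can_eq (prev_next uT)). Qed.

End CycleWords.

Section BalancedCycles.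
Local Open Scope ring_scope.
Variables (V : finType).
Implicit Types (e : V -> V -> int) (P T : seq V) (x y z : V).

(* The sum condition says that every vertex, on or off the cycle, has as many arrows to the cycle
   as from it. *)
Record balanced_cycle e P : Prop := BalancedCycle {
  cycle_uniq : uniq P;
  cycle_size : (1 < size P)%N;
  cycle_eps : forall x y, x \in P -> y \in P -> e x y = (next P x == y)%:Z - (next P y == x)%:Z;
  cycle_sum : forall k, \sum_(x <- P) e k x = 0 }.

Lemma balanced_cycle_rot n e P : balanced_cycle e P -> balanced_cycle e (rot n P).
Proof.
case=> uP sP eP bP; split; rewrite ?rot_uniq ?size_rot //.
  by move=> x y; rewrite !mem_rot !next_rot //; apply: eP.
by move=> k; apply: etrans (bP k); apply: perm_big; rewrite perm_rot.
Qed.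

Lemma balanced_cycle_head e z h T x : skewsym e -> balanced_cycle e [:: z, h & T] -> T != [::] ->
  x \in h :: T -> let l := last h T in
  [/\ h != l, x != z, e z x = (x == h)%:Z - (x == l)%:Z,
      [e z x]_+ = (x == h)%:Z & [- e z x]_+ = (x == l)%:Z].
Proof.
move=> sk [uP _ eP _] T0 xT l.
have hl : h != l.
  move: uP T0 => /= /and3P [_ hT _]; rewrite /l; case: (T) hT => //= t T' hT _.
  by apply: contraNneq hT => ->; apply: mem_last.
have xz : x != z by move: uP => /= /andP [zn _]; apply: contraNneq zn => <-.
have ezx : e z x = (x == h)%:Z - (x == l)%:Z.
  rewrite eP ?mem_head //; last by rewrite inE xT orbT.
  by rewrite next_head next_eq_head // (eq_sym h).
have [|px mx] := @pos_part_indicators (x == h) (x == l); last by rewrite ezx.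
by case: eqP => //= ->.
Qed.

Lemma sum_indicator (I : eqType) (T : seq I) h :
  uniq T -> h \in T -> \sum_(x <- T) (x == h)%:Z = 1.
Proof. by move=> uT hT; rewrite (bigD1_seq h) //= eqxx big1 ?addr0 // => x /negPf ->. Qed.

Lemma mut_eps_sum e z T a b : skewsym e -> uniq T -> a \in T -> b \in T -> z \notin T ->
  (forall x, x \in T -> [e z x]_+ = (x == a)%:Z /\ [- e z x]_+ = (x == b)%:Z) ->
  forall k, k != z -> \sum_(x <- T) mut_eps e z k x = \sum_(x <- T) e k x + e k z.
Proof.
move=> sk uT aT bT zT pE k kz; rewrite -[e k z in RHS]pos_partB.
rewrite (eq_big_seq (fun x => e k x + ([e k z]_+ * (x == a)%:Z - [- e k z]_+ * (x == b)%:Z))).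
  by rewrite big_split /= sumrB -!mulr_sumr !sum_indicator ?mulr1.
move=> x xT; have [<- <-] := pE x xT; rewrite mut_eps_neq //.
by apply: contraNneq zT => <-.
Qed.

Lemma balanced_cycle_del e z T : skewsym e -> balanced_cycle e (z :: T) -> (1 < size T)%N ->
  balanced_cycle (mut_eps e z) T.
Proof.
case: T => [|h T] // sk cy T1; have [uP _ eP bP] := cy.
have T0 : T != [::] by case: (T) T1.
have [zT uT] : z \notin h :: T /\ uniq (h :: T) := andP uP.
have head x xT := @balanced_cycle_head e z h T x sk cy T0 xT.
have lT : last h T \in h :: T := mem_last h T.
split=> // [x y xT yT|k].
  have [hl xz _ px mx] := head x xT; have [_ yz _ py my] := head y yT.
  rewrite mut_eps_neq // (sk x z) opprK px mx py my eP; try by rewrite inE ?xT ?yT orbT.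
  have [zx zy] : (z == x) = false /\ (z == y) = false.
    by rewrite !(eq_sym z) (negPf xz) (negPf yz).
  have nl := next_last uT; rewrite !next_cons // (eq_sym x h) (eq_sym y h).
  case: (x =P last h T) => [xl|_]; case: (y =P last h T) => [yl|_]; rewrite ?zx ?zy.
  - by rewrite xl yl nl (negPf hl).
  - by rewrite xl nl (negPf hl); case: (h == y); case: (_ == last h T).
  - by rewrite yl nl (negPf hl); case: (h == x); case: (_ == last h T).
  by case: (h == x); case: (h == y); case: (_ == y); case: (_ == x).
have := bP k; rewrite big_cons; have [->|kz] := eqVneq k z.
  rewrite skewsym_diag // add0r => bz; under eq_bigr do rewrite mut_eps_row.
  by rewrite sumrN bz oppr0.
rewrite addrC => bz; apply: etrans bz.
apply: (mut_eps_sum sk uT (mem_head h T) lT zT _ kz) => x xT.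
by have [_ _ _ -> ->] := head x xT.
Qed.

Lemma twin_rows_tperm e x y : skewsym e -> (forall l, e x l = e y l) ->
  step_eps e (Perm (tperm x y)) = e.
Proof.
move=> sk xy; have row k l : e (tperm x y k) l = e k l by case: tpermP => [->|->|].
by apply: eq_matrix => k l; rewrite /= tpermV row sk row -sk.
Qed.

Lemma cycle2P e x y : balanced_cycle e [:: x; y] ->
  [/\ x != y, e x y = 0 & forall k, e k y = - e k x].
Proof.
case=> /andP [xy _] _ eP bP; rewrite inE in xy; split=> // [|k].
  by rewrite eP ?inE ?eqxx ?orbT //= (eq_sym y) (negPf xy) !eqxx.
by have := bP k; rewrite !big_cons big_nil; lia.
Qed.

(* After the first mutation the rows of x and y coincide. *)
Lemma eps_RP2 e x y : skewsym e -> balanced_cycle e [:: x; y] -> eps_seq e (RP [:: x; y]) = e.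
Proof.
move=> sk /cycle2P [xy exy eky]; have yx : y != x by rewrite eq_sym.
have eyx : e y x = 0 by rewrite sk exy oppr0.
have twins l : mut_eps e x x l = mut_eps e x y l.
  by rewrite mut_eps_row mut_eps_row0 // (sk y l) eky opprK -sk.
rewrite RP2 /= -[LHS]/(step_eps (mut_eps (mut_eps e x) y) (Perm (tperm x y))).
have := perm_mut_eps (mut_eps e x) (tperm x y) x; rewrite tpermV tpermL => <-.
by rewrite twin_rows_tperm ?mut_epsK //; auto.
Qed.

Lemma eps_RP e P : skewsym e -> balanced_cycle e P -> eps_seq e (RP P) = e.
Proof.
elim: P e => [|z T IH] e sk cy; first by case: cy.
have := cycle_size cy; rewrite /= ltnS => T0; have [T1|] := ltnP 1 (size T).
  have cz := balanced_cycle_del sk cy T1.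
  by rewrite RP_cons // /mu_conj -cat1s !eps_seq_cat IH; [apply: mut_epsK | auto | ].
by case: T T0 cy {IH} => [|y [|? ?]] //= _ cy _; apply: eps_RP2.
Qed.

End BalancedCycles.

Section CycleReflections.
Local Open Scope ring_scope.
Variables (V : finType) (K : fieldType) (C : pos_cone K).
Implicit Types (e : V -> V -> int) (P T : seq V) (x y z : V) (u v : seq (mstep V)).

Local Notation "u ~[ e ] v" := (mequiv C e u v) (at level 70).

Lemma mequiv_RP2 e x y : RP [:: x; y] ~[e] mu_conj x [:: Perm (tperm x y)].
Proof.
apply: mequiv_sym; exact: (@mequiv_catl _ _ _ e [:: Mu x] _ _ (mequiv_tpermL _ _ x y)).
Qed.

Lemma mequiv_RPK e P : skewsym e -> balanced_cycle e P -> RP P ++ RP P ~[e] [::].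
Proof.
have conj e' z u : skewsym e' -> u ++ u ~[mut_eps e' z] [::] ->
    mu_conj z u ++ mu_conj z u ~[e'] [::].
  move=> sk /mequiv_mu_conj uu; apply: mequiv_trans (mequiv_mu_conjM _ _ _ _ sk) _.
  by apply: mequiv_trans uu _; apply: mequiv_muK.
elim: P e => [|z T IH] e sk cy; first by case: cy.
have := cycle_size cy; rewrite /= ltnS => T0; have [T1|] := ltnP 1 (size T).
  by rewrite RP_cons //; apply/conj/IH/balanced_cycle_del => //; apply: skewsym_mut.
case: T T0 cy {IH} => [|y [|? ?]] // _ cy _; pose t := [:: Perm (tperm z y) : mstep V].
apply: mequiv_trans (conj e z t sk (mequiv_tpermK _ _ z y)).
apply: mequiv_cat; first exact: mequiv_RP2.
by rewrite eps_RP2 //; apply: mequiv_RP2.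
Qed.

Lemma mequiv_RPC e P Q : skewsym e -> disconnected e [set x in P] [set x in Q] ->
  RP P ++ RP Q ~[e] RP Q ++ RP P.
Proof. by move=> sk d; apply: (mequiv_disconnectedC _ sk d); apply: supported_RP. Qed.

End CycleReflections.

Section CycleRotation.
Local Open Scope ring_scope.
Variables (V : finType) (K : fieldType) (C : pos_cone K).
Implicit Types (e : V -> V -> int) (P T : seq V) (x y z : V).

Local Notation "u ~[ e ] v" := (mequiv C e u v) (at level 70).

Lemma cycle3P e x y z : balanced_cycle e [:: x; y; z] ->
  [/\ x != y, x != z, y != z & [/\ e x y = 1, e y z = 1 & e x z = -1]].
Proof.
case=> /and3P [xT yz _] _ eP _; move: xT yz; rewrite !inE negb_or => /andP [xy xz] yz.
have [yx zx zy] : [/\ y != x, z != x & z != y] by rewrite !(eq_sym _ x) (eq_sym z).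
have nx : next [:: x; y; z] x = y by rewrite /= eqxx.
have ny : next [:: x; y; z] y = z by rewrite /= eqxx (negPf yx).
have nz : next [:: x; y; z] z = x by rewrite /= eqxx (negPf zx) (negPf zy).
do !split => //; rewrite eP ?inE ?eqxx ?orbT // !(nx, ny, nz) eqxx;
  by rewrite ?(negPf xy, negPf zx, negPf yz).
Qed.

(* Inserting mu_x (xz) by a pentagon brings the two mutations at x next to mu_y, and the pentagon
   for x and y turns the word around. *)
Lemma mequiv_RP3_rot1 e x y z : skewsym e -> balanced_cycle e [:: x; y; z] ->
  RP [:: x; y; z] ~[e] RP [:: y; z; x].
Proof.
move=> sk cy; have [xy xz yz [exy eyz exz]] := cycle3P cy.
have [yx zx zy] : [/\ y != x, z != x & z != y] by rewrite !(eq_sym _ x) (eq_sym z).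
pose e2 := eps_seq e [:: Mu x; Mu y].
have eyx : e y x = -1 by rewrite sk exy.
have e2xz : e2 x z = 1.
  rewrite /e2 /= mut_eps_neq // !mut_eps_row mut_eps_neq // exz exy eyz eyx.
  by rewrite !pos_part_units; ring.
rewrite [RP [:: y; z; x]]RP_cons // RP2 [RP [:: x; y; z]]RP_cons // RP2.
apply: (mequiv_trans (v := [:: Mu x; Mu y; Mu z; Mu x; Perm (tperm y z)])).
  exact: (mequiv_at (n := 3) (mequiv_tpermD _ _ yx zx)).
apply: (mequiv_trans (v := [:: Mu x; Mu y; Mu x; Mu z; Mu x; Perm (tperm x z);
    Perm (tperm y z)])).
  apply: mequiv_sym; apply: (mequiv_at (n := 2) (mequiv_pentagonK _ _ xz _)) => //; first by auto.
  by rewrite -[eps_seq _ _]/e2 e2xz.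
apply: (mequiv_trans (v := [:: Mu y; Mu x; Perm (tperm x y); Mu z; Mu x; Perm (tperm x z);
    Perm (tperm y z)])).
  by apply: (mequiv_catr [:: _; _; _; _] (mequiv_pentagon _ sk xy _)); rewrite exy.
apply: (mequiv_trans (v := [:: Mu y; Mu x; Mu z; Perm (tperm x y); Mu x; Perm (tperm x z);
    Perm (tperm y z)])).
  exact: (mequiv_at (n := 2) (mequiv_tpermD _ _ xz yz)).
apply: (mequiv_trans (v := [:: Mu y; Mu x; Mu z; Mu y; Perm (tperm x y); Perm (tperm x z);
    Perm (tperm y z)])).
  exact: (mequiv_at (n := 3) (mequiv_tpermL _ _ x y)).
apply: (mequiv_trans (v := [:: Mu y; Mu z; Mu x; Mu y; Perm (tperm x y); Perm (tperm x z);
    Perm (tperm y z)])).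
  apply: (mequiv_at (n := 1) (mequiv_muC _ _ xz _)) => //; first by auto.
  by rewrite /= mut_eps_neq // exz eyz exy !pos_part_units; ring.
apply: (mequiv_trans (v := [:: Mu y; Mu z; Mu x; Mu y; Perm (tperm x y); Perm (tperm y z);
    Perm (tperm x y)])).
  apply: (mequiv_at (n := 5) (mequiv_perm_eq _ _ (conjgC _ _))) => //.
  by rewrite /= tpermJ tpermD // tpermR.
apply: (mequiv_trans (v := [:: Mu y; Mu z; Mu x; Mu y; Perm (tperm x z)])).
  exact: (mequiv_at (n := 4) (mequiv_tpermJ _ _ xz yz)).
rewrite tpermC; apply: mequiv_sym.
exact: (mequiv_at (n := 3) (mequiv_tpermD _ _ zy xy)).
Qed.

Lemma balanced_cycle_mut_disconnected e z T : skewsym e ->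
  (forall x, x \in T -> x != z /\ e z x = 0) -> balanced_cycle e T ->
  balanced_cycle (mut_eps e z) T.
Proof.
move=> sk zT [uT sT eT bT]; have col k x : x \in T -> mut_eps e z k x = e k x.
  by move=> /zT [xz ezx]; apply: mut_eps_col0.
split=> // [x y xT yT|k]; first by rewrite col // eT.
by apply: etrans (bT k); apply: eq_big_seq => x xT; rewrite col.
Qed.

Lemma mut_eps_head2 e x y T : skewsym e -> balanced_cycle e [:: x, y & T] -> (1 < size T)%N ->
  mut_eps (mut_eps e x) y x y = 1 /\
  forall t, t \in T -> mut_eps (mut_eps e x) y x t = 0.
Proof.
move=> sk cy sT; have cx := balanced_cycle_del sk cy (leqW sT : (1 < size (y :: T))%N).
case: T sT cy cx => [|h T] // sT cy cx; have T0 : T != [::] by case: (T) sT.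
have [yl yx exy _ _] := balanced_cycle_head sk cy (erefl true) (mem_head y _).
split=> [|t tT]; first by rewrite mut_eps_col mut_eps_row exy eqxx (negPf yl) opprK.
have [_ ty _ pt mt] := balanced_cycle_head (skewsym_mut x sk) cx T0 tT.
have tyT : t \in [:: y, h & T] by rewrite inE tT orbT.
have [_ tx ext _ _] := balanced_cycle_head sk cy (erefl true) tyT.
rewrite mut_eps_neq ?(eq_sym x) // !mut_eps_row pt mt ext exy eqxx (negPf yl) (negPf ty).
by rewrite subr0 !pos_part_units /= mul0r mul1r sub0r opprK addrN.
Qed.

Lemma balanced_cycle_mut3 e x y T (e3 := mut_eps (mut_eps (mut_eps e x) y) x) : skewsym e ->
  balanced_cycle e [:: x, y & T] -> (1 < size T)%N ->
  [/\ e3 x y = -1, balanced_cycle e3 T & disconnected e3 [set x] [set t in T]].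
Proof.
move=> sk cy sT; have [e2xy e2xT] := mut_eps_head2 sk cy sT.
have [xyT _] := andP (cycle_uniq cy); rewrite inE negb_or in xyT; have [xy xT] := andP xyT.
have cx := balanced_cycle_del sk cy (leqW sT : (1 < size (y :: T))%N).
have neq t : t \in T -> t != x by move=> tT; apply: contraNneq xT => <-.
split=> [||a t]; first by rewrite /e3 mut_eps_row e2xy.
  apply: balanced_cycle_mut_disconnected => [|t tT|]; first by auto.
    by rewrite neq ?e2xT.
  exact: (balanced_cycle_del (skewsym_mut x sk) cx).
by rewrite !inE => /eqP-> tT; rewrite eq_sym neq // /e3 mut_eps_row e2xT ?oppr0.
Qed.

(* Inserting two mutations at x, the pentagon relation turns both ends of the word around. *)
Lemma mequiv_RP_swap e x y T : skewsym e -> balanced_cycle e [:: x, y & T] -> (1 < size T)%N ->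
  mu_conj x (mu_conj y (RP T)) ~[e] mu_conj y (mu_conj x (RP T)).
Proof.
move=> sk cy sT; have [e3xy c3 dxT] := balanced_cycle_mut3 sk cy sT.
have [xyT yT _] := and3P (cycle_uniq cy); rewrite inE negb_or in xyT; have [xy xT] := andP xyT.
have exy : (e x y == 1) || (e x y == -1).
  have T0 : T != [::] by case: (T) sT.
  have [yl _ -> _ _] := balanced_cycle_head sk cy T0 (mem_head y _).
  by rewrite eqxx (negPf yl).
set e3 := mut_eps _ _ in e3xy c3 dxT; have sk3 : skewsym e3 by do 3!apply: skewsym_mut.
have epsR : eps_seq e ([:: Mu x; Mu y; Mu x] ++ RP T) = e3.
  by rewrite eps_seq_cat -[eps_seq e _]/e3 eps_RP.
have sR := supported_RP T; set R := RP T in epsR sR *.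
rewrite /mu_conj /= -!catA /=.
apply: (mequiv_trans (v := [:: Mu x, Mu y, Mu x, Mu x & R ++ [:: Mu y; Mu x]])).
  by apply: mequiv_sym; exact: (mequiv_cancel _ [:: Mu x; Mu y] x _ sk).
apply: (mequiv_trans (v := [:: Mu x; Mu y; Mu x] ++ (R ++ [:: Mu x]) ++ [:: Mu y; Mu x])).
  apply: (@mequiv_ctx _ _ C e [:: Mu x; Mu y; Mu x] (Mu x :: R) (R ++ [:: Mu x])).
  apply: (mequiv_disconnectedC _ sk3 dxT (_ : supported _ [:: Mu x]) sR).
  by rewrite /supported /= inE eqxx.
apply: (mequiv_trans (v := ([:: Mu x; Mu y; Mu x] ++ R) ++
    [:: Perm (tperm x y); Mu x; Mu y])).
  rewrite -!catA catA; apply: mequiv_catl; rewrite epsR.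
  by apply: mequiv_pentagonV; rewrite // e3xy.
rewrite -catA; apply: mequiv_trans (mequiv_catr _ (mequiv_pentagon C sk xy exy)) _.
apply: (mequiv_trans (v := [:: Mu y; Mu x] ++ R ++ [:: Perm (tperm x y); Perm (tperm x y);
    Mu x; Mu y])).
  apply: (@mequiv_catl _ _ C e [:: Mu y; Mu x] (Perm _ :: R ++ _)).
  rewrite -cat_cons -[[:: Perm _, Perm _ & _]]cat1s catA; apply: mequiv_catr.
  by apply: mequiv_tperm_word sR _ _; rewrite inE.
rewrite !catA; exact: (mequiv_ctx _ (mequiv_tpermK _ _ x y)).
Qed.

Lemma mequiv_RP_rot1 e z T : skewsym e -> balanced_cycle e (z :: T) ->
  RP (z :: T) ~[e] RP (rcons T z).
Proof.
elim: {T}(size T) {-2}T (leqnn (size T)) e z => [|n IH] [|y T] sT e z sk cy; try by case: cy.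
case: T sT cy => [|t [|t' T]] sT cy.
- have [zy ezy _] := cycle2P cy; rewrite -[rcons _ _]/[:: y; z] !RP2 tpermC.
  exact: (mequiv_at (n := 0) (mequiv_muC _ _ zy _)).
- exact: mequiv_RP3_rot1.
set U := [:: t, t' & T] in sT cy *.
have cU : balanced_cycle (mut_eps e y) (z :: U).
  have -> : z :: U = rot (size U) (rcons U z) by rewrite -cats1 rot_size_cat.
  apply/balanced_cycle_rot/balanced_cycle_del; rewrite ?size_rcons // -rcons_cons -rot1_cons.
  exact: balanced_cycle_rot.
rewrite rcons_cons [RP [:: z, y & U]]RP_cons // [RP (y :: U)]RP_cons //.
rewrite [RP (y :: rcons U z)]RP_cons ?size_rcons //.
apply: mequiv_trans (mequiv_RP_swap sk cy _) _ => //.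
by rewrite -RP_cons //; apply: mequiv_mu_conj; apply: IH => //; apply: skewsym_mut.
Qed.

Lemma mequiv_RP_rot n e P : skewsym e -> balanced_cycle e P -> RP P ~[e] RP (rot n P).
Proof.
move=> sk cy; elim: n => [|n IH]; first by rewrite rot0.
have [lt|le] := ltnP n (size P); last by rewrite rot_oversize // ltnW.
apply: mequiv_trans IH _; rewrite rotS //.
have := balanced_cycle_rot n cy; case: (rot n P) => [|z T] cn; first by case: cn.
by rewrite rot1_cons; apply: mequiv_RP_rot1.
Qed.

Lemma mequiv_RP_del e P1 z P2 : skewsym e -> balanced_cycle e (P1 ++ z :: P2) ->
  (1 < size (P1 ++ P2))%N -> balanced_cycle (mut_eps e z) (P1 ++ P2) /\
  RP (P1 ++ z :: P2) ~[e] mu_conj z (RP (P1 ++ P2)).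
Proof.
move=> sk cy; rewrite size_cat addnC -size_cat => s21.
have cz := balanced_cycle_rot (size P1) cy; rewrite rot_size_cat in cz.
have c21 : balanced_cycle (mut_eps e z) (P2 ++ P1) := balanced_cycle_del sk cz s21.
have c12 := balanced_cycle_rot (size P2) c21; rewrite rot_size_cat in c12.
split=> //; apply: mequiv_trans (mequiv_RP_rot (size P1) sk cy) _.
rewrite rot_size_cat RP_cons //; apply: mequiv_mu_conj.
by rewrite -[P1 ++ P2]rot_size_cat; apply: mequiv_RP_rot => //; apply: skewsym_mut.
Qed.

End CycleRotation.

(** * Braid relation for linked cycles *)

Section LinkedCycles.
Local Open Scope ring_scope.
Variables (V : finType) (K : fieldType) (C : pos_cone K).
Implicit Types (e : V -> V -> int) (P A B : seq V) (g : V -> V) (u v : seq (mstep V)).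

Local Notation "u ~[ e ] v" := (mequiv C e u v) (at level 70).

Definition braided e u v := u ++ v ++ u ~[e] v ++ u ++ v.

Lemma braided_sym e u v : braided e u v -> braided e v u.
Proof. exact: mequiv_sym. Qed.

Lemma braided_mequiv e u v u' v' : u ~[e] u' -> v ~[e] v' -> eps_seq e u = e ->
  eps_seq e v = e -> braided e u' v' -> braided e u v.
Proof.
move=> uu' vv' eu ev uv'.
have cat3 a b a' b' : eps_seq e a = e -> eps_seq e b = e -> a ~[e] a' -> b ~[e] b' ->
    a ++ b ++ a ~[e] a' ++ b' ++ a'.
  by move=> ea eb aa' bb'; do 2?[apply: mequiv_cat; rewrite ?ea ?eb //].
apply: mequiv_trans (cat3 u v _ _ eu ev uu' vv') _; apply: mequiv_trans uv' _.
exact/mequiv_sym/cat3.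
Qed.

Lemma braided_mu_conj e k u v u' v' : skewsym e -> u ~[e] mu_conj k u' ->
  v ~[e] mu_conj k v' -> eps_seq e u = e -> eps_seq e v = e ->
  braided (mut_eps e k) u' v' -> braided e u v.
Proof.
move=> sk uu' vv' eu ev uv'; apply: (braided_mequiv uu' vv' eu ev).
have conj3 a b : eps_seq e (mu_conj k a) = e ->
    mu_conj k a ++ mu_conj k b ++ mu_conj k a ~[e] mu_conj k (a ++ b ++ a).
  move=> ea; apply: mequiv_trans (mequiv_mu_conjM _ _ _ _ sk).
  by apply: mequiv_catl; rewrite ea; apply: mequiv_mu_conjM.
apply: mequiv_trans (conj3 _ _ _) _; first by rewrite -(mequiv_eps uu').
apply: mequiv_trans (mequiv_mu_conj uv') _.
by apply/mequiv_sym/conj3; rewrite -(mequiv_eps vv').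
Qed.

Lemma eps_mequiv_mu_conj e k u u' : u ~[e] mu_conj k u' -> eps_seq e u = e ->
  eps_seq (mut_eps e k) u' = mut_eps e k.
Proof. by move=> /mequiv_eps uu' eu; apply: eps_mu_conj; rewrite -uu'. Qed.

Lemma braided_tperm e a b c : a != b -> a != c -> b != c ->
  braided e [:: Perm (tperm a b)] [:: Perm (tperm b c)].
Proof.
move=> ab ac bc; apply: mequiv_trans (mequiv_tpermJ _ _ ac bc) _; apply: mequiv_sym.
rewrite (tpermC b c) (tpermC a b) (tpermC a c).
by apply: mequiv_tpermJ; rewrite eq_sym.
Qed.

Lemma mequiv_tperm_mu_conj e a b k : skewsym e -> a != k -> b != k ->
  [:: Perm (tperm a b)] ~[e] mu_conj k [:: Perm (tperm a b)].
Proof.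
move=> sk ak bk; apply: mequiv_sym.
apply: (mequiv_trans (v := [:: Mu k; Mu k; Perm (tperm a b)])).
  exact: (mequiv_at (n := 1) (mequiv_tpermD _ _ ak bk)).
exact: (mequiv_cancel _ [::]).
Qed.

Section Insertion.
Variables (e : V -> V -> int) (z b1 b2 : V) (B : seq V).
Local Notation P := [:: b1, b2 & B].
Local Notation Q := [:: b1, z, b2 & B].
Hypotheses (sk : skewsym e) (cP : balanced_cycle e P) (zP : z \notin P)
  (ez : forall y, y \in P -> e z y = (y == b1)%:Z - (y == b2)%:Z).

Let uP := cycle_uniq cP.
Let b1P : b1 \in P. Proof. exact: mem_head. Qed.
Let b2P : b2 \in P. Proof. by rewrite !inE eqxx orbT. Qed.
Let b12 : b1 != b2. Proof. by case/andP: uP; rewrite inE negb_or => /andP []. Qed.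
Let neqz y (yP : y \in P) : y != z. Proof. by apply: contraTneq yP => ->. Qed.
Let z_neq y (yP : y \in P) : (z == y) = false. Proof. by rewrite eq_sym (negPf (neqz yP)). Qed.

Let pos_parts_z y : y \in P -> [e z y]_+ = (y == b1)%:Z /\ [- e z y]_+ = (y == b2)%:Z.
Proof.
move=> yP; rewrite ez //; apply: pos_part_indicators.
by case: eqP => //= ->.
Qed.

Let next_z : next Q z = b2. Proof. by rewrite next_inserted // z_neq. Qed.

Let next_eq_z x : x \in P -> (next Q x == z) = (x == b1).
Proof.
move=> xP; rewrite next_insert ?neqz //; case: (x =P b1); rewrite ?eqxx // (negPf (neqz _)) //.
by rewrite mem_next.
Qed.

Let next_eq x y : x \in P -> y \in P ->
  (next Q x == y)%:Z = (next P x == y)%:Z - ((x == b1) && (y == b2))%:Z.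
Proof.
move=> xP yP; rewrite next_insert ?neqz //; case: (x =P b1) => [->|_]; rewrite ?subr0 //.
by rewrite next_head z_neq // (eq_sym b2) subrr.
Qed.

Lemma mut_eps_insert x y : x \in Q -> y \in Q ->
  mut_eps e z x y = (next Q x == y)%:Z - (next Q y == x)%:Z.
Proof.
have skz := skewsym_mut z sk; have QE t : (t \in Q) = (t == z) || (t \in P).
  by rewrite !inE; do 2!case: (t == _).
have row_z t : t \in P -> mut_eps e z z t = (next Q z == t)%:Z - (next Q t == z)%:Z.
  by move=> tP; rewrite mut_eps_row ez // next_z next_eq_z // (eq_sym b2) opprB.
rewrite !QE => /orP [/eqP->|xP] /orP [/eqP->|yP].
- by rewrite skewsym_diag // subrr.
- exact: row_z.
- by rewrite skz row_z // opprB.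
have [[px mx] [py my]] := (pos_parts_z xP, pos_parts_z yP).
rewrite mut_eps_neq ?neqz // (sk x z) opprK px mx py my (cycle_eps cP) // !next_eq //.
by case: (x == b1); case: (x == b2); case: (y == b1); case: (y == b2);
   case: (_ == y); case: (_ == x).
Qed.

Lemma balanced_cycle_insert : balanced_cycle (mut_eps e z) Q.
Proof.
split=> // [|x y|k]; [|exact: mut_eps_insert|].
  move: uP zP; rewrite /= !inE !negb_or (eq_sym z b1).
  by move=> /and3P [/andP [-> ->] -> ->] /and3P [-> -> ->].
have QP : perm_eq Q (z :: P) by rewrite (perm_catCA [:: b1] [:: z]).
have bP := cycle_sum cP; rewrite (perm_big _ QP) /= big_cons; have [->|kz] := eqVneq k z.
  rewrite skewsym_diag ?add0r; last exact: skewsym_mut.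
  by under eq_bigr do rewrite mut_eps_row; rewrite sumrN bP oppr0.
by rewrite (mut_eps_sum sk uP b1P b2P zP pos_parts_z kz) bP add0r mut_eps_col addNr.
Qed.

End Insertion.

Lemma mequiv_RP_insert e z b1 b2 B : skewsym e ->
  balanced_cycle (mut_eps e z) [:: b1, z, b2 & B] ->
  RP [:: b1, b2 & B] ~[e] mu_conj z (RP [:: b1, z, b2 & B]).
Proof.
move=> sk cz; have [//|_ /mequiv_mu_conj del] :=
  @mequiv_RP_del _ _ C _ [:: b1] z (b2 :: B) (skewsym_mut z sk) cz.
by apply/mequiv_sym/(mequiv_trans del)/mequiv_mu_conjK.
Qed.

(* The vertex x of A has one arrow to its anchor g x in B and one arrow from the anchor of its
   successor in A; the anchors occur in B in the cyclic order of A. *)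
Record linked e A g B : Prop := Linked {
  linked_left : balanced_cycle e A;
  linked_right : balanced_cycle e B;
  linked_subseq : subseq (map g A) B;
  linked_disjoint : forall x, x \in A -> x \notin B;
  linked_eps : forall x y, x \in A -> y \in B ->
    e x y = (y == g x)%:Z - (y == g (next A x))%:Z }.

Lemma braided_linked_del e A g B1 z B2 : skewsym e -> linked e A g (B1 ++ z :: B2) ->
  z \notin map g A ->
  (linked (mut_eps e z) A g (B1 ++ B2) -> braided (mut_eps e z) (RP A) (RP (B1 ++ B2))) ->
  braided e (RP A) (RP (B1 ++ z :: B2)).
Proof.
move=> sk [cA cB sub dj eAB] zg IH; have uB := cycle_uniq cB.
have sub' : subseq (map g A) (B1 ++ B2).
  have gE := elimT (subseq_uniqP uB) sub.
  by rewrite gE filter_cat /= (negPf zg) -filter_cat filter_subseq.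
have s2 : (1 < size (B1 ++ B2))%N.
  by apply: leq_trans (size_subseq sub'); rewrite size_map; case: cA.
have [cB' delB] := mequiv_RP_del C sk cB s2.
have sB x : x \in B1 ++ B2 -> x \in B1 ++ z :: B2.
  by rewrite !mem_cat inE => /orP [->|->]; rewrite ?orbT.
have zB : z \in B1 ++ z :: B2 by rewrite mem_cat mem_head orbT.
have eAz x : x \in A -> x != z /\ e z x = 0.
  move=> xA; split; first by apply: contraNneq (dj x xA) => ->.
  have neq y : y \in A -> (z == g y) = false.
    by move=> yA; apply: contraNF zg => /eqP->; apply: map_f.
  by rewrite sk eAB // !neq ?mem_next // oppr0.
apply: (@braided_mu_conj e z _ _ (RP A) _ sk _ delB); try exact: eps_RP.
- apply: mequiv_mu_conj_disconnected (supported_RP A) => // x y.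
  by rewrite !inE => /eqP -> /eAz [yz ezy]; rewrite eq_sym.
apply: IH; split=> //; first exact: balanced_cycle_mut_disconnected.
  by move=> x xA; apply: contra (dj x xA); apply: sB.
move=> x y xA /sB yB; have [xz ezx] := eAz x xA.
have exz : e x z = 0 by rewrite sk ezx oppr0.
by rewrite mut_eps_row0 // eAB.
Qed.

Section LinkedHead.
Variables (e : V -> V -> int) (a1 a2 b1 b2 : V) (A B : seq V) (g : V -> V).
Local Notation P := [:: a1, a2 & A].
Local Notation Q := [:: b1, b2 & B].
Hypotheses (sk : skewsym e) (A0 : A != [::]) (L : linked e P g Q) (gP : map g P = Q).

Let g' x := if x == a2 then a1 else g x.
Let cA := linked_left L.
Let cB := linked_right L.
Let gE : [/\ g a1 = b1, g a2 = b2 & map g A = B]. Proof. by case: gP. Qed.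
Let a1P : a1 \in P. Proof. exact: mem_head. Qed.
Let a1Q : a1 \notin Q. Proof. exact: linked_disjoint L _ a1P. Qed.
Let neqa1 y (yQ : y \in Q) : y != a1. Proof. by apply: contraNneq a1Q => <-. Qed.
Let gQ x (xP : x \in P) : g x \in Q. Proof. by rewrite -gP map_f. Qed.
Let a1_neq_g x (xP : x \in P) : (a1 == g x) = false.
Proof. by rewrite eq_sym (negPf (neqa1 (gQ xP))). Qed.
Let uP := cycle_uniq cA.
Let a1A : a1 \notin a2 :: A. Proof. by case/andP: uP. Qed.
Let uA : uniq (a2 :: A). Proof. by case/andP: uP. Qed.
Let AP x (xA : x \in a2 :: A) : x \in P. Proof. by rewrite inE xA orbT. Qed.

Let row_a1 y : y \in Q -> e a1 y = (y == b1)%:Z - (y == b2)%:Z.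
Proof. by move=> yQ; rewrite (linked_eps L) // next_head; have [-> -> _] := gE. Qed.

Let pos_parts_a1 y : y \in Q -> [e a1 y]_+ = (y == b1)%:Z /\ [- e a1 y]_+ = (y == b2)%:Z.
Proof.
move=> yQ; rewrite row_a1 //; apply: pos_part_indicators; case: eqP => //= ->.
by case/andP: (cycle_uniq cB); rewrite inE negb_or => /andP [].
Qed.

Lemma linked_head_anchor_a1 x : x \in a2 :: A ->
  mut_eps e a1 x a1 = (a1 == g' x)%:Z - (a1 == g' (next (a2 :: A) x))%:Z.
Proof.
move=> xA; have nA : next (a2 :: A) x \in P by rewrite AP ?mem_next.
have [_ _ a1x _ _] := balanced_cycle_head sk cA A0 xA.
rewrite mut_eps_col -sk a1x /g' next_eq_head //; congr (_ - _).
  by case: eqP => _; rewrite ?eqxx // a1_neq_g // AP.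
by case: eqP => _; rewrite ?eqxx // a1_neq_g.
Qed.

Lemma linked_head_anchor x y : x \in a2 :: A -> y \in Q ->
  mut_eps e a1 x y = (y == g' x)%:Z - (y == g' (next (a2 :: A) x))%:Z.
Proof.
move=> xA yQ; have [b1E b2E _] := gE; have ya1 := negPf (neqa1 yQ).
have nP : next P x = if x == last a2 A then a1 else next (a2 :: A) x by apply: next_cons.
have xa1 : x != a1 by apply: contraNneq a1A => <-.
have la2 : a2 != last a2 A.
  case: (A) A0 uA => // a3 A' _ /andP [a2A _].
  by apply: contraNneq a2A => ->; apply: (mem_last a3).
have [_ _ _ px mx] := balanced_cycle_head sk cA A0 xA; have [py my] := pos_parts_a1 yQ.
rewrite mut_eps_neq ?(neqa1 yQ) // (sk x a1) opprK px mx py my (linked_eps L) ?AP //.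
rewrite /g' next_eq_head // nP; have [->|xa2] := eqVneq x a2.
  rewrite (negPf la2) ya1 b2E.
  by case: (y == b1); case: (y == b2); case: (y == g _).
by case: (x == last a2 A); rewrite ?ya1 ?b1E; case: (y == b1); case: (y == b2);
  case: (y == g x); case: (y == g _).
Qed.

Lemma linked_mut_head : linked (mut_eps e a1) (a2 :: A) g' [:: b1, a1, b2 & B].
Proof.
split=> [||| x xA|x y xA yQ].
- by apply: balanced_cycle_del => //; case: (A) A0.
- exact: balanced_cycle_insert.
- rewrite /= /g' eqxx (_ : map _ A = B); last first.
    have [_ _ <-] := gE; apply/eq_in_map => x xA; case: eqP => // xa2.
    by case/andP: uA; rewrite -xa2 xA.
  by apply: (@cat_subseq _ [:: a1] B [:: b1; a1] (b2 :: B)); rewrite ?subseq_cons ?suffix_subseq.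
- rewrite !inE !negb_or; have := linked_disjoint L (AP xA); rewrite !inE !negb_or.
  by move=> /and3P [-> -> ->] /=; rewrite andbT; apply: contraNneq a1A => <-.
have [->|ya1] := eqVneq y a1; first exact: linked_head_anchor_a1.
by apply: linked_head_anchor => //; move: yQ; rewrite !inE (negPf ya1).
Qed.

End LinkedHead.

Lemma braided_linked2 e a1 a2 g b1 b2 : skewsym e -> linked e [:: a1; a2] g [:: b1; b2] ->
  g a1 = b1 -> g a2 = b2 -> braided e (RP [:: a1; a2]) (RP [:: b1; b2]).
Proof.
move=> sk [cA cB _ dj eAB] ga1 ga2; have [a12 _ _] := cycle2P cA.
have [a1B a2B] : a1 \notin [:: b1; b2] /\ a2 \notin [:: b1; b2].
  by split; apply: dj; rewrite !inE eqxx ?orbT.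
have cB' : balanced_cycle (mut_eps e a1) [:: b1; a1; b2].
  apply: balanced_cycle_insert => // y yB.
  by rewrite eAB ?mem_head // next_head ga1 ga2.
move: a1B a2B; rewrite !inE !negb_or => /andP [a1b1 a1b2] /andP [a2b1 a2b2].
have sk1 : skewsym (mut_eps e a1) := skewsym_mut a1 sk; set e1 := mut_eps e a1 in cB' sk1.
have sk2 : skewsym (mut_eps e1 b1) := skewsym_mut b1 sk1; set e2 := mut_eps e1 b1 in sk2.
have cB2 : balanced_cycle e2 [:: a1; b2] by apply: balanced_cycle_del.
have conjA := mequiv_RP2 C e a1 a2; have conjB := mequiv_RP_insert sk cB'.
have fixes_e1 := eps_mequiv_mu_conj conjA (eps_RP sk cA).
have conjT1 := mequiv_tperm_mu_conj sk1 a1b1 a2b1.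
have fixes_e2 := eps_mequiv_mu_conj conjT1 fixes_e1.
have conjT2 := mequiv_tperm_mu_conj sk2 a1b2 a2b2.
have conjB2 : RP [:: a1; b2] ~[e2] mu_conj b2 [:: Perm (tperm b2 a1)].
  apply: mequiv_trans (mequiv_RP_rot1 C sk2 cB2) _; exact: mequiv_RP2.
apply: (braided_mu_conj sk conjA conjB); try exact: eps_RP.
have conjB1 : RP [:: b1; a1; b2] ~[e1] mu_conj b1 (RP [:: a1; b2]) by rewrite RP_cons.
apply: (braided_mu_conj sk1 conjT1 conjB1 fixes_e1); first exact: eps_RP.
apply: (braided_mu_conj sk2 conjT2 conjB2 fixes_e2); first exact: eps_RP.
by rewrite tpermC (tpermC b2); apply: braided_tperm; rewrite // eq_sym.
Qed.

Lemma braided_linked e A g B : skewsym e -> linked e A g B -> braided e (RP A) (RP B).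
Proof.
have [n] := ubnP (2 * size A + size B)%N; elim: n => // n IH in e A g B *.
rewrite ltnS => le sk L; have cB := linked_right L.
have [/allP Bg|/allPn [z zB zg]] := boolP (all (mem (map g A)) B); last first.
  case/splitPr: zB le L {cB} => B1 B2 le L; apply: (braided_linked_del sk L zg) => L'.
  by apply: IH L'; [move: le; rewrite !size_cat /=; lia | apply: skewsym_mut].
have gA : map g A = B.
  by rewrite (elimT (subseq_uniqP (cycle_uniq cB)) (linked_subseq L)); apply/all_filterP/allP.
have sA := cycle_size (linked_left L).
case: A sA le L gA {Bg} => [|a1 [|a2 A]] // _ le L gA; subst B.
have [A0|A0] := eqVneq A [::]; first by rewrite A0 in L *; apply: braided_linked2 L _ _.
have L' := linked_mut_head sk A0 L (erefl _).
have conjA : RP [:: a1, a2 & A] ~[e] mu_conj a1 (RP (a2 :: A)).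
  by rewrite RP_cons //; case: (A) A0.
apply: (braided_mu_conj sk conjA (mequiv_RP_insert sk (linked_right L'))).
- exact: eps_RP (linked_left L).
- exact: eps_RP cB.
by apply: IH L'; [move: le; rewrite /= size_map; lia | apply: skewsym_mut].
Qed.

End LinkedCycles.

(** * Valuations and tropical seeds *)

Section FractionCone.
Local Open Scope ring_scope.
Variables (R : idomainType) (pos : R -> Prop).
Hypotheses (pos1 : pos 1) (posD : forall x y, pos x -> pos y -> pos (x + y))
  (posM : forall x y, pos x -> pos y -> pos (x * y)) (pos_neq0 : forall x, pos x -> x != 0).

Local Notation "x %:F" := (@FracField.tofrac R x).

Definition frac_pos (x : {fraction R}) := exists p q, [/\ pos p, pos q & x = p%:F / q%:F].

Lemma tofrac_neq0 p : pos p -> p%:F != 0.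
Proof. by move=> /pos_neq0; rewrite tofrac_eq0. Qed.

Lemma tofrac_addf_div p q p' q' : pos q -> pos q' ->
  p%:F / q%:F + p'%:F / q'%:F = (p * q' + p' * q)%:F / (q * q')%:F.
Proof. by move=> /tofrac_neq0 q0 /tofrac_neq0 q0'; rewrite tofracD !tofracM addf_div. Qed.

Lemma tofrac_mulf_div p q p' q' : (p%:F / q%:F) * (p'%:F / q'%:F) = (p * p')%:F / (q * q')%:F.
Proof. by rewrite !tofracM mulf_div. Qed.

Lemma tofrac_frac_pos p : pos p -> frac_pos p%:F.
Proof. by exists p, 1; rewrite tofrac1 divr1. Qed.

Lemma frac_pos1 : frac_pos 1.
Proof. by rewrite -tofrac1; apply: tofrac_frac_pos. Qed.

Lemma frac_posD x y : frac_pos x -> frac_pos y -> frac_pos (x + y).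
Proof.
move=> [p [q [posp posq ->]]] [p' [q' [posp' posq' ->]]]; rewrite tofrac_addf_div //.
by do 2!eexists; split; last reflexivity; do ?[apply: posD | apply: posM].
Qed.

Lemma frac_posM x y : frac_pos x -> frac_pos y -> frac_pos (x * y).
Proof.
move=> [p [q [posp posq ->]]] [p' [q' [posp' posq' ->]]]; rewrite tofrac_mulf_div.
by do 2!eexists; split; last reflexivity; apply: posM.
Qed.

Lemma frac_posV x : frac_pos x -> frac_pos x^-1.
Proof. by move=> [p [q [posp posq ->]]]; exists q, p; split => //; rewrite invf_div. Qed.

Lemma frac_pos_neq0 x : frac_pos x -> x != 0.
Proof. by move=> [p [q [posp posq ->]]]; rewrite mulf_neq0 ?invr_eq0 ?tofrac_neq0. Qed.

Definition frac_cone : pos_cone {fraction R} :=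
  PosCone frac_pos1 frac_posD frac_posM frac_posV frac_pos_neq0.

End FractionCone.

Section GenericSeed.
Local Open Scope ring_scope.

Section MPoly.
Variable n : nat.
Implicit Types p q : {mpoly rat[n]}.

Definition mpoly_pos p : Prop := 0 < p.@[fun=> 1].

Lemma mpoly_pos1 : mpoly_pos 1. Proof. by rewrite /mpoly_pos rmorph1. Qed.

Lemma mpoly_posD p q : mpoly_pos p -> mpoly_pos q -> mpoly_pos (p + q).
Proof. by rewrite /mpoly_pos rmorphD; apply: addr_gt0. Qed.

Lemma mpoly_posM p q : mpoly_pos p -> mpoly_pos q -> mpoly_pos (p * q).
Proof. by rewrite /mpoly_pos rmorphM; apply: mulr_gt0. Qed.

Lemma mpoly_pos_neq0 p : mpoly_pos p -> p != 0.
Proof. by rewrite /mpoly_pos; apply: contraTneq => ->; rewrite rmorph0 ltxx. Qed.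

Definition mpoly_cone : pos_cone {fraction {mpoly rat[n]}} :=
  frac_cone mpoly_pos1 mpoly_posD mpoly_posM mpoly_pos_neq0.

End MPoly.

Lemma pos_generic_seed (V : finType) e : pos_seed (mpoly_cone (nvars V)) (@generic_seed V e).
Proof.
by split=> v; apply: (tofrac_frac_pos (@mpoly_pos1 _)); rewrite /mpoly_pos mevalXU.
Qed.

Lemma mequiv_same_in_Gamma (V : finType) (e : V -> V -> int) (u v : seq (mstep V)) :
  mequiv (mpoly_cone (nvars V)) e u v -> same_in_Gamma e u v.
Proof.
by move=> uv; rewrite /same_in_Gamma (apply_seq_mequiv uv) //; apply: pos_generic_seed.
Qed.

End GenericSeed.

Section Valuation.
Local Open Scope ring_scope.
Implicit Types p q : {poly rat}.

Definition lead_pos p : Prop := 0 < lead_coef p.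

Lemma lead_pos1 : lead_pos 1. Proof. by rewrite /lead_pos lead_coef1. Qed.

Lemma lead_posM p q : lead_pos p -> lead_pos q -> lead_pos (p * q).
Proof. by rewrite /lead_pos lead_coefM; apply: mulr_gt0. Qed.

Lemma lead_pos_neq0 p : lead_pos p -> p != 0.
Proof. by rewrite /lead_pos; apply: contraTneq => ->; rewrite lead_coef0 ltxx. Qed.

Lemma lead_posD_size p q : lead_pos p -> lead_pos q ->
  lead_pos (p + q) /\ size (p + q) = maxn (size p) (size q).
Proof.
move=> lp lq; case: (ltngtP (size p) (size q)) => pq.
- by rewrite addrC /lead_pos lead_coefDl // size_polyDl.
- by rewrite /lead_pos lead_coefDl // size_polyDl.
have top : (p + q)`_(size p).-1 = lead_coef p + lead_coef q by rewrite coefD !lead_coefE pq.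
have top_gt0 : 0 < (p + q)`_(size p).-1 by rewrite top; apply: addr_gt0.
have sE : size (p + q) = size p.
  apply/eqP; rewrite eqn_leq (leq_trans (size_polyD p q)) ?pq ?maxnn //= -pq leqNgt.
  apply: contraL top_gt0 => lt; rewrite nth_default ?ltxx //.
  by rewrite -ltnS prednK // lt0n size_poly_eq0 lead_pos_neq0.
by rewrite sE; split; rewrite // /lead_pos lead_coefE sE.
Qed.

Lemma lead_posD p q : lead_pos p -> lead_pos q -> lead_pos (p + q).
Proof. by move=> lp lq; case: (lead_posD_size lp lq). Qed.

Lemma lead_pos_sizeM p q : lead_pos p -> lead_pos q ->
  (size (p * q))%:Z = (size p)%:Z + (size q)%:Z - 1.
Proof.
move=> /lead_pos_neq0 p0 /lead_pos_neq0 q0; rewrite size_mul //.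
by move: p0 q0; rewrite -!size_poly_gt0; move: (size p) (size q) => a b; lia.
Qed.

Definition poly_cone : pos_cone {fraction {poly rat}} :=
  frac_cone lead_pos1 lead_posD lead_posM lead_pos_neq0.

Local Notation "x %:F" := (@FracField.tofrac {poly rat} x).

(* The order of vanishing at infinity of a quotient of polynomials with positive leading
   coefficients; no cancellation occurs in sums of such quotients. *)
Definition has_order (x : {fraction {poly rat}}) (n : int) := exists p q,
  [/\ lead_pos p, lead_pos q, x = p%:F / q%:F & n = (size q)%:Z - (size p)%:Z].

Lemma has_order_cone x n : has_order x n -> poly_cone x.
Proof. by move=> [p [q [? ? ? _]]]; exists p, q. Qed.

Lemma has_order_inj x n n' : has_order x n -> has_order x n' -> n = n'.
Proof.
move=> [p [q [lp lq -> ->]]] [p' [q' [lp' lq' /eqP E ->]]]; move: E.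
rewrite eqr_div ?(tofrac_neq0 lead_pos_neq0) // -!tofracM tofrac_eq => /eqP E.
by have := lead_pos_sizeM lp lq'; rewrite E lead_pos_sizeM //; lia.
Qed.

Lemma has_order1 : has_order 1 0.
Proof. by exists 1, 1; split; rewrite ?tofrac1 ?divr1 ?subrr //; apply: lead_pos1. Qed.

Lemma has_orderM x y n n' : has_order x n -> has_order y n' -> has_order (x * y) (n + n').
Proof.
move=> [p [q [lp lq -> ->]]] [p' [q' [lp' lq' -> ->]]]; exists (p * p'), (q * q').
split; try exact: lead_posM; first by rewrite tofrac_mulf_div.
by rewrite !lead_pos_sizeM //; ring.
Qed.

Lemma has_orderV x n : has_order x n -> has_order x^-1 (- n).
Proof.
by move=> [p [q [lp lq -> ->]]]; exists q, p; split => //; rewrite ?invf_div ?opprB.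
Qed.

Lemma has_orderD x y n n' :
  has_order x n -> has_order y n' -> has_order (x + y) (Num.min n n').
Proof.
move=> [p [q [lp lq -> ->]]] [p' [q' [lp' lq' -> ->]]].
exists (p * q' + p' * q), (q * q').
have [l s] := lead_posD_size (lead_posM lp lq') (lead_posM lp' lq).
split=> //; [exact: lead_posM | by rewrite (tofrac_addf_div lead_pos_neq0) |].
have := lead_pos_sizeM lp lq'; have := lead_pos_sizeM lp' lq.
by rewrite (lead_pos_sizeM lq lq') s; move: (size (p * q')) (size (p' * q)); lia.
Qed.

Lemma has_orderX x n (k : int) : has_order x n -> has_order (x ^ k) (k * n).
Proof.
move=> xn; have nat_pow m : has_order (x ^+ m) (m%:Z * n).
  elim: m => [|m IH]; first by rewrite mul0r; apply: has_order1.
  by rewrite exprS intS mulrDl mul1r; apply: has_orderM.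
by case: k => m; [apply: nat_pow | rewrite NegzE mulNr; apply/has_orderV/nat_pow].
Qed.

Lemma has_order_ex (k : int) : exists x, has_order x k.
Proof.
have x1 : has_order ('X%:F)^-1 1.
  exists 1, 'X; rewrite tofrac1 div1r size_polyX size_poly1.
  by split; rewrite // /lead_pos ?lead_coef1 ?lead_coefX.
by exists (('X%:F)^-1 ^ k); have := has_orderX k x1; rewrite mulr1.
Qed.

End Valuation.

Section TropicalSeeds.
Local Open Scope ring_scope.
Variable V : finType.
Implicit Types (e : V -> V -> int) (t : tseed V) (u v : seq (mstep V)) (x : V -> trop V).

Definition trop_step t (st : mstep V) : tseed V :=
  match st with Mu k => tmut t k | Perm p => tperm_seed t p end.

Definition trop_seq t u : tseed V := foldl trop_step t u.

Lemma trop_seq_cat t u v : trop_seq t (u ++ v) = trop_seq (trop_seq t u) v.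
Proof. exact: foldl_cat. Qed.

Lemma teps_trop_seq t u : teps (trop_seq t u) = eps_seq (teps t) u.
Proof. by elim: u t => //= -[k|p] u IH t; rewrite IH. Qed.

Lemma green_run_cat t u v :
  green_run t (u ++ v) = obind (fun t' => green_run t' v) (green_run t u).
Proof. by elim: u t => [|[k|p] u IH] t //=; case: ifP. Qed.

Lemma green_run_trop_seq t t' u : green_run t u = Some t' -> trop_seq t u = t'.
Proof. by elim: u t => [|[k|p] u IH] t /=; [case | case: ifP => // _ /IH | move/IH]. Qed.

Lemma green_run_mu e x k u : (forall w, 0 <= x k w) ->
  green_run (TSeed e x) (Mu k :: u) = green_run (tmut (TSeed e x) k) u.
Proof. by move=> x0 /=; rewrite (_ : trop_pos _) //; apply/forallP. Qed.

(* The w-exponents of the tropical variables of t are the orders of the X-variables of s. *)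
Definition tropicalizes (w : V) (s : seed V {fraction {poly rat}}) t :=
  seps s = teps t /\ forall a, has_order (sX s a) (tx t a w).

Lemma tropicalizes_step w s t st :
  tropicalizes w s t -> tropicalizes w (step_seed s st) (trop_step t st).
Proof.
case: st => [k|p] [se sv]; split => //=; rewrite ?se // => a.
case: ifP => _; first exact/has_orderV.
apply: has_orderM => //; apply/has_orderX/has_orderD/has_orderX => //; exact: has_order1.
Qed.

Lemma tropicalizes_seq w s t u :
  tropicalizes w s t -> tropicalizes w (apply_seq s u) (trop_seq t u).
Proof. by elim: u s t => //= st u IH s t s_t; apply/IH/tropicalizes_step. Qed.

Lemma trop_seq_mequiv e u v x :
  mequiv poly_cone e u v -> trop_seq (TSeed e x) u = trop_seq (TSeed e x) v.
Proof.
move=> uv; pose t := TSeed e x.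
have [f fP] : exists f : V -> V -> {fraction {poly rat}}, forall a w, has_order (f a w) (x a w).
  apply: (fin_all_exists (P := fun a fa => forall w, has_order (fa w) (x a w))) => a.
  by apply: (fin_all_exists (P := fun w y => has_order y (x a w))) => w; apply: has_order_ex.
pose s w := Seed e (fun a => f a w) (fun=> 1).
have s_t w : tropicalizes w (s w) t by split=> //= a.
have ps w : pos_seed poly_cone (s w).
  by split=> a /=; [apply: has_order_cone (fP a w) | exact: (cone1 poly_cone)].
have uvE : teps (trop_seq t u) = teps (trop_seq t v) by rewrite !teps_trop_seq (mequiv_eps uv).
have uvx a w : tx (trop_seq t u) a w = tx (trop_seq t v) a w.
  have [_ /(_ a) ua] := tropicalizes_seq u (s_t w).
  have [_ /(_ a) va] := tropicalizes_seq v (s_t w).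
  by rewrite (apply_seq_mequiv uv) // in ua; apply: has_order_inj ua va.
case: (trop_seq t u) (trop_seq t v) uvE uvx => [e1 x1] [e2 x2] /= -> xE.
by rewrite (eq_matrix xE : x1 = x2).
Qed.

End TropicalSeeds.

(** * Green reflections along a cycle *)

Section TropicalReflections.
Local Open Scope ring_scope.
Variable V : finType.
Implicit Types (e : V -> V -> int) (P T : seq V) (x : V -> trop V) (k z y : V) (h : V -> int).

Definition green_mut e x k : V -> trop V :=
  fun i w => if i == k then - x k w else x i w + [e i k]_+ * x k w.

Lemma green_mut_eq e x k w : green_mut e x k k w = - x k w.
Proof. by rewrite /green_mut eqxx. Qed.

Lemma green_mut_neq e x k i w : i != k -> green_mut e x k i w = x i w + [e i k]_+ * x k w.
Proof. by rewrite /green_mut => /negPf->. Qed.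

Lemma tmut_green_mut e x k : (forall w, 0 <= x k w) ->
  tmut (TSeed e x) k = TSeed (mut_eps e k) (green_mut e x k).
Proof.
move=> x0; rewrite /tmut /=; congr TSeed; apply: eq_matrix => i w; rewrite /green_mut.
case: ifP => // _; congr (_ + _); move: (x0 w); move: (e i k) (x k w) => n a a0.
have [n0|n0|->] := ltrgtP n 0; last by rewrite oppr0 !mul0r.
  by rewrite ltr0_sgz // pos_part_eq0 ?ltW // opprK mul1r min_l // mulr0 mul0r.
by rewrite gtr0_sgz // pos_part_id ?ltW // mulN1r min_r ?oppr_le0 // mulrNN.
Qed.

Lemma green_run_green_mut e x k u : (forall w, 0 <= x k w) ->
  green_run (TSeed e x) (Mu k :: u) = green_run (TSeed (mut_eps e k) (green_mut e x k)) u.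
Proof. by move=> x0; rewrite green_run_mu // tmut_green_mut. Qed.

Definition potential e P k h :=
  [/\ forall v, v \in P -> h (next P v) - h v = e k (next P v),
      forall v, v \in P -> 0 <= h v & exists2 v, v \in P & h v = 0].

(* The effect of R(P) on nonnegative tropical variables. *)
Definition cycle_reflection e P x x' : Prop :=
  (forall v, v \in P -> forall w, x' (next P v) w = - x v w) /\
  (forall k h, k \notin P -> potential e P k h ->
     forall w, x' k w = x k w + \sum_(v <- P) h v * x v w).

Lemma potential2 e z y k h : z != y -> potential e [:: z; y] k h ->
  [e k z]_+ = h z /\ [- e k z]_+ = h y.
Proof.
move=> zy [he h0 [v vP hv0]]; have [zP yP] : z \in [:: z; y] /\ y \in [:: z; y].
  by rewrite !inE !eqxx orbT.
have <- : h z - h y = e k z by have := he y yP; rewrite /= (eq_sym y) (negPf zy) eqxx.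
have min0 : Num.min (h z) (h y) = 0.
  move: vP hv0; rewrite !inE => /orP [] /eqP-> hv0; first by rewrite min_l hv0 // h0.
  by rewrite min_r hv0 // h0.
by rewrite !pos_part_min min0 !subr0.
Qed.

Lemma cycle_reflection2 e z y x : skewsym e -> balanced_cycle e [:: z; y] ->
  cycle_reflection e [:: z; y] x
    (fun i => green_mut (mut_eps e z) (green_mut e x z) y (tperm z y i)).
Proof.
move=> sk cy; have [zy ezy eky] := cycle2P cy; have yz : y != z by rewrite eq_sym.
have eyz : e y z = 0 by rewrite sk ezy.
have [nz ny] : next [:: z; y] z = y /\ next [:: z; y] y = z.
  by rewrite /= (negPf yz) !eqxx.
have xy w : green_mut e x z y w = x y w.
  by rewrite green_mut_neq // eyz pos_part_units mul0r addr0.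
split=> [v|k h].
  rewrite !inE => /orP [/eqP->|/eqP->] w; rewrite (nz, ny) (tpermL, tpermR).
    by rewrite green_mut_neq // green_mut_eq mut_eps_row ezy pos_part_units mul0r addr0.
  by rewrite green_mut_eq xy.
rewrite !inE negb_or => /andP [kz ky] /(potential2 zy) [hz hy] w.
rewrite tpermD 1?eq_sym // green_mut_neq // xy green_mut_neq //.
by rewrite mut_eps_col0 // eky hz hy !big_cons big_nil addr0 addrA.
Qed.

Section Cons.
Variables (e : V -> V -> int) (z h0 : V) (T : seq V).
Let l := last h0 T.
Hypotheses (sk : skewsym e) (cy : balanced_cycle e [:: z, h0 & T]) (T0 : T != [::]).

Let uT : uniq (h0 :: T). Proof. by case/andP: (cycle_uniq cy). Qed.
Let lT : l \in h0 :: T. Proof. exact: mem_last. Qed.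
Let head v (vT : v \in h0 :: T) := balanced_cycle_head sk cy T0 vT.
Let h0l : h0 != l. Proof. by case: (head (mem_head h0 T)). Qed.

Let next_zT v : v \in h0 :: T ->
  next [:: z, h0 & T] v = if v == l then z else next (h0 :: T) v.
Proof. by move=> vT; rewrite next_cons ?(cycle_uniq cy). Qed.

Let next_h0 v : (next (h0 :: T) v == h0) = (v == l). Proof. exact: next_eq_head. Qed.

Lemma potential_head : potential (mut_eps e z) (h0 :: T) z (fun v => (v == l)%:Z).
Proof.
split=> [v vT|v _|]; last by exists h0; rewrite ?mem_head // (negPf h0l).
  have nT : next (h0 :: T) v \in h0 :: T by rewrite mem_next.
  by have [_ _ ezn _ _] := head nT; rewrite mut_eps_row ezn next_h0 opprB.
by case: (v == l).
Qed.

Lemma potential_del k h : k != z -> potential e [:: z, h0 & T] k h ->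
  potential (mut_eps e z) (h0 :: T) k (fun v => if v == l then Num.min (h z) (h l) else h v).
Proof.
move=> kz [he h_ge0 [v0 v0P hv0]].
have hz := h_ge0 z (mem_head _ _).
have hT v : v \in h0 :: T -> 0 <= h v by move=> vT; apply: h_ge0; rewrite inE vT orbT.
have ekz : e k z = h z - h l by have := he l; rewrite next_zT // eqxx inE lT orbT => ->.
have ekh0 : e k h0 = h h0 - h z by have := he z (mem_head _ _); rewrite next_head.
split=> [v vT|v vT|].
- have nT : next (h0 :: T) v \in h0 :: T by rewrite mem_next.
  have [_ nz _ pn mn] := head nT; rewrite mut_eps_neq // pn mn next_h0.
  have [->|vl] := eqVneq v l.
    rewrite next_last // (negPf h0l) ekh0 ekz !pos_part_min mulr1 mulr0.
    by move: (Num.min _ _) => n; ring.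
  have := he v; rewrite next_zT // (negPf vl) inE vT orbT => <- //.
  rewrite ekz !pos_part_min mulr0; case: (next (h0 :: T) v =P l) => [->|_].
    by rewrite mulr1; move: (Num.min _ _) => n; ring.
  by rewrite mulr0; ring.
- by case: eqP => _; [rewrite le_min hz hT | apply: hT].
move: v0P; rewrite inE => /orP [/eqP vz|vT].
  by exists l => //; rewrite eqxx -vz hv0 min_l ?hT.
by exists v0 => //; case: eqP => // vl; rewrite -vl hv0 min_r.
Qed.

Variables (x x2 : V -> trop V).
Hypothesis (refl_T : cycle_reflection (mut_eps e z) (h0 :: T) (green_mut e x z) x2).

Let zT : z \notin h0 :: T. Proof. by case/andP: (cycle_uniq cy). Qed.

Lemma green_mut_head v w : v \in h0 :: T ->
  green_mut e x z v w = x v w + (v == l)%:Z * x z w.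
Proof. by move=> vT; have [_ vz _ _ mv] := head vT; rewrite green_mut_neq // sk mv. Qed.

Lemma cycle_reflection_head w : x2 z w = x l w.
Proof.
have [_ x2off] := refl_T; rewrite (x2off z _ zT potential_head).
rewrite (bigD1_seq l) //= eqxx mul1r (green_mut_head w lT) eqxx mul1r green_mut_eq.
by rewrite big1 => [|v /negPf->]; [ring | rewrite mul0r].
Qed.

Lemma cycle_reflection_cons :
  cycle_reflection e [:: z, h0 & T] x (green_mut (mut_eps e z) x2 z).
Proof.
have [x2next x2off] := refl_T; split=> [v|k h].
  rewrite inE => /orP [/eqP->|vT] w.
    have [_ h0z _ ph0 _] := head (mem_head h0 T).
    rewrite next_head green_mut_neq // mut_eps_col -sk ph0 eqxx cycle_reflection_head.
    by rewrite -{1}(next_last uT) x2next // green_mut_head // eqxx !mul1r; ring.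
  rewrite next_zT //; case: (eqVneq v l) => [->|vl].
    by rewrite green_mut_eq cycle_reflection_head.
  have nT : next (h0 :: T) v \in h0 :: T by rewrite mem_next.
  have [_ nz _ pn _] := head nT.
  rewrite green_mut_neq // mut_eps_col -sk pn next_h0 (negPf vl) mul0r addr0 x2next //.
  rewrite green_mut_head //.
  by rewrite (negPf vl) mul0r addr0.
rewrite inE negb_or => /andP [kz kT] pot w; have [he _ _] := pot.
have ekz : e k z = h z - h l by have := he l; rewrite next_zT // eqxx inE lT orbT => ->.
rewrite green_mut_neq // mut_eps_col cycle_reflection_head ekz pos_part_min.
rewrite (x2off k _ kT (potential_del kz pot)) green_mut_neq // ekz pos_part_min [in RHS]big_cons.
rewrite (eq_big_seq (fun v => h v * x v w + (v == l)%:Z *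
    ((Num.min (h z) (h l) - h l) * x l w + Num.min (h z) (h l) * x z w))) => [|v vT].
  rewrite big_split /= -mulr_suml sum_indicator // mul1r.
  by move: (Num.min _ _) => n; ring.
rewrite green_mut_head //; case: (eqVneq v l) => [->|_].
  by rewrite !mul1r; ring.
by rewrite !mul0r !addr0.
Qed.

End Cons.

Lemma green_run_RP e P x : skewsym e -> balanced_cycle e P ->
  (forall v, v \in P -> forall w, 0 <= x v w) ->
  exists2 x', green_run (TSeed e x) (RP P) = Some (TSeed e x') & cycle_reflection e P x x'.
Proof.
elim: P e x => [|z T IH] e x sk cy x0; first by case: cy.
have x0z w : 0 <= x z w by apply: x0; rewrite mem_head.
have skz := skewsym_mut z sk.
have := cycle_size cy; rewrite /= ltnS => T1; have [T2|] := ltnP 1 (size T); last first.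
  case: T T1 cy x0 {IH} => [|y [|? ?]] // _ cy x0 _; have [zy ezy _] := cycle2P cy.
  exists (fun i => green_mut (mut_eps e z) (green_mut e x z) y (tperm z y i)).
    rewrite RP2 green_run_green_mut // green_run_green_mut => [|w].
      by have := eps_RP2 sk cy; rewrite RP2 /= /tperm_seed tpermV /= => ->.
    rewrite green_mut_neq 1?eq_sym // sk ezy oppr0 pos_part_units mul0r addr0.
    by apply: x0; rewrite !inE eqxx orbT.
  exact: cycle_reflection2.
case: T T1 T2 cy x0 IH => [|h0 T] // _ T2 cy x0 IH; have T0 : T != [::] by case: (T) T2.
have lT : last h0 T \in h0 :: T := mem_last h0 T.
have [|x2 run2 refl2] := IH _ (green_mut e x z) skz (balanced_cycle_del sk cy T2).
  move=> v vT w; rewrite (green_mut_head sk cy) //; apply: addr_ge0; last by rewrite mulr_ge0.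
  by apply: x0; rewrite inE vT orbT.
exists (green_mut (mut_eps e z) x2 z); last exact: cycle_reflection_cons.
rewrite RP_cons // /mu_conj green_run_green_mut // green_run_cat run2 /=.
rewrite -[if _ then _ else _]/(green_run (TSeed _ x2) [:: Mu z]) green_run_green_mut => [|w].
  by rewrite mut_epsK.
by rewrite (cycle_reflection_head sk cy T0 refl2); apply: x0; rewrite inE lT orbT.
Qed.

End TropicalReflections.

(** * The quiver Q_m(g) *)

Section QuiverArrows.
Local Open Scope ring_scope.
Variable t : ctype.
Hypothesis vt : valid_ctype t.
Implicit Types a b : nat.

Lemma sc_cases a : (sc t a = 1)%N \/ sc t a = rr t.
Proof. by case: t => [l|l|l|l|||||] /=; try (by left); case: ifP; auto. Qed.

Lemma rr_cases : [\/ (rr t = 1)%N, (rr t = 2)%N | (rr t = 3)%N].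
Proof. by case: t => [l|l|l|l|||||] /=; auto using Or31, Or32, Or33. Qed.

Lemma rr_gt0 : (0 < rr t)%N.
Proof. by case: rr_cases => ->. Qed.

Lemma sc_gt0 a : (0 < sc t a)%N.
Proof. by case: (sc_cases a) => -> //; apply: rr_gt0. Qed.

Lemma sc_le_rr a : (sc t a <= rr t)%N.
Proof. by case: (sc_cases a) => ->; rewrite ?rr_gt0. Qed.

Definition sc_max a b : nat := maxn (sc t a) (sc t b).

Lemma sc_maxC a b : sc_max a b = sc_max b a.
Proof. exact: maxnC. Qed.

Lemma sc_dvd_max a b : (Posz (sc t a) %| Posz (sc_max a b))%Z.
Proof.
rewrite /sc_max; case: (sc_cases a) => sa; first by rewrite sa dvd1z.
by rewrite (maxn_idPl _) ?dvdzz // sa sc_le_rr.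
Qed.

Lemma dynkin_edge_lt a b : (a, b) \in dynkin_edges t -> (b < a)%N.
Proof.
move: vt; case: t => [l|l|l|l|||||] v; rewrite /dynkin_edges ?mem_cat.
1-3: by case/mapP => i _ [-> ->].
- case/orP => [/mapP [i _ [-> ->]] //|]; rewrite inE => /eqP [-> ->]; move: v => /=; lia.
all: by rewrite /= ?inE; do ?[case/orP]; move/eqP => [-> ->].
Qed.

Lemma dynkin_edges_uniq : uniq (dynkin_edges t).
Proof.
have uniq_chain k n : uniq [seq (i.+1, i) | i <- iota k n].
  by rewrite map_inj_uniq ?iota_uniq // => i j [].
move: vt; case: t => [l|l|l|l|||||] v //=.
rewrite cats1 rcons_uniq uniq_chain andbT; apply/mapP => -[i]; rewrite mem_iota => i_lt [lE l2E].
by move: v lE l2E => /=; lia.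
Qed.

Lemma dynkin_edge_asym a b : (a, b) \in dynkin_edges t -> (b, a) \in dynkin_edges t = false.
Proof.
by move=> ab; apply/negP => ba; have := dynkin_edge_lt ab; have := dynkin_edge_lt ba; lia.
Qed.

Lemma adjacentC a b : adjacent t a b = adjacent t b a.
Proof. by rewrite /adjacent orbC. Qed.

Lemma adjacent_neq a b : adjacent t a b -> a != b.
Proof. by move=> /orP [] /dynkin_edge_lt; lia. Qed.

(* For an edge (a, b) the arrows are v^a_n -> v^b_(n + edge_shift a); only the short end of a
   multiple bond in types B and F4 is shifted. *)
Definition edge_shift a : int :=
  match t with
  | TB l => if a == l then -1 else 0
  | TF4 => if a == 3%N then -1 else 0
  | _ => 0
  end.

Lemma edge_shift_dvd a b : (a, b) \in dynkin_edges t -> sc t a = sc t b ->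
  (Posz (sc t a) %| edge_shift a)%Z.
Proof.
rewrite /edge_shift; case: t => [l|l|l|l|||||]; rewrite ?dvdz0 //=; last first.
  by rewrite !inE => /or3P [] /eqP [-> ->].
case/mapP => i _ [-> ->]; case: (eqVneq i.+1 l) => [<-|_]; last by rewrite dvdz0.
by rewrite ltnn ltnSn.
Qed.

Definition uniform_gens : seq (nat * int * nat * int) :=
  [seq (i, 0%Z, i, Posz (sc t i)) | i <- iota 1 (rank t)] ++
  flatten [seq [:: (g.1, 0%Z, g.2, edge_shift g.1);
                   (g.2, edge_shift g.1 + Posz (sc_max g.1 g.2), g.1, 0%Z)]
            | g <- dynkin_edges t].

End QuiverArrows.

Lemma chain_gens_perm (T : eqType) (A A' : nat -> T) (E : nat -> seq T)
    (E' : nat * nat -> seq T) n a b c :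
  (forall i, 0 < i <= n.+1 -> A i = A' i) -> a = A' n.+2 ->
  (forall i, 0 < i <= n -> E i.+1 = E' (i.+1, i)) -> E' (n.+2, n.+1) = [:: b; c] ->
  perm_eq (map A (iota 1 n.+1) ++ flatten (map E (iota 2 n)) ++ [:: a; b; c])
    (map A' (iota 1 n.+2) ++ flatten (map E' [seq (i.+1, i) | i <- iota 1 n.+1])).
Proof.
move=> AA' -> EE' E'bc.
have iotaS k : iota 1 k.+1 = iota 1 k ++ [:: k.+1] by rewrite -[in LHS](addn1 k) iotaD.
have -> : map A (iota 1 n.+1) = map A' (iota 1 n.+1).
  by apply/eq_in_map => i; rewrite mem_iota => i_lt; apply: AA'; lia.
rewrite (iotaS n.+1) [in X in perm_eq _ X]map_cat -catA perm_cat2l (iotaS n) !map_cat flatten_cat.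
rewrite /= E'bc cats0 -[2]/(1 + 1) iotaDl -!map_comp.
have -> : map (E \o addn 1) (iota 1 n) = map (E' \o (fun i => (i.+1, i))) (iota 1 n).
  by apply/eq_in_map => i; rewrite mem_iota => i_lt /=; rewrite add1n EE' //; lia.
set Y := flatten _; exact/permPl/(perm_catCA Y [:: _] [:: _; _]).
Qed.

Lemma gens_uniform t : valid_ctype t -> perm_eq (gens t) (uniform_gens t).
Proof.
case: t => [l|l|l|l|||||] //; case: l => [//|[//|n]] _;
  rewrite /gens /uniform_gens !subSS !subn0; apply: chain_gens_perm => //=.
- by move=> i i_le; have -> : i < n.+2 by lia.
- by rewrite ltnn.
- move=> i i_le; rewrite /sc_max /edge_shift /= subn1 /=.
  have [-> -> ->] : [/\ (i.+1 == n.+2) = false, i.+1 < n.+2 & i < n.+2] by split; lia.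
  by [].
- by rewrite /sc_max /edge_shift /= ?eqxx ?ltnn ?ltnSn ?subn1.
- by move=> i i_le; have -> : i < n.+2 by lia.
- by rewrite ltnn.
- move=> i i_le; rewrite /sc_max /= subn1 /=.
  have [-> ->] : i.+1 < n.+2 /\ i < n.+2 by split; lia.
  by [].
by rewrite /sc_max /= ?ltnn ?ltnSn ?subn1.
Qed.

Section ExchangeMatrix.
Local Open Scope ring_scope.
Variable t : ctype.
Hypothesis vt : valid_ctype t.
Implicit Types a b : nat.

Definition arrow_shift a b : int :=
  if (a, b) \in dynkin_edges t then edge_shift t a
  else - edge_shift t b - Posz (sc_max t a b).

Lemma arrow_shiftC a b : adjacent t a b ->
  arrow_shift b a = - arrow_shift a b - Posz (sc_max t a b).
Proof.
move=> /orP [ab|ab]; rewrite /arrow_shift ab (dynkin_edge_asym vt ab); first by rewrite sc_maxC.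
by rewrite opprD !opprK addrK.
Qed.

Lemma arrow_shift_dvd a b : adjacent t a b -> sc t a = sc t b ->
  (Posz (sc t a) %| arrow_shift a b)%Z.
Proof.
move=> /orP [ab|ab] sab; rewrite /arrow_shift; first by rewrite ab (edge_shift_dvd ab).
rewrite (dynkin_edge_asym vt ab) rpredB ?sc_dvd_max // rpredN sab.
exact: edge_shift_dvd (esym sab).
Qed.

Variable m : nat.
Hypothesis m1 : (1 < m)%N.
Local Notation N := (rr t * m)%N.

(* The time difference z is a whole number of turns around Z / N. *)
Definition full_turn (z : int) : bool := (Posz N %| z)%Z.

Lemma full_turnN z : full_turn (- z) = full_turn z.
Proof. by rewrite /full_turn !dvdzE abszN. Qed.

Lemma full_turn_modz x y : full_turn (x - y) = ((x %% Posz N)%Z == (y %% Posz N)%Z).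
Proof. by rewrite /full_turn -eqz_mod_dvd. Qed.

Lemma full_turn_trans y x z : full_turn (x - y) -> full_turn (y - z) -> full_turn (x - z).
Proof. by move=> xy yz; rewrite /full_turn -(subrKA y) rpredD. Qed.

Lemma period_gt0 : (0 < N)%N.
Proof. by rewrite muln_gt0 (ltnW m1) rr_gt0. Qed.

Lemma modz_ord (k : 'I_N) : (Posz k %% Posz N)%Z = Posz k.
Proof. by rewrite modz_small //= ltz_nat ltn_ord. Qed.

Lemma modz_period_lt (z : int) : (`|(z %% Posz N)%Z| < N)%N.
Proof.
have N0 : Posz N != 0 by rewrite eqz_nat -lt0n period_gt0.
by rewrite -ltz_nat gez0_abs ?modz_ge0 // ltz_pmod // ltz_nat period_gt0.
Qed.

Lemma sum_is_vert a x b y (u v : vert t m) :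
  (\sum_(n < N) (is_vert a (Posz n + x) u && is_vert b (Posz n + y) v : nat) =
   [&& a == u.1.+1, b == v.1.+1 & full_turn (Posz v.2 - Posz u.2 - (y - x))])%N.
Proof.
have modE (z : int) (k : 'I_N) : ((z %% Posz N)%Z == Posz k) = full_turn (z - Posz k).
  by rewrite full_turn_modz modz_ord.
rewrite /is_vert; case: (a == _) => /=; last by rewrite big1.
case: (b == _) => /=; last by rewrite big1 // => n _; rewrite andbF.
pose n0 := Ordinal (modz_period_lt (Posz u.2 - x)).
have n0E : full_turn (Posz n0 + x - Posz u.2).
  rewrite -modE /= gez0_abs ?modz_ge0 ?eqz_nat -?lt0n ?period_gt0 //.
  by rewrite modzDml subrK modz_ord.
rewrite (bigD1 n0) //= !modE n0E /= big1 ?addn0 => [|n nn0].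
  congr nat_of_bool; rewrite /full_turn -(rpredBl _ n0E); congr (_ %| _)%Z; ring.
rewrite !modE (_ : full_turn _ = false) //; apply: contraNF nn0 => nE.
have : full_turn (Posz n - Posz n0).
  rewrite (_ : _ - _ = (Posz n + x - Posz u.2) - (Posz n0 + x - Posz u.2)); last by ring.
  exact: rpredB.
by rewrite full_turn_modz !modz_ord eqz_nat (inj_eq val_inj).
Qed.

Lemma narrowsE (u v : vert t m) (d := Posz v.2 - Posz u.2) :
  narrows u v = ((u.1 == v.1) && full_turn (d - Posz (sc t u.1.+1)) +
    (adjacent t u.1.+1 v.1.+1 && full_turn (d - arrow_shift u.1.+1 v.1.+1)))%N.
Proof.
have sum_pick (I : eqType) (r : seq I) x (c : bool) : uniq r ->
    (\sum_(i <- r) ((i == x) && c : nat))%N = ((x \in r) && c)%N.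
  move=> ur; have [xr|xr] := boolP (x \in r).
    by rewrite (bigD1_seq x) //= eqxx big1 ?addn0 // => i /negPf ->.
  by rewrite big1_seq // => i /= ir; case: eqP => // ix; rewrite -ix ir in xr.
have -> : narrows u v = (\sum_(g <- uniform_gens t)
    [&& g.1.1.1 == u.1.+1, g.1.2 == v.1.+1 & full_turn (d - (g.2 - g.1.1.2))])%N.
  rewrite /narrows -(eq_bigr _ (fun g _ => sum_is_vert _ _ _ _ u v)) exchange_big /=.
  apply: eq_bigr => n _; rewrite (seq.permP (gens_uniform vt)) -sum1_count big_mkcond /=.
  by apply: eq_bigr => g _; case: (_ && _).
rewrite /uniform_gens big_cat /= big_map; congr addn.
  rewrite (eq_bigr (fun i => (i == u.1.+1) &&
    ((u.1 == v.1) && full_turn (d - Posz (sc t u.1.+1))) : nat)) => [|i _ /=].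
    by rewrite sum_pick ?iota_uniq // mem_iota add1n /= ltnS ltn_ord.
  by case: eqP => //= ->; rewrite eqSS -(inj_eq val_inj) subr0.
rewrite big_flatten /= big_map.
rewrite (eq_bigr (fun g => ((g == (u.1.+1, v.1.+1)) && full_turn (d - edge_shift t u.1.+1) +
    ((g == (v.1.+1, u.1.+1)) &&
       full_turn (d + edge_shift t v.1.+1 + Posz (sc_max t u.1.+1 v.1.+1))))%N)); last first.
  move=> [a b] _ /=; rewrite !big_cons big_nil /= addn0 !xpair_eqE -!andbA; congr addn.
    by case: eqP => //= ->; case: eqP => //=; rewrite subr0.
  rewrite andbCA; case: eqP => //= ->; case: eqP => //= ->.
  by rewrite sub0r opprK addrA sc_maxC.
rewrite big_split /= !sum_pick ?dynkin_edges_uniq // /adjacent /arrow_shift.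
have [uv|uv] := boolP ((u.1.+1, v.1.+1) \in _).
  by rewrite (dynkin_edge_asym vt uv) /= addn0.
by case: (_ \in _) => //=; rewrite add0n; congr (nat_of_bool (full_turn _)); ring.
Qed.

Lemma epsQ_same_row (u v : vert t m) (d := Posz v.2 - Posz u.2) (s := Posz (sc t u.1.+1)) :
  u.1 = v.1 -> epsQ u v = (full_turn (d - s))%:Z - (full_turn (d + s))%:Z.
Proof.
move=> uv; have nadj : adjacent t u.1.+1 v.1.+1 = false.
  by apply/negP => /(adjacent_neq vt); rewrite uv eqxx.
rewrite /epsQ !narrowsE nadj [adjacent t v.1.+1 _]adjacentC nadj /s uv eqxx /= !addn0 -/d.
by congr (_ - Posz (nat_of_bool _)); rewrite -full_turnN; congr full_turn; rewrite /d; ring.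
Qed.

Lemma epsQ_adjacent (u v : vert t m) (d := Posz v.2 - Posz u.2) : adjacent t u.1.+1 v.1.+1 ->
  epsQ u v = (full_turn (d - arrow_shift u.1.+1 v.1.+1))%:Z -
             (full_turn (d - arrow_shift u.1.+1 v.1.+1 - Posz (sc_max t u.1.+1 v.1.+1)))%:Z.
Proof.
move=> uv; have := adjacent_neq vt uv; rewrite eqSS (inj_eq val_inj) => /negPf uv1.
rewrite /epsQ !narrowsE [adjacent t v.1.+1 _]adjacentC uv uv1 eq_sym uv1 /= !add0n -/d.
congr (_ - Posz (nat_of_bool _)); rewrite -full_turnN (arrow_shiftC uv).
by congr full_turn; rewrite /d; ring.
Qed.

Lemma epsQ_nonadjacent (u v : vert t m) :
  u.1 != v.1 -> ~~ adjacent t u.1.+1 v.1.+1 -> epsQ u v = 0.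
Proof.
move=> /negPf uv /negPf nadj; rewrite /epsQ !narrowsE uv nadj [v.1 == _]eq_sym uv.
by rewrite [adjacent t v.1.+1 _]adjacentC nadj subrr.
Qed.

Lemma skewsym_epsQ : @skewsym (vert t m) (@epsQ t m).
Proof. by move=> u v; rewrite /epsQ opprB. Qed.

End ExchangeMatrix.

Section RowCycles.
Local Open Scope ring_scope.
Variables (t : ctype) (m : nat).
Hypotheses (vt : valid_ctype t) (m1 : (1 < m)%N).
Local Notation N := (rr t * m)%N.
Local Notation full_turn := (full_turn t m).
Local Notation eQ := (@epsQ t m).
Local Notation s_ i := (sc t (nat_of_ord i).+1).
Local Notation adj i j := (adjacent t (nat_of_ord i).+1 (nat_of_ord j).+1).
Local Notation shift_ i j := (arrow_shift t (nat_of_ord i).+1 (nat_of_ord j).+1).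
Implicit Types (i j : 'I_(rank t)) (z : int) (u v : vert t m).

Definition vertex i z : vert t m := (i, Ordinal (modz_period_lt t m1 z)).

Lemma vertex_time i z : Posz (vertex i z).2 = (z %% Posz N)%Z.
Proof. by rewrite /= gez0_abs // modz_ge0 // eqz_nat -lt0n period_gt0. Qed.

Lemma full_turn_vertex i z : full_turn (Posz (vertex i z).2 - z).
Proof. by rewrite full_turn_modz vertex_time modz_mod. Qed.

Lemma vertex_eq i z v : (vertex i z == v) = (i == v.1) && full_turn (Posz v.2 - z).
Proof.
rewrite -pair_eqE /pair_eq /=; congr (_ && _).
rewrite full_turn_modz modz_ord eq_sym -(inj_eq val_inj) -eqz_nat; congr (_ == _).
exact: vertex_time.
Qed.

Lemma vertexK v : vertex v.1 (Posz v.2) = v.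
Proof. by apply/eqP; rewrite vertex_eq eqxx subrr /full_turn dvdz0. Qed.

Lemma eq_vertex i z z' : full_turn (z - z') -> vertex i z = vertex i z'.
Proof.
move=> zz'; apply/eqP; rewrite vertex_eq eqxx /=.
by apply: full_turn_trans (full_turn_vertex i z') _; rewrite -full_turnN opprB.
Qed.

Lemma vertex_shift i j z c : vertex j (Posz (vertex i z).2 + c) = vertex j (z + c).
Proof.
by apply: eq_vertex; have := full_turn_vertex i z; congr full_turn; ring.
Qed.

Definition delay (c : nat) v : vert t m := vertex v.1 (Posz v.2 + Posz c).

Definition cycle_length i : nat := (N %/ s_ i)%N.

Lemma cycle_lengthK i : (cycle_length i * s_ i = N)%N.
Proof.
rewrite /cycle_length; case: (sc_cases t i.+1) => ->; first by rewrite divn1 muln1.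
by rewrite mulKn ?(mulnC m) ?rr_gt0.
Qed.

Lemma cycle_length_gt1 i : (1 < cycle_length i)%N.
Proof.
rewrite /cycle_length; case: (sc_cases t i.+1) => ->; last by rewrite mulKn ?rr_gt0.
by rewrite divn1; apply: leq_trans m1 (leq_pmull _ (rr_gt0 t)).
Qed.

Lemma full_turn_dvd i z : full_turn z -> (Posz (s_ i) %| z)%Z.
Proof. by apply: dvdz_trans; rewrite -(cycle_lengthK i) PoszM dvdz_mull. Qed.

Definition row_cycle i z : seq (vert t m) :=
  [seq vertex i (z + Posz (k * s_ i)) | k <- iota 0 (cycle_length i)].

Lemma cycleP_row_cycle i g : cycleP m i g = row_cycle i (Posz g).
Proof.
rewrite /cycleP /row_cycle -/(cycle_length i); elim: (iota 0 _) => //= k r IH.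
rewrite (insubT (fun x => x < N)%N (ltn_pmod _ (period_gt0 t m1))) /= IH; congr (_ :: _).
by congr pair; apply: val_inj; rewrite /= -PoszD modz_nat.
Qed.

Lemma size_row_cycle i z : size (row_cycle i z) = cycle_length i.
Proof. by rewrite size_map size_iota. Qed.

Lemma mem_row_cycle i z v :
  (v \in row_cycle i z) = (v.1 == i) && (Posz (s_ i) %| Posz v.2 - z)%Z.
Proof.
apply/mapP/andP => [[k _ ->]|[/eqP vi /dvdzP [q qE]]].
  split; rewrite ?eqxx //; have := full_turn_dvd i (full_turn_vertex i (z + Posz (k * s_ i))).
  by rewrite opprD addrA rpredBr // PoszM dvdz_mull.
have n0 : Posz (cycle_length i) != 0 by rewrite eqz_nat -lt0n ltnW ?cycle_length_gt1.
exists `|(q %% Posz (cycle_length i))%Z|%N.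
  rewrite mem_iota /= -ltz_nat gez0_abs ?modz_ge0 // ltz_pmod // ltz_nat.
  exact: ltnW (cycle_length_gt1 i).
apply/eqP; rewrite eq_sym vertex_eq vi eqxx /= PoszM gez0_abs ?modz_ge0 //.
rewrite opprD addrA qE -mulrBl {1}(divz_eq q (Posz (cycle_length i))) addrK.
by rewrite /full_turn -mulrA -PoszM cycle_lengthK dvdz_mull.
Qed.

Lemma row_cycle_uniq i z : uniq (row_cycle i z).
Proof.
rewrite map_inj_in_uniq ?iota_uniq // => a b; rewrite !mem_iota !add0n => /= a_lt b_lt /eqP.
rewrite vertex_eq eqxx /= => ab.
have : full_turn (Posz (b * s_ i) - Posz (a * s_ i)).
  have := full_turn_vertex i (z + Posz (b * s_ i)); rewrite -full_turnN opprB => bb.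
  by have := full_turn_trans bb ab; congr full_turn; ring.
have small c : (c < cycle_length i)%N -> (Posz (c * s_ i) %% Posz N)%Z = Posz (c * s_ i).
  by move=> c_lt; rewrite modz_small //= ltz_nat -(cycle_lengthK i) ltn_pmul2r ?sc_gt0.
by rewrite full_turn_modz !small // eqz_nat eqn_pmul2r ?sc_gt0 // => /eqP ->.
Qed.

Lemma iter_delay i z k :
  iter k (delay (s_ i)) (vertex i z) = vertex i (z + Posz (k * s_ i)).
Proof.
elim: k => [|k IH]; first by rewrite mul0n addr0.
by rewrite iterS IH /delay vertex_shift; congr vertex; rewrite mulSn PoszD; ring.
Qed.

Lemma row_cycle_traject i z :
  row_cycle i z = traject (delay (s_ i)) (vertex i z) (cycle_length i).
Proof.
rewrite /row_cycle; elim: (cycle_length i) => // n IH; rewrite trajectSr -IH iter_delay.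
by rewrite -(addn1 n) iotaD map_cat /= cats1 add0n.
Qed.

Lemma fcycle_row_cycle i z : fcycle (delay (s_ i)) (row_cycle i z).
Proof.
rewrite row_cycle_traject; case: (cycle_length i) (cycle_lengthK i) => // n nN.
have closed : iter n.+1 (delay (s_ i)) (vertex i z) = vertex i z.
  by rewrite iter_delay nN; apply: eq_vertex; rewrite addrAC subrr add0r; apply: dvdzz.
by rewrite /= -{3}closed iterSr -trajectSr fpath_traject.
Qed.

Lemma next_row_cycle i z v :
  v \in row_cycle i z -> next (row_cycle i z) v = vertex i (Posz v.2 + Posz (s_ i)).
Proof.
move=> vC; have /eqP <- := next_cycle (fcycle_row_cycle i z) vC.
by move: vC; rewrite mem_row_cycle /delay => /andP [/eqP -> _].
Qed.

Lemma sum_row_cycle i z w :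
  \sum_(v <- row_cycle i z) (full_turn (Posz v.2 - w))%:Z = (Posz (s_ i) %| w - z)%Z%:Z.
Proof.
have [wz|wz] := boolP (Posz (s_ i) %| w - z)%Z.
  have wC : vertex i w \in row_cycle i z.
    by rewrite mem_row_cycle eqxx /= -(subrKA w) rpredD // full_turn_dvd // full_turn_vertex.
  rewrite (eq_big_seq (fun x => (x == vertex i w)%:Z)) ?sum_indicator ?row_cycle_uniq // => v.
  by rewrite mem_row_cycle => /andP [/eqP vi _]; rewrite eq_sym vertex_eq vi eqxx.
rewrite big1_seq // => v /= vC; rewrite (_ : full_turn _ = false) //.
apply: contraNF wz => /(full_turn_dvd i) vw.
move: vC; rewrite mem_row_cycle => /andP [_ vz].
by rewrite (_ : w - z = (Posz v.2 - z) - (Posz v.2 - w)); [apply: rpredB | ring].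
Qed.

Lemma row_cycle_rot i z z' : (Posz (s_ i) %| z - z')%Z ->
  exists n, row_cycle i z = rot n (row_cycle i z').
Proof.
move=> zz; have zC : vertex i z \in row_cycle i z'.
  by rewrite mem_row_cycle eqxx /= -(subrKA z) rpredD // full_turn_dvd // full_turn_vertex.
have [n q qE] := rot_to zC; exists n; rewrite qE.
have := fcycle_row_cycle i z'; rewrite -(rot_cycle n) qE /= rcons_path => /andP [/fpathP [l ql] _].
have := congr1 size qE; rewrite size_rot size_row_cycle ql /= size_traject => nl.
by rewrite row_cycle_traject nl.
Qed.

Lemma balanced_row_cycle i z : balanced_cycle eQ (row_cycle i z).
Proof.
have row v : v \in row_cycle i z -> v.1 = i by rewrite mem_row_cycle => /andP [/eqP].
split; [exact: row_cycle_uniq | by rewrite size_row_cycle cycle_length_gt1 | |].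
  move=> u v uC vC; rewrite !next_row_cycle // !vertex_eq epsQ_same_row ?row //.
  rewrite !eqxx /=; congr (Posz (nat_of_bool _) - Posz (nat_of_bool _)).
    by congr full_turn; ring.
  by rewrite -full_turnN; congr full_turn; ring.
move=> k; have sum0 w w' : (Posz (s_ i) %| w - w')%Z ->
    (forall v, v \in row_cycle i z ->
       eQ k v = (full_turn (Posz v.2 - w))%:Z - (full_turn (Posz v.2 - w'))%:Z) ->
    \sum_(v <- row_cycle i z) eQ k v = 0.
  move=> ww' kE; rewrite (eq_big_seq _ kE) sumrB !sum_row_cycle.
  by rewrite -[w - z](subrKA w') rpredDl // subrr.
have [ki|ki] := eqVneq k.1 i.
  apply: (sum0 (Posz k.2 + Posz (s_ i)) (Posz k.2 - Posz (s_ i))).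
    by rewrite (_ : _ - _ = Posz (s_ i) * 2); [apply: dvdz_mulr | ring].
  move=> v /row vi; rewrite epsQ_same_row ?ki ?vi //.
  by congr (Posz (nat_of_bool (full_turn _)) - Posz (nat_of_bool (full_turn _))); ring.
have [a|a] := boolP (adj k.1 i); last first.
  by rewrite big1_seq // => v /= /row vi; rewrite epsQ_nonadjacent ?vi.
apply: (sum0 (Posz k.2 + shift_ k.1 i)
  (Posz k.2 + shift_ k.1 i + Posz (sc_max t k.1.+1 i.+1))).
  rewrite (_ : _ - _ = - Posz (sc_max t k.1.+1 i.+1)); last by ring.
  by rewrite rpredN sc_maxC sc_dvd_max.
move=> v /row vi; rewrite epsQ_adjacent ?vi //.
by congr (Posz (nat_of_bool (full_turn _)) - Posz (nat_of_bool (full_turn _))); ring.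
Qed.

Lemma disconnected_same_step i j g g' : s_ i = s_ j -> (g < s_ i)%N -> (g' < s_ j)%N -> g != g' ->
  disconnected eQ [set v in cycleP m i g] [set v in cycleP m j g'].
Proof.
move=> sij gi gj gg u v; rewrite !inE !cycleP_row_cycle !mem_row_cycle -sij in gj *.
move=> /andP [/eqP ui dvd_u] /andP [/eqP vj dvd_v].
have no_turn k : (Posz (s_ i) %| k)%Z -> full_turn (Posz v.2 - Posz u.2 - k) = false.
  move=> dvd_k; apply: contraNF gg => /(full_turn_dvd i) dvd_uv.
  have : (Posz (s_ i) %| Posz g - Posz g')%Z.
    rewrite (_ : _ - _ = (Posz v.2 - Posz g') - (Posz u.2 - Posz g) -
      (Posz v.2 - Posz u.2 - k) - k); last by ring.
    exact: (rpredB (rpredB (rpredB dvd_v dvd_u) dvd_uv) dvd_k).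
  by rewrite -eqz_mod_dvd !modz_small //= ?ltz_nat // eqz_nat.
split; first by apply: contraFneq (no_turn 0 (dvdz0 _)) => ->; rewrite subrr subr0; apply: dvdz0.
have [ij|ij] := eqVneq i j.
  rewrite epsQ_same_row ?ui ?vj // no_turn ?dvdzz // -[Posz (s_ i)]opprK.
  by rewrite no_turn // rpredN dvdzz.
have [a|a] := boolP (adj i j); last by rewrite epsQ_nonadjacent ?ui ?vj.
have sh := arrow_shift_dvd vt a sij.
rewrite epsQ_adjacent ?ui ?vj // no_turn // -[_ - _ - Posz _]addrA -opprD no_turn //.
by rewrite rpredD // sc_dvd_max.
Qed.

Lemma disconnected_nonadjacent i j g g' : i != j -> ~~ adj i j ->
  disconnected eQ [set v in cycleP m i g] [set v in cycleP m j g'].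
Proof.
move=> ij a u v; rewrite !inE !cycleP_row_cycle !mem_row_cycle.
move=> /andP [/eqP ui _] /andP [/eqP vj _]; rewrite epsQ_nonadjacent ?ui ?vj //.
by split=> //; apply: contraNneq ij => uv; rewrite -ui -vj uv.
Qed.

Lemma linked_row_cycle i j z : adj i j -> (s_ j <= s_ i)%N ->
  linked eQ (row_cycle i z) (fun v => vertex j (Posz v.2 + shift_ i j))
    (row_cycle j (z + shift_ i j)).
Proof.
set g := (fun v : vert t m => _) => aij sij.
have nij : i != j by have := adjacent_neq vt aij; rewrite eqSS (inj_eq val_inj).
have maxE : sc_max t i.+1 j.+1 = s_ i by rewrite /sc_max (maxn_idPl sij).
split; try exact: balanced_row_cycle.
- have [c cE] : exists c, s_ i = (c * s_ j)%N.
    have := sc_dvd_max t j.+1 i.+1; rewrite sc_maxC maxE => sji.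
    by exists (s_ i %/ s_ j)%N; rewrite divnK.
  have lenE : cycle_length j = (c * cycle_length i)%N.
    apply/eqP; rewrite -(eqn_pmul2r (sc_gt0 t j.+1)) cycle_lengthK -(cycle_lengthK i) cE.
    by apply/eqP; lia.
  have multiples k n : subseq [seq (l * c)%N | l <- iota k n] (iota (c * k) (c * n)).
    have c0 : (0 < c)%N by have := sc_gt0 t i.+1; rewrite cE; case: (c).
    elim: n k => [|n IH] k; first by rewrite muln0.
    rewrite mulnS iotaD [(c * k + c)%N]addnC -mulnS /= -cat1s; apply: cat_subseq => //.
    by rewrite sub1seq mem_iota mulnC leqnn -[X in (X < _)%N]addn0 ltn_add2l.
  have -> : map g (row_cycle i z) = [seq vertex j (z + shift_ i j + Posz (l * s_ j))
      | l <- [seq (k * c)%N | k <- iota 0 (cycle_length i)]].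
    rewrite /row_cycle -!map_comp; apply: eq_map => k /=; rewrite /g vertex_shift -mulnA -cE.
    by congr vertex; ring.
  by apply: map_subseq; have := multiples 0%N (cycle_length i); rewrite muln0 lenE.
- by move=> v; rewrite !mem_row_cycle => /andP [/eqP -> _]; rewrite (negPf nij).
move=> u v uC vC; rewrite next_row_cycle //.
move: uC vC; rewrite !mem_row_cycle => /andP [/eqP ui _] /andP [/eqP vj _].
rewrite epsQ_adjacent ?ui ?vj // maxE 2!(eq_sym v) /g vertex_shift !vertex_eq vj eqxx /=.
by congr (Posz (nat_of_bool (full_turn _)) - Posz (nat_of_bool (full_turn _))); ring.
Qed.

Variables (K : fieldType) (C : pos_cone K).

Lemma eps_RP_cycleP i g : eps_seq eQ (RP (cycleP m i g)) = eQ.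
Proof.
by rewrite cycleP_row_cycle; apply: eps_RP (balanced_row_cycle _ _); apply: skewsym_epsQ.
Qed.

Lemma mequiv_RP_cyclePK i g : mequiv C eQ (RP (cycleP m i g) ++ RP (cycleP m i g)) [::].
Proof.
by rewrite cycleP_row_cycle; apply: mequiv_RPK (balanced_row_cycle _ _); apply: skewsym_epsQ.
Qed.

Lemma braided_cycleP i j g g' : adj i j -> s_ i != s_ j \/ g = g' ->
  braided C eQ (RP (cycleP m i g)) (RP (cycleP m j g')).
Proof.
wlog sij : i j g g' / (s_ j <= s_ i)%N => [wlog_le|] aij gg.
  have [sji|/ltnW sij] := leqP (s_ j) (s_ i); first exact: wlog_le.
  apply: braided_sym; apply: wlog_le => //; first by rewrite adjacentC.
  by case: gg => [ss|->]; [left; rewrite eq_sym | right].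
have skQ := skewsym_epsQ (t := t) (m := m).
have aligned : (Posz (s_ j) %| (Posz g + shift_ i j) - Posz g')%Z.
  have [ss|ss] := eqVneq (s_ i) (s_ j).
    case: gg => [|->]; first by rewrite ss eqxx.
    by rewrite addrAC subrr add0r -ss; apply: arrow_shift_dvd.
  have -> : s_ j = 1%N; last by rewrite dvd1z.
  case: (sc_cases t j.+1) => // sj; case: (sc_cases t i.+1) => si; rewrite si sj in sij ss.
    by apply/eqP; rewrite sj eqn_leq sij rr_gt0.
  by rewrite eqxx in ss.
have [n rotE] := row_cycle_rot aligned; rewrite !cycleP_row_cycle.
have cB := balanced_row_cycle j (Posz g').
apply: braided_mequiv (mequiv_refl _ _ _) (mequiv_RP_rot C n skQ cB) _ _ _.
- exact: eps_RP (balanced_row_cycle _ _).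
- exact: eps_RP cB.
by rewrite -rotE; apply: braided_linked skQ (linked_row_cycle _ aij sij).
Qed.

End RowCycles.

(** * Coxeter relations by folding *)

Section BraidRelations.
Variable T : Type.
Implicit Types (f g : T -> T) (a b : nat -> T -> T) (r : seq nat) (i j : nat).

Definition commuting f g := forall x, f (g x) = g (f x).

Fixpoint alternate f g k x := if k is k'.+1 then f (alternate g f k' x) else x.

Definition braid k f g := forall x, alternate f g k x = alternate g f k x.

Lemma alternateSr f g k x :
  alternate f g k.+1 x = alternate f g k ((if odd k then g else f) x).
Proof.
by elim: k f g => // k IH f g; rewrite -[LHS]/(f (alternate g f k.+1 x)) IH /= if_neg.
Qed.

Lemma alternateD f g k l x : alternate f g (k + l) x =
  alternate f g k (if odd k then alternate g f l x else alternate f g l x).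
Proof. by elim: k f g => //= k IH f g; rewrite IH if_neg. Qed.

Lemma alternateK f g k x : involutive f -> involutive g ->
  alternate f g k (if odd k then alternate f g k x else alternate g f k x) = x.
Proof.
move=> fK gK; elim: k x => // k IH x; rewrite alternateSr -[RHS]IH /=.
by case: (odd k); rewrite (fK, gK).
Qed.

Lemma iter_braid f g k : involutive f -> involutive g -> braid k f g ->
  iter k (f \o g) =1 id.
Proof.
move=> fK gK fg x; have -> : iter k (f \o g) x = alternate f g (k + k) x.
  by elim: {fg}k => // k IH; rewrite iterS addnS addSn /= IH.
by rewrite alternateD fg -[RHS](alternateK k x fK gK) fg.
Qed.

Fixpoint compose_seq a r x := if r is i :: r' then compose_seq a r' (a i x) else x.

Lemma commuting_compose_seq f a r :
  (forall i, i \in r -> commuting f (a i)) -> commuting f (compose_seq a r).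
Proof.
elim: r => //= i r IH fa x; rewrite IH => [|j jr]; first by rewrite fa ?mem_head.
by apply: fa; rewrite inE jr orbT.
Qed.

Lemma involutive_compose_seq a r : uniq r -> (forall i, involutive (a i)) ->
  {in r &, forall i j, i != j -> commuting (a i) (a j)} -> involutive (compose_seq a r).
Proof.
move=> + aK; elim: r => //= i r IH /andP [ir ur] aC x.
have aiC : commuting (a i) (compose_seq a r).
  apply: commuting_compose_seq => j jr; apply: aC; rewrite ?mem_head ?inE ?jr ?orbT //.
  by apply: contraNneq ir => ->.
by rewrite aiC aK IH // => j k jr kr; apply: aC; rewrite inE (jr, kr) orbT.
Qed.

Lemma braid_compose_seq a b r : uniq r ->
  {in r &, forall i j, i != j ->
     [/\ commuting (a i) (a j), commuting (b i) (b j) & commuting (a i) (b j)]} ->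
  (forall i, i \in r -> braid 3 (a i) (b i)) ->
  braid 3 (compose_seq a r) (compose_seq b r).
Proof.
elim: r => //= i r IH /andP [ir ur] abC ab x; rewrite /braid /=.
have ij j : j \in r -> [/\ i \in i :: r, j \in i :: r, i != j & j != i].
  by move=> jr; rewrite mem_head inE jr orbT eq_sym; split=> //; apply: contraNneq ir => <-.
have aA : commuting (a i) (compose_seq a r).
  by apply: commuting_compose_seq => j /ij [? ? ? _]; case: (abC i j).
have bB : commuting (b i) (compose_seq b r).
  by apply: commuting_compose_seq => j /ij [? ? ? _]; case: (abC i j).
have aB : commuting (a i) (compose_seq b r).
  by apply: commuting_compose_seq => j /ij [? ? ? _]; case: (abC i j).
have bA : commuting (b i) (compose_seq a r).
  apply: commuting_compose_seq => j /ij [? ? _ ?] y.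
  by have [|||_ _ ->] := abC j i.
have abi : b i (a i (b i x)) = a i (b i (a i x)) by rewrite [RHS](ab i (mem_head i r) x).
rewrite aB bA aA [in RHS]bA aB bB abi; apply: IH => // [j k jr kr|j jr].
  by apply: abC; rewrite inE (jr, kr) orbT.
by apply: ab; rewrite inE jr orbT.
Qed.

Section Folding.
Variables a b c d : T -> T.
Hypotheses (ac : commuting a c) (ab : braid 3 a b) (cb : braid 3 c b).

(* The folding of the Coxeter graph A_3 to B_2. *)
Lemma braid4_fold : braid 4 (fun x => a (c x)) b.
Proof.
have aba x : a (b (a x)) = b (a (b x)) by apply: ab.
have cbc x : c (b (c x)) = b (c (b x)) by apply: cb.
move=> x /=; apply: esym; rewrite [a (c x)]ac.
transitivity (a (b (a (c (b (a x)))))); first by rewrite cbc -aba.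
transitivity (a (b (c (b (a (b x)))))); first by rewrite ac aba.
by rewrite -cbc -ac.
Qed.

Hypotheses (db : braid 3 d b) (ad : commuting a d) (cd : commuting c d).

(* The folding of D_4 to G_2, through B_3 with nodes a c, b and d. *)
Lemma braid6_fold : braid 6 (fun x => a (c (d x))) b.
Proof.
pose u x := a (c x); have ub x : u (b (u (b x))) = b (u (b (u x))) by apply: braid4_fold.
have ud x : u (d x) = d (u x) by rewrite /u cd ad.
have dbd x : d (b (d x)) = b (d (b x)) by apply: db.
move=> x; apply: esym; rewrite /= -!/(u _).
transitivity (b (d (u (b (u (b (d (b (u x))))))))).
  by rewrite [u (d x)]ud dbd [u (d (b _))]ud.
transitivity (d (b (u (d (b (u (d (b (u x))))))))); first by rewrite ub -dbd -ud.
transitivity (d (b (u (b (d (b (u (b (u x))))))))); first by rewrite [u (d (b (u x)))]ud dbd.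
transitivity (d (u (b (u (b (d (b (u (b x))))))))); first by rewrite -ub -ud -ub.
by rewrite -dbd -!ud.
Qed.

End Folding.
End BraidRelations.

Section SeedAction.
Variables (V : finType) (K : fieldType) (C : pos_cone K) (e : V -> V -> int).
Implicit Types (u v w : seq (mstep V)).

Definition seed_at : Type := {s : seed V K | seps s = e /\ pos_seed C s}.

Lemma seed_at_inj : injective (@sval _ _ : seed_at -> seed V K).
Proof.
move=> [s ps] [s' ps'] /= ss'; case: s' / ss' ps' => ps'.
by rewrite (proof_irrelevance _ ps ps').
Qed.

Lemma act_subproof w (s : seed_at) : eps_seq e w = e ->
  seps (apply_seq (sval s) w) = e /\ pos_seed C (apply_seq (sval s) w).
Proof. by case: s => s [/= se ps] we; rewrite seps_seq se; split; last exact: pos_seed_seq. Qed.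

Definition act w (we : eps_seq e w = e) (s : seed_at) : seed_at :=
  exist _ (apply_seq (sval s) w) (act_subproof s we).

Lemma mequivP u v :
  mequiv C e u v <-> forall s : seed_at, apply_seq (sval s) u = apply_seq (sval s) v.
Proof.
split=> [[uv] [s [se ps]]|uv]; first exact: uv.
by split=> s se ps; apply: (uv (exist _ s (conj se ps))).
Qed.

Lemma apply_seq_nseq n w (s : seed V K) :
  apply_seq s (flatten (nseq n w)) = iter n ((@apply_seq V K)^~ w) s.
Proof. by elim: n s => //= n IH s; rewrite apply_seq_cat IH -iterSr. Qed.

End SeedAction.

Section CoxeterRelations.
Local Open Scope ring_scope.
Variables (t : ctype) (m : nat).
Hypotheses (vt : valid_ctype t) (m1 : (1 < m)%N).
Local Notation eQ := (@epsQ t m).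
Local Notation s_ i := (sc t (nat_of_ord i).+1).
Local Notation adj i j := (adjacent t (nat_of_ord i).+1 (nat_of_ord j).+1).
Variables (K : fieldType) (C : pos_cone K).
Implicit Types (i j : 'I_(rank t)) (g : nat).

Lemma coxmC (a b : nat) : coxm t a b = coxm t b a.
Proof. by rewrite /coxm eq_sym mulrC. Qed.

Lemma coxm_sc i j : i != j -> (s_ j <= s_ i)%N -> coxm t i.+1 j.+1 =
  if adj i j then (if s_ i == s_ j then 3 else if s_ i == 2 then 4 else 6)%N else 2%N.
Proof.
move=> ij; have [neq_ij neq_ji] : (i.+1 == j.+1)%N = false /\ (j.+1 == i.+1)%N = false.
  by rewrite !eqSS !(inj_eq val_inj) (eq_sym j) (negPf ij).
rewrite /coxm /cartan neq_ij neq_ji (adjacentC t j.+1); case: (adj i j) => //=.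
case: (sc_cases t i.+1) => ->; case: (sc_cases t j.+1) => -> //;
  by case: (rr_cases t) => ->.
Qed.

Definition cycle_refl i g : seed_at C eQ -> seed_at C eQ := act (eps_RP_cycleP vt m1 i g).

Definition row_refl i : seed_at C eQ -> seed_at C eQ :=
  compose_seq (cycle_refl i) (rev (iota 0 (s_ i))).

Lemma cycle_reflK i g : involutive (cycle_refl i g).
Proof.
move=> s; apply: seed_at_inj; rewrite /= -apply_seq_cat.
by have /mequivP := mequiv_RP_cyclePK vt m1 C i g; apply.
Qed.

Lemma cycle_refl_commuting i j g h :
  disconnected eQ [set v in cycleP m i g] [set v in cycleP m j h] ->
  commuting (cycle_refl i g) (cycle_refl j h).
Proof.
move=> d s; apply: esym; apply: seed_at_inj; rewrite /= -!apply_seq_cat.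
by have /mequivP := mequiv_RPC C (skewsym_epsQ (t := t) (m := m)) d; apply.
Qed.

Lemma cycle_refl_braid i j g h : adj i j -> s_ i != s_ j \/ g = h ->
  braid 3 (cycle_refl i g) (cycle_refl j h).
Proof.
move=> aij gh s; apply: seed_at_inj; rewrite /= -!apply_seq_cat.
by have /mequivP := braided_cycleP vt m1 C aij gh; apply.
Qed.

Lemma sval_row_refl i s : sval (row_refl i s) = apply_seq (sval s) (Ri m i).
Proof.
rewrite /row_refl /Ri; elim: (rev _) s => //= g r IH s.
by rewrite IH apply_seq_cat.
Qed.

Lemma mem_rev_iota n g : (g \in rev (iota 0 n)) = (g < n)%N.
Proof. by rewrite mem_rev mem_iota. Qed.

Lemma row_reflK i : involutive (row_refl i).
Proof.
apply: involutive_compose_seq => [||g h]; first by rewrite rev_uniq iota_uniq.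
  exact: cycle_reflK.
rewrite !mem_rev_iota => gi hi gh.
exact/cycle_refl_commuting/disconnected_same_step.
Qed.

Lemma row_refl_braid i j : i != j -> braid (coxm t i.+1 j.+1) (row_refl i) (row_refl j).
Proof.
wlog sij : i j / (s_ j <= s_ i)%N => [wlog_le|] ij.
  have [sji|/ltnW sij] := leqP (s_ j) (s_ i); first exact: wlog_le.
  have ji : j != i by rewrite eq_sym.
  by move=> s; rewrite coxmC; apply/esym/wlog_le.
have commute_i g h : (g < s_ i)%N -> (h < s_ i)%N -> g != h ->
    commuting (cycle_refl i g) (cycle_refl i h).
  by move=> gi hi gh; apply/cycle_refl_commuting/disconnected_same_step.
rewrite coxm_sc //; have [a|a] := boolP (adj i j); last first.
  move=> s; apply: commuting_compose_seq => h _ {}s; apply: esym.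
  apply: commuting_compose_seq => g _.
  apply/cycle_refl_commuting/disconnected_nonadjacent => //.
    by rewrite eq_sym.
  by rewrite adjacentC.
have [ss|ss] := eqVneq (s_ i) (s_ j).
  rewrite /row_refl -ss; apply: braid_compose_seq => [|g h|g _].
  - by rewrite rev_uniq iota_uniq.
  - rewrite !mem_rev_iota => gi hi gh; have [gj hj] : (g < s_ j)%N /\ (h < s_ j)%N by rewrite -ss.
    by split; apply/cycle_refl_commuting/disconnected_same_step.
  by apply: cycle_refl_braid; auto.
have b g h : braid 3 (cycle_refl i g) (cycle_refl j h) by apply: cycle_refl_braid; auto.
have sj : s_ j = 1%N.
  case: (sc_cases t j.+1) => // sj; case: (sc_cases t i.+1) => si; rewrite si sj in sij ss *.
    by apply/eqP; rewrite eqn_leq sij rr_gt0.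
  by rewrite eqxx in ss.
have : s_ i = 2 \/ s_ i = 3.
  move: ss; rewrite sj; case: (sc_cases t i.+1) => -> //.
  by case: (rr_cases t) => -> //; auto.
rewrite /row_refl sj; case=> si; rewrite si in commute_i *.
  by apply: braid4_fold; do ?[exact: b | exact: commute_i].
by apply: braid6_fold; do ?[exact: b | exact: commute_i].
Qed.

Lemma mequiv_RiRj_pow i j : mequiv C eQ (RiRj_pow m i j) [::].
Proof.
apply/mequivP => s; rewrite /RiRj_pow apply_seq_nseq.
have -> : iter (coxm t i.+1 j.+1) ((@apply_seq _ K)^~ (Ri m j ++ Ri m i)) (sval s) =
    sval (iter (coxm t i.+1 j.+1) (row_refl i \o row_refl j) s).
  by elim: (coxm _ _ _) => //= n ->; rewrite apply_seq_cat !sval_row_refl.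
have [<-|ij] := eqVneq i j; first by rewrite /coxm eqxx /= row_reflK.
by rewrite iter_braid //; [apply: row_reflK | apply: row_reflK | apply: row_refl_braid].
Qed.

Lemma eps_Ri i : eps_seq eQ (Ri m i) = eQ.
Proof.
by rewrite /Ri; elim: (rev _) => //= g r IH; rewrite eps_seq_cat eps_RP_cycleP.
Qed.

Lemma eps_Rword (ws : seq 'I_(rank t)) : eps_seq eQ (Rword m ws) = eQ.
Proof. by rewrite /Rword; elim: (rev ws) => //= i r IH; rewrite eps_seq_cat eps_Ri. Qed.

Lemma Rword_cat (u v : seq 'I_(rank t)) : Rword m (u ++ v) = Rword m v ++ Rword m u.
Proof. by rewrite /Rword rev_cat map_cat flatten_cat. Qed.

Lemma Rword_coxrel i j : Rword m (coxrel i j) = RiRj_pow m i j.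
Proof.
rewrite /coxrel /RiRj_pow; elim: (coxm _ _ _) => // n IH.
have flattenSr (T : Type) (w : seq T) k :
    flatten (nseq k.+1 w) = flatten (nseq k w) ++ w.
  by elim: k => /= [|k IHk]; rewrite ?cats0 // -catA -IHk.
rewrite [in RHS]flattenSr -IH /= -[[:: i, j & _]]/([:: i; j] ++ _) Rword_cat.
by congr (_ ++ _); rewrite /Rword /= cats0.
Qed.

Lemma mequiv_Rword (u v : seq 'I_(rank t)) :
  wequiv u v -> mequiv C eQ (Rword m u) (Rword m v).
Proof.
elim=> {u v} [u|u v _ IH|u v w _ IH1 _ IH2|u v i j].
- exact: mequiv_refl.
- exact: mequiv_sym.
- exact: mequiv_trans IH1 IH2.
rewrite !Rword_cat -!catA Rword_coxrel; apply: (@mequiv_ctx _ _ _ _ _ _ [::]).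
by rewrite eps_Rword; apply: mequiv_RiRj_pow.
Qed.

End CoxeterRelations.

(** * Green reflections in rank two *)

Section RankTwoRows.
Local Open Scope ring_scope.
Variables (p q c c' S : nat).
Implicit Types rows : (int -> int) * (int -> int).

(* The rows of nodes a and b, with time steps p and q, under R_a and R_b; each variable of one row
   sees c, respectively c', consecutive variables of the other, and S = max p q. *)
Definition reflect_a rows : (int -> int) * (int -> int) :=
  (fun n => - rows.1 (n - Posz p),
   fun n => rows.2 n + \sum_(r <- iota 0 c) rows.1 (n + Posz (r * p))).

Definition reflect_b rows : (int -> int) * (int -> int) :=
  (fun n => rows.1 n + \sum_(r <- iota 0 c') rows.2 (n - Posz S + Posz (r * q)),
   fun n => - rows.2 (n - Posz q)).

Fixpoint reflect_ab k rows :=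
  if k is k'.+1 then (if odd k' then reflect_b else reflect_a) (reflect_ab k' rows) else rows.

(* The row that the next reflection negates; greenness asks for it to be nonnegative. *)
Definition next_row k rows : int -> int :=
  if odd k then (reflect_ab k rows).2 else (reflect_ab k rows).1.

Lemma next_rowSS k rows n : next_row k.+2 rows n =
  if odd k then - next_row k rows (n - Posz q) +
    \sum_(r <- iota 0 c) next_row k.+1 rows (n + Posz (r * p))
  else - next_row k rows (n - Posz p) +
    \sum_(r <- iota 0 c') next_row k.+1 rows (n - Posz S + Posz (r * q)).
Proof. by rewrite /next_row /= negbK; case: (odd k). Qed.

Definition nonneg_rows k := forall F G l n, (forall z, 0 <= F z) -> (forall z, 0 <= G z) ->
  (l < k)%N -> 0 <= next_row l (F, G) n.

Lemma nonneg_rowsI k :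
  (forall (y : nat -> int -> int) G, (forall z, 0 <= y 0%N z) -> (forall z, 0 <= G z) ->
    (forall z, y 1%N z = G z + \sum_(r <- iota 0 c) y 0%N (z + Posz (r * p))) ->
    (forall l z, y l.+2 z =
      if odd l then - y l (z - Posz q) + \sum_(r <- iota 0 c) y l.+1 (z + Posz (r * p))
      else - y l (z - Posz p) + \sum_(r <- iota 0 c') y l.+1 (z - Posz S + Posz (r * q))) ->
    forall l z, (l < k)%N -> 0 <= y l z) ->
  nonneg_rows k.
Proof.
move=> rows_ge0 F G l n F0 G0 lk; apply: (rows_ge0 (next_row ^~ (F, G)) G) => //.
by move=> *; apply: next_rowSS.
Qed.

End RankTwoRows.

Section RankTwoCases.
Local Open Scope ring_scope.

Ltac sum_rows := rewrite /= !big_cons big_nil ?mul0n ?mul1n ?addr0 -?addrA.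

Lemma nonneg_rows_A1A1 p q S : nonneg_rows p q 0 0 S 2.
Proof.
by apply: nonneg_rowsI => y G y0 G0 y1 _ [|[|]] z // _; rewrite y1 big_nil addr0.
Qed.

Lemma nonneg_rows_A2 p : nonneg_rows p p 1 1 p 3.
Proof.
apply: nonneg_rowsI => y G y0 G0 y1 ySS.
have {}y1 z : y 1%N z = G z + y 0%N z by rewrite y1; sum_rows.
have y2 z : y 2%N z = G (z - Posz p) by rewrite ySS; sum_rows; rewrite !y1 -?addrA; ring.
by case=> [|[|[|]]] z // _; rewrite (y1, y2) ?addr_ge0.
Qed.

Lemma nonneg_rows_B2_long : nonneg_rows 2 1 1 2 2 4.
Proof.
apply: nonneg_rowsI => y G y0 G0 y1 ySS.
have {}y1 z : y 1%N z = G z + y 0%N z by rewrite y1; sum_rows.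
have y2 z : y 2%N z = G (z - 2) + G (z - 1) + y 0%N (z - 1).
  by rewrite ySS; sum_rows; rewrite !y1 -?addrA; ring.
have y3 z : y 3%N z = G (z - 2) by rewrite ySS; sum_rows; rewrite y2 !y1 -?addrA; ring.
by case=> [|[|[|[|]]]] z // _; rewrite (y1, y2, y3) ?addr_ge0.
Qed.

Lemma nonneg_rows_B2_short : nonneg_rows 1 2 2 1 2 4.
Proof.
apply: nonneg_rowsI => y G y0 G0 y1 ySS.
have {}y1 z : y 1%N z = G z + y 0%N z + y 0%N (z + 1) by rewrite y1; sum_rows.
have y2 z : y 2%N z = G (z - 2) + y 0%N (z - 2).
  by rewrite ySS; sum_rows; rewrite !y1 -?addrA; ring.
have y3 z : y 3%N z = G (z - 1) by rewrite ySS; sum_rows; rewrite !y2 !y1 -?addrA; ring.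
by case=> [|[|[|[|]]]] z // _; rewrite (y1, y2, y3) ?addr_ge0.
Qed.

Lemma nonneg_rows_G2_long : nonneg_rows 3 1 1 3 3 6.
Proof.
apply: nonneg_rowsI => y G y0 G0 y1 ySS.
have {}y1 z : y 1%N z = G z + y 0%N z by rewrite y1; sum_rows.
have y2 z : y 2%N z = G (z - 3) + G (z - 2) + G (z - 1) + y 0%N (z - 2) + y 0%N (z - 1).
  by rewrite ySS; sum_rows; rewrite !y1 -?addrA; ring.
have y3 z : y 3%N z = G (z - 3) + G (z - 2) + y 0%N (z - 2).
  by rewrite ySS; sum_rows; rewrite !y2 !y1 -?addrA; ring.
have y4 z : y 4%N z = G (z - 5) + G (z - 4) + G (z - 3) + y 0%N (z - 3).
  by rewrite ySS; sum_rows; rewrite !y3 !y2 -?addrA; ring.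
have y5 z : y 5%N z = G (z - 5) by rewrite ySS; sum_rows; rewrite !y4 !y3 -?addrA; ring.
by case=> [|[|[|[|[|[|]]]]]] z // _; rewrite (y1, y2, y3, y4, y5) ?addr_ge0.
Qed.

Lemma nonneg_rows_G2_short : nonneg_rows 1 3 3 1 3 6.
Proof.
apply: nonneg_rowsI => y G y0 G0 y1 ySS.
have {}y1 z : y 1%N z = G z + y 0%N z + y 0%N (z + 1) + y 0%N (z + 2) by rewrite y1; sum_rows.
have y2 z : y 2%N z = G (z - 3) + y 0%N (z - 3) + y 0%N (z - 2).
  by rewrite ySS; sum_rows; rewrite !y1 -?addrA; ring.
have y3 z : y 3%N z = G (z - 2) + G (z - 1) + y 0%N (z - 2) + y 0%N (z - 1) + y 0%N z.
  by rewrite ySS; sum_rows; rewrite !y2 !y1 -?addrA ?addNr ?addr0; ring.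
have y4 z : y 4%N z = G (z - 5) + y 0%N (z - 5).
  by rewrite ySS; sum_rows; rewrite !y3 !y2 -?addrA; ring.
have y5 z : y 5%N z = G (z - 3) by rewrite ySS; sum_rows; rewrite !y4 !y3 -?addrA; ring.
by case=> [|[|[|[|[|[|]]]]]] z // _; rewrite (y1, y2, y3, y4, y5) ?addr_ge0.
Qed.

End RankTwoCases.

(** * The tropical action of R_i *)

Section DisconnectedCycles.
Local Open Scope ring_scope.
Variables (V : finType) (e : V -> V -> int) (I : eqType) (P : I -> seq V).
Hypothesis sk : skewsym e.
Implicit Types (L : seq I) (x : V -> trop V) (k v : V) (h : V -> int).

Lemma potential_disconnected (S : {set V}) Q k : balanced_cycle e Q ->
  disconnected e S [set v in Q] -> k \in S -> k \notin Q /\ potential e Q k (fun=> 0).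
Proof.
move=> cQ dSQ kS; have dkQ v : v \in Q -> k != v /\ e k v = 0.
  by move=> vQ; apply: dSQ; rewrite ?inE.
split; first by apply/negP => /dkQ []; rewrite eqxx.
split=> // [v vQ|]; first by have [|_ ->] := dkQ (next Q v); rewrite ?mem_next ?subrr.
by case: Q cQ {dSQ dkQ} => [[]|v Q _] //; exists v => //; apply: mem_head.
Qed.

Lemma green_run_cycles L x : uniq L -> {in L, forall g, balanced_cycle e (P g)} ->
  {in L &, forall g g', g != g' -> disconnected e [set v in P g] [set v in P g']} ->
  {in L, forall g v, v \in P g -> forall w, 0 <= x v w} ->
  exists2 x', green_run (TSeed e x) (flatten [seq RP (P g) | g <- L]) = Some (TSeed e x') &
    {in L, forall g v, v \in P g -> forall w, x' (next (P g) v) w = - x v w} /\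
    (forall k h, {in L, forall g, k \notin P g /\ potential e (P g) k h} ->
       forall w, x' k w = x k w + \sum_(g <- L) \sum_(v <- P g) h v * x v w).
Proof.
elim: L x => [|g L IH] x uL cyP dP x0.
  by exists x => //; split=> // k h _ w; rewrite big_nil addr0.
case/andP: uL => gL uL; have inL g' : g' \in L -> g' \in g :: L by rewrite inE orbC => ->.
have gin := mem_head g L; have [x1 run1 [x1next x1off]] := green_run_RP sk (cyP g gin) (x0 g gin).
have away l l' v : l \in g :: L -> l' \in g :: L -> l != l' -> v \in P l ->
    v \notin P l' /\ potential e (P l') v (fun=> 0).
  move=> lL l'L ll' vP; apply: potential_disconnected (cyP l' l'L) (dP l l' lL l'L ll') _.
  by rewrite inE.
have same l v w : l \in L -> v \in P l -> x1 v w = x v w.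
  move=> lL vP; have lg : l != g by apply: contraNneq gL => <-.
  have [vPg pot] := away l g v (inL l lL) gin lg vP.
  by rewrite (x1off v _ vPg pot) big1 ?addr0 // => u _; rewrite mul0r.
have [|||x' run' [x'next x'off]] := IH x1 uL.
- by move=> l /inL; apply: cyP.
- by move=> l l' /inL lL /inL; apply: dP.
- by move=> l lL v vP w; rewrite (same l) // (x0 l) // inL.
exists x'; first by rewrite /= green_run_cat run1.
split=> [l|k h kP w].
  rewrite inE => /orP [/eqP-> v vP w|lL v vP w]; last by rewrite x'next // (same l).
  rewrite (x'off _ (fun=> 0)) ?x1next // => [|l' l'L].
    by rewrite big1 ?addr0 // => l' _; rewrite big1 // => u _; rewrite mul0r.
  have gl' : g != l' by apply: contraNneq gL => ->.
  by apply: away gin (inL l' l'L) gl' _; rewrite mem_next.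
rewrite (x'off k h) => [|l /inL/kP //]; have [kg potg] := kP g gin.
rewrite (x1off k h kg potg) big_cons addrA; congr (_ + _ + _).
by apply: eq_big_seq => l lL; apply: eq_big_seq => v vP; rewrite (same l).
Qed.

End DisconnectedCycles.

Section GreenReflection.
Local Open Scope ring_scope.
Variables (t : ctype) (m : nat).
Hypotheses (vt : valid_ctype t) (m1 : (1 < m)%N).
Local Notation full_turn := (full_turn t m).
Local Notation eQ := (@epsQ t m).
Local Notation s_ i := (sc t (nat_of_ord i).+1).
Local Notation adj i j := (adjacent t (nat_of_ord i).+1 (nat_of_ord j).+1).
Local Notation shift_ i j := (arrow_shift t (nat_of_ord i).+1 (nat_of_ord j).+1).
Local Notation vertex := (vertex m1).
Local Notation row_cycle := (row_cycle m1).
Implicit Types (i j : 'I_(rank t)) (x : vert t m -> trop (vert t m)) (k v : vert t m) (z : int).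

(* The number of vertices of row i on an arc cut out by the two neighbours of a vertex of row j. *)
Definition arc_length j i : nat := if adj j i then (sc_max t j.+1 i.+1 %/ s_ i)%N else 0%N.

Lemma arc_length_lt j i : (arc_length j i < cycle_length m i)%N.
Proof.
rewrite /arc_length; case: ifP => _; last by rewrite ltnW // (cycle_length_gt1 m1).
rewrite ltn_divLR ?sc_gt0 // cycle_lengthK.
apply: leq_ltn_trans (_ : rr t < _)%N; first by rewrite geq_max !sc_le_rr.
by rewrite -[X in (X < _)%N]muln1 ltn_pmul2l ?rr_gt0.
Qed.

Definition arc_potential i k v : int :=
  \sum_(r <- iota 0 (arc_length k.1 i))
     (full_turn (Posz v.2 - (Posz k.2 + shift_ k.1 i + Posz (r * s_ i))))%:Z.

Lemma sum_iota_diff (a : nat -> int) n :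
  \sum_(r <- iota 0 n) a r - \sum_(r <- iota 0 n) a r.+1 = a 0%N - a n.
Proof.
rewrite -sumrB -opprB -telescope_sumr // /index_iota subn0 -sumrN.
by apply: eq_bigr => r _; rewrite opprB.
Qed.

Lemma arc_potential_diff i z k v : k.1 != i -> v \in row_cycle i z ->
  let nv := next (row_cycle i z) v in arc_potential i k nv - arc_potential i k v = eQ k nv.
Proof.
move=> ki vC nv; have nvE : nv = vertex i (Posz v.2 + Posz (s_ i)) by apply: next_row_cycle.
have turn w : full_turn (Posz nv.2 - w) = full_turn (Posz v.2 + Posz (s_ i) - w).
  have nvt := full_turn_vertex m1 i (Posz v.2 + Posz (s_ i)); rewrite nvE.
  by apply/idP/idP; apply: full_turn_trans; rewrite // -full_turnN opprB.
pose a r : int :=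
  (full_turn (Posz v.2 + Posz (s_ i) - (Posz k.2 + shift_ k.1 i + Posz (r * s_ i))))%:Z.
rewrite /arc_potential (eq_bigr a) => [|r _]; last by rewrite turn.
rewrite [X in _ - X](eq_bigr (fun r => a r.+1)) => [|r _]; last first.
  by congr (Posz (nat_of_bool (full_turn _))); rewrite mulSn PoszD; ring.
rewrite sum_iota_diff /arc_length; have [aki|aki] := boolP (adj k.1 i); last first.
  by rewrite subrr epsQ_nonadjacent ?nvE.
have nvi : nv.1 = i by rewrite nvE.
rewrite epsQ_adjacent ?nvi // /a mul0n addr0 divnK; last first.
  by have := sc_dvd_max t i.+1 k.1.+1; rewrite sc_maxC.
by rewrite -!turn; congr (Posz (nat_of_bool (full_turn _)) - Posz (nat_of_bool (full_turn _)));
  ring.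
Qed.

(* A zero exists since the values over a row cycle sum to at most the arc length, which is less than
   the length of the cycle. *)
Lemma potential_arc i z k : k.1 != i -> potential eQ (row_cycle i z) k (arc_potential i k).
Proof.
move=> ki; have pot_ge0 v : 0 <= arc_potential i k v by apply: sumr_ge0.
split=> [v vC|//|]; first exact: arc_potential_diff.
apply: NNPP => no_zero; have := arc_length_lt k.1 i; rewrite -(size_row_cycle m1 i z) ltnNge.
case/negP; rewrite -lez_nat.
apply: (@le_trans _ _ (\sum_(v <- row_cycle i z) arc_potential i k v)).
  rewrite -sum1_size -natz natr_sum big_seq [leRHS]big_seq; apply: ler_sum => v vC.
  have := pot_ge0 v; rewrite le_eqVlt => /orP [/eqP pot0|//].
  by case: no_zero; exists v.
rewrite /arc_potential exchange_big /=; under eq_bigr do rewrite sum_row_cycle.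
rewrite -[leRHS]natz -{2}(size_iota 0 (arc_length k.1 i)) -sum1_size natr_sum.
by apply: ler_sum => r _; case: (_ %| _)%Z.
Qed.

Lemma sum_row_cycle_fun i z (F : vert t m -> int) w :
  \sum_(v <- row_cycle i z) (full_turn (Posz v.2 - w))%:Z * F v =
  (Posz (s_ i) %| w - z)%Z%:Z * F (vertex i w).
Proof.
rewrite -(sum_row_cycle m1) mulr_suml; apply: eq_big_seq => v.
rewrite mem_row_cycle => /andP [/eqP vi _].
have [vw|_] := boolP (full_turn _); last by rewrite !mul0r.
by congr (_ * F _); apply/esym/eqP; rewrite vertex_eq vi eqxx.
Qed.

Lemma sum_residues (s : nat) w : (0 < s)%N ->
  \sum_(g <- rev (iota 0 s)) (Posz s %| w - Posz g)%Z%:Z = 1.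
Proof.
move=> s0; have s0' : Posz s != 0 by rewrite eqz_nat -lt0n.
have gE : Posz `|(w %% Posz s)%Z| = (w %% Posz s)%Z by rewrite gez0_abs // modz_ge0.
have gs : (`|(w %% Posz s)%Z| < s)%N by rewrite -ltz_nat gE ltz_pmod // ltz_nat.
rewrite -[RHS](@sum_indicator _ (rev (iota 0 s)) `|(w %% Posz s)%Z|%N) ?mem_rev_iota //;
  last by rewrite rev_uniq iota_uniq.
apply: eq_big_seq => g; rewrite mem_rev_iota => gs'.
by rewrite -eqz_mod_dvd [(Posz g %% _)%Z]modz_small //= ?ltz_nat // -gE eqz_nat eq_sym.
Qed.

Definition row_reflection i x x' : Prop :=
  (forall z w, x' (vertex i z) w = - x (vertex i (z - Posz (s_ i))) w) /\
  (forall j z w, j != i -> x' (vertex j z) w = x (vertex j z) w +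
     \sum_(r <- iota 0 (arc_length j i)) x (vertex i (z + shift_ j i + Posz (r * s_ i))) w).

Lemma green_run_Ri i x : (forall z w, 0 <= x (vertex i z) w) ->
  exists2 x', green_run (TSeed eQ x) (Ri m i) = Some (TSeed eQ x') & row_reflection i x x'.
Proof.
move=> x0; have s0 := sc_gt0 t i.+1; set L := rev (iota 0 (s_ i)).
have gL g : (g \in L) = (g < s_ i)%N := mem_rev_iota _ _.
have rowE g v : v \in cycleP m i g -> v.1 = i.
  by rewrite (cycleP_row_cycle m1) mem_row_cycle => /andP [/eqP].
have [|g _|g g' gin g'in|g _ v /rowE vi w|x' run [x'next x'off]] :=
  @green_run_cycles _ eQ _ (cycleP m i) (skewsym_epsQ (t := t) (m := m)) L x.
- by rewrite rev_uniq iota_uniq.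
- by rewrite (cycleP_row_cycle m1); apply: balanced_row_cycle.
- by move=> gg'; apply: disconnected_same_step; rewrite // -gL.
- by rewrite -(vertexK m1 v) vi.
exists x' => //; split=> [z w|j z w ji].
  set v := vertex i (z - Posz (s_ i)); pose g := (v.2 %% s_ i)%N.
  have vC : v \in row_cycle i (Posz g).
    by rewrite mem_row_cycle eqxx /= -eqz_mod_dvd /g -modz_nat modz_mod.
  have := x'next g; rewrite gL ltn_mod cycleP_row_cycle => <- //.
  by rewrite next_row_cycle // vertex_shift subrK.
set k := vertex j z; rewrite (x'off k (arc_potential i k)) => [|g _]; last first.
  split; first by apply: contraNN ji => /rowE <-.
  by rewrite (cycleP_row_cycle m1); apply: potential_arc.
congr (_ + _); pose W r := Posz k.2 + shift_ j i + Posz (r * s_ i).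
transitivity (\sum_(g <- L) \sum_(r <- iota 0 (arc_length j i))
   (Posz (s_ i) %| W r - Posz g)%Z%:Z * x (vertex i (W r)) w).
  apply: eq_bigr => g _; under eq_bigr do rewrite mulr_suml.
  rewrite exchange_big /= (cycleP_row_cycle m1); apply: eq_bigr => r _.
  exact: sum_row_cycle_fun (fun v => x v w) _.
rewrite exchange_big /=; apply: eq_bigr => r _; rewrite -mulr_suml sum_residues // mul1r.
by rewrite /W -addrA vertex_shift addrA.
Qed.

End GreenReflection.

(** * Words in the Weyl group *)

Section CoxeterWords.
Variable t : ctype.
Implicit Types (u v w : seq 'I_(rank t)) (a b c i j : 'I_(rank t)).

Lemma wequiv_ctx p q u v : wequiv u v -> wequiv (p ++ u ++ q) (p ++ v ++ q).
Proof.
elim=> {u v} [u|u v _ IH|u v w _ IH1 _ IH2|u v i j].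
- exact: we_refl.
- exact: we_sym.
- exact: we_trans IH1 IH2.
by have := we_rel (p ++ u) (v ++ q) i j; rewrite -!catA.
Qed.

Lemma wequiv_catl p u v : wequiv u v -> wequiv (p ++ u) (p ++ v).
Proof. by move=> /(wequiv_ctx p [::]); rewrite !cats0. Qed.

Lemma wequiv_catr q u v : wequiv u v -> wequiv (u ++ q) (v ++ q).
Proof. exact: (wequiv_ctx [::] q). Qed.

Lemma wequiv_odd_size u v : wequiv u v -> odd (size u) = odd (size v).
Proof.
elim=> {u v} [u|u v _ ->|u v w _ -> _ ->|u v i j] //.
rewrite !size_cat !oddD (_ : odd (size (coxrel i j)) = false) ?addFb //.
by rewrite /coxrel; elim: (coxm _ _ _) => //= c ->.
Qed.

Lemma wequiv_cancel i w : wequiv [:: i, i & w] w.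
Proof. by have := we_rel [::] w i i; rewrite /coxrel /coxm eqxx. Qed.

Lemma wequiv_cat_rev u : wequiv (u ++ rev u) [::].
Proof.
elim: u => [|a u IH]; first exact: we_refl.
rewrite rev_cons -cats1 catA; apply: we_trans (wequiv_cancel a [::]).
exact: (wequiv_ctx [:: a] [:: a] IH).
Qed.

Lemma wequiv_inv u v : wequiv (u ++ v) [::] -> wequiv v (rev u).
Proof.
move=> /(wequiv_catl (rev u)); rewrite cats0; apply: we_trans; apply: we_sym.
by have := wequiv_catr v (wequiv_cat_rev (rev u)); rewrite revK -catA.
Qed.

Lemma reduced_infix p q u : reduced (p ++ u ++ q) -> reduced u.
Proof.
by move=> red w /(wequiv_ctx p q)/red; rewrite !size_cat leq_add2l leq_add2r.
Qed.

Lemma reduced_prefix q u : reduced (u ++ q) -> reduced u.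
Proof. exact: (@reduced_infix [::] q u). Qed.

Lemma reduced_suffix p u : reduced (p ++ u) -> reduced u.
Proof. by move=> red; apply: (@reduced_infix p [::]); rewrite cats0. Qed.

Lemma reduced_wequiv u v : reduced u -> wequiv v u -> size v <= size u -> reduced v.
Proof. by move=> red vu vs w wv; apply: leq_trans vs _; apply: red; apply: we_trans wv vu. Qed.

Lemma size_reduced u v : reduced u -> reduced v -> wequiv u v -> size u = size v.
Proof. by move=> ru rv uv; apply/eqP; rewrite eqn_leq ru ?rv //; apply: we_sym. Qed.

Lemma not_reduced_cancel i w : ~ reduced [:: i, i & w].
Proof. by move=> /(_ w (we_sym (wequiv_cancel i w))) /=; rewrite ltnNge leqnSn. Qed.

Lemma reduced_descent c v : reduced v -> ~ reduced (c :: v) ->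
  exists2 w, reduced (c :: w) & wequiv (c :: w) v.
Proof.
move=> rv nrcv; have [w wcv sw] : exists2 w, wequiv w (c :: v) & size w < (size v).+1.
  apply: NNPP => no; apply: nrcv => w wcv; rewrite leqNgt; apply/negP => sw.
  by apply: no; exists w.
have cwv : wequiv (c :: w) v.
  by apply: we_trans (wequiv_cancel c v); apply: (wequiv_catl [:: c]).
have w_v : size w != size v.
  by apply: contraPneq (wequiv_odd_size wcv) => /= ->; case: odd.
by exists w => //; apply: reduced_wequiv rv cwv _; rewrite ltn_neqAle w_v -ltnS.
Qed.

(* Moving a maximal prefix in the letters i and j out of v: both i and j are ascents of what
   remains. *)
Lemma dihedral_factor i j u v : reduced (u ++ v) -> {subset u <= [:: i; j]} ->
  exists u' v', [/\ wequiv (u' ++ v') (u ++ v), reduced (u' ++ v'), size v' <= size v,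
    {subset u' <= [:: i; j]} & forall c, c \in [:: i; j] -> reduced (c :: v')].
Proof.
have [n] := ubnP (size v); elim: n u v => // n IH u v vn red uij.
have [asc|] := classic (forall c, c \in [:: i; j] -> reduced (c :: v)).
  by exists u, v; split=> //; apply: we_refl.
move=> no_asc; have [c cij nrcv] : exists2 c, c \in [:: i; j] & ~ reduced (c :: v).
  apply: NNPP => no; apply: no_asc => c cij; apply: NNPP => nrcv.
  by apply: no; exists c.
have rv := reduced_suffix red; have [w rcw cwv] := reduced_descent rv nrcv.
have wv : (size w).+1 = size v := size_reduced rcw rv cwv.
have ucw : wequiv ((u ++ [:: c]) ++ w) (u ++ v) by rewrite -catA; apply: wequiv_catl.
have [|||u' [v' [uv' red' vw uij' asc]]] := IH (u ++ [:: c]) w.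
- by rewrite -ltnS wv.
- by apply: reduced_wequiv red ucw _; rewrite !size_cat -wv addn1 addSnnS.
- by move=> d; rewrite mem_cat mem_seq1 => /orP [/uij|/eqP->].
exists u', v'; split=> //; first exact: we_trans uv' ucw.
by apply: leq_trans vw _; rewrite -wv.
Qed.

(* The alternating word of length k whose rightmost letter, the first one to act, is a. *)
Fixpoint alt_word a b k :=
  if k is k'.+1 then (if odd k' then b else a) :: alt_word a b k' else [::].

Lemma size_alt_word a b k : size (alt_word a b k) = k.
Proof. by elim: k => //= k ->. Qed.

Lemma alt_wordD a b k n : exists2 u, alt_word a b (k + n) = u ++ alt_word a b n & size u = k.
Proof.
elim: k => [|k [u uE us]]; first by exists [::].
by exists ((if odd (k + n) then b else a) :: u); rewrite /= ?uE ?us.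
Qed.

Lemma alt_word_coxrel a b : alt_word a b (2 * coxm t a.+1 b.+1) = coxrel b a.
Proof.
rewrite /coxrel coxmC; elim: (coxm _ _ _) => [|c IH]; first by rewrite muln0.
by rewrite mulnS /= IH mul2n odd_double.
Qed.

Lemma coxm_gt0 (a b : nat) : 0 < coxm t a b.
Proof. by rewrite /coxm; case: ifP => // _; case: absz => [|[|[|]]]. Qed.

Lemma reduced_alt_word_leq a b k : reduced (alt_word a b k) -> k <= coxm t a.+1 b.+1.
Proof.
set c := coxm _ _ _ => red; have c0 : 0 < c := coxm_gt0 _ _; rewrite leqNgt; apply/negP => ck.
have [q qE _] := alt_wordD a b (k - c.+1) c.+1; rewrite subnK // in qE.
have {}red : reduced (alt_word a b c.+1) by move: red; rewrite qE; apply: reduced_suffix.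
have [u uE us] := alt_wordD a b c.-1 c.+1.
have cc : c.-1 + c.+1 = 2 * c by rewrite addnS -addSn prednK // mul2n addnn.
have cycl : wequiv (u ++ alt_word a b c.+1) [::].
  by rewrite -uE cc alt_word_coxrel; have := we_rel [::] [::] b a; rewrite cats0.
have := red _ (we_sym (wequiv_inv cycl)).
by rewrite size_rev us size_alt_word -ltnS prednK // ltnNge leqnSn.
Qed.

Lemma reduced_alt_wordE i j u : reduced (i :: u) -> {subset u <= [:: i; j]} ->
  i :: u = alt_word (if odd (size u) then j else i) (if odd (size u) then i else j) (size u).+1.
Proof.
elim: u i j => [|c u IH] i j // red uij.
have ci : c != i by apply/eqP => ci; rewrite ci in red; apply: not_reduced_cancel red.
have /eqP cj : c == j by have := uij c (mem_head _ _); rewrite !inE (negPf ci).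
rewrite {}cj in red uij *; rewrite [in LHS](IH j i (reduced_suffix (p := [:: i]) red)) /=.
  by case: (odd (size u)).
by move=> d du; have := uij d; rewrite !inE du orbT orbC => /(_ isT).
Qed.

End CoxeterWords.

(** * Green sequences of reduced words *)

Section GreenWords.
Local Open Scope ring_scope.
Variables (t : ctype) (m : nat).
Hypotheses (vt : valid_ctype t) (m1 : (1 < m)%N).
Local Notation eQ := (@epsQ t m).
Local Notation s_ i := (sc t (nat_of_ord i).+1).
Local Notation adj i j := (adjacent t (nat_of_ord i).+1 (nat_of_ord j).+1).
Local Notation shift_ i j := (arrow_shift t (nat_of_ord i).+1 (nat_of_ord j).+1).
Local Notation vertex := (vertex m1).
Local Notation coxeter a b := (coxm t (nat_of_ord a).+1 (nat_of_ord b).+1).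
Local Notation rank_two F a b :=
  (F (s_ a) (s_ b) (arc_length b a) (arc_length a b) (sc_max t a.+1 b.+1)).
Implicit Types (a b i j : 'I_(rank t)) (x : vert t m -> trop (vert t m)) (u v ws : seq 'I_(rank t)).

Lemma nonneg_rows_coxm a b : a != b -> rank_two nonneg_rows a b (coxeter a b).
Proof.
move=> ab; have coxE : coxeter a b = if adj a b then
    (if s_ a == s_ b then 3 else if sc_max t a.+1 b.+1 == 2 then 4 else 6)%N else 2%N.
  have [sba|/ltnW sab] := leqP (s_ b) (s_ a).
    by rewrite coxm_sc // /sc_max (maxn_idPl sba).
  by rewrite coxmC coxm_sc 1?eq_sym // adjacentC /sc_max (maxn_idPr sab).
rewrite coxE /arc_length (adjacentC t b.+1) (sc_maxC t b.+1) /sc_max.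
case: (adj a b); last exact: nonneg_rows_A1A1.
case: (sc_cases t a.+1) => ->; case: (sc_cases t b.+1) => ->.
- exact: nonneg_rows_A2.
- by case: (rr_cases t) => ->;
    [apply: nonneg_rows_A2 | apply: nonneg_rows_B2_short | apply: nonneg_rows_G2_short].
- by case: (rr_cases t) => ->;
    [apply: nonneg_rows_A2 | apply: nonneg_rows_B2_long | apply: nonneg_rows_G2_long].
by case: (rr_cases t) => ->; apply: nonneg_rows_A2.
Qed.

Definition trop_word x ws : vert t m -> trop (vert t m) :=
  tx (trop_seq (TSeed eQ x) (Rword m ws)).

Lemma trop_seq_Rword x ws : trop_seq (TSeed eQ x) (Rword m ws) = TSeed eQ (trop_word x ws).
Proof.
have := teps_trop_seq (TSeed eQ x) (Rword m ws).
by rewrite eps_Rword // /trop_word; case: (trop_seq _ _) => e y /= ->.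
Qed.

Lemma trop_word_cat x u v : trop_word x (u ++ v) = trop_word (trop_word x v) u.
Proof. by rewrite {1}/trop_word Rword_cat trop_seq_cat trop_seq_Rword. Qed.

Lemma trop_word_wequiv x u v : wequiv u v -> trop_word x u = trop_word x v.
Proof.
by move=> uv; rewrite /trop_word (trop_seq_mequiv _ (mequiv_Rword vt m1 poly_cone uv)).
Qed.

Definition nonneg_row i x := forall z w, 0 <= x (vertex i z) w.

Lemma green_run_letter i x (x' := trop_word x [:: i]) : nonneg_row i x ->
  green_run (TSeed eQ x) (Rword m [:: i]) = Some (TSeed eQ x') /\ row_reflection m1 i x x'.
Proof.
move=> xi; have [y run xy] := green_run_Ri vt xi.
by rewrite /x' /trop_word /Rword /= cats0 (green_run_trop_seq run).
Qed.

Definition rows a b x w : (int -> int) * (int -> int) :=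
  (fun z => x (vertex a z) w, fun z => x (vertex b (z - shift_ b a)) w).

Lemma rows_reflect_a a b x x' w : b != a -> row_reflection m1 a x x' ->
  rows a b x' w = reflect_a (s_ a) (arc_length b a) (rows a b x w).
Proof.
move=> ba [xa xj]; congr pair; apply: functional_extensionality => z; first exact: xa.
by rewrite xj // subrK.
Qed.

Lemma rows_reflect_b a b x x' w : a != b -> row_reflection m1 b x x' ->
  rows a b x' w = reflect_b (s_ b) (arc_length a b) (sc_max t a.+1 b.+1) (rows a b x w).
Proof.
move=> ab [xb xj]; congr pair; apply: functional_extensionality => z; last first.
  by rewrite xb /=; congr (- x (vertex b _) w); ring.
rewrite xj //; congr (_ + _); rewrite /arc_length.
case: ifP => adj_ab; last by rewrite !big_nil.
apply: eq_bigr => r _ /=; congr (x (vertex b _) w).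
by rewrite (arrow_shiftC vt adj_ab); ring.
Qed.

Lemma nonneg_row_alt_word a b x k : a != b -> nonneg_row a x -> nonneg_row b x ->
  (k < coxeter a b)%N -> nonneg_row (if odd k then b else a) (trop_word x (alt_word a b k)).
Proof.
move=> ab xa xb.
have row_ge0 l w z : (l < coxeter a b)%N -> 0 <= rank_two next_row a b l (rows a b x w) z.
  by move=> lc; apply: nonneg_rows_coxm.
have nonneg l : (l < coxeter a b)%N ->
    (forall w, rows a b (trop_word x (alt_word a b l)) w =
       rank_two reflect_ab a b l (rows a b x w)) ->
    nonneg_row (if odd l then b else a) (trop_word x (alt_word a b l)).
  move=> lc rowsE z w; have := row_ge0 l w (if odd l then z + shift_ b a else z) lc.
  by rewrite /next_row -rowsE; case: (odd l); rewrite //= addrK.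
move=> kc; apply: (nonneg k kc) => w; elim: k kc w => [|k IH] kc w; first by [].
have {}IH := IH (ltnW kc); have pos := nonneg k (ltnW kc) IH.
have [_] := green_run_letter pos; rewrite -trop_word_cat /= -IH.
by case: (odd k) => refl; [apply: rows_reflect_b refl | apply: rows_reflect_a refl; rewrite eq_sym].
Qed.

Local Notation unit_vectors := (tx (trop_init eQ)).

(* As for Deodhar's lemma on signs of roots: if i and j are both ascents of a suffix v of a
   reduced word, then only the rank two subgroup generated by s_i and s_j matters. *)
Lemma nonneg_row_reduced i ws : reduced (i :: ws) -> nonneg_row i (trop_word unit_vectors ws).
Proof.
have [n] := ubnP (size ws); elim: n i ws => // n IH i [|j ws] sz red; first by move=> z w.
have ij : i != j by apply/eqP => ij; rewrite ij in red; apply: not_reduced_cancel red.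
have redj := reduced_suffix (p := [:: i]) red.
have [|u [v [uv reduv sv uij asc]]] := @dihedral_factor _ i j [:: j] ws redj.
  by move=> c; rewrite !inE => ->; rewrite orbT.
have redi : reduced ((i :: u) ++ v).
  apply: (reduced_wequiv red); first exact: (wequiv_catl [:: i]) uv.
  by rewrite /= (size_reduced reduv redj uv).
have := reduced_prefix redi => /[dup] red_iu /reduced_alt_wordE/(_ uij).
set a := if _ then j else i; set b := if _ then i else j => alt.
have ab : a != b by rewrite /a /b; case: odd; rewrite // eq_sym.
have asc_row c : c \in [:: i; j] -> nonneg_row c (trop_word unit_vectors v).
  by move=> cij; apply: IH (asc c cij); apply: leq_ltn_trans sv _.
have lt : (size u < coxeter a b)%N by apply: reduced_alt_word_leq; rewrite -alt.
rewrite -(trop_word_wequiv _ uv) trop_word_cat; case: alt => {1}-> {2}->.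
apply: nonneg_row_alt_word => //; apply: asc_row; rewrite /a /b;
  by case: odd; rewrite !inE eqxx ?orbT.
Qed.

Lemma green_run_reduced ws : reduced ws -> green_run (trop_init eQ) (Rword m ws) =
  Some (TSeed eQ (trop_word unit_vectors ws)).
Proof.
elim: ws => [|i ws IH] red //; have pos := nonneg_row_reduced red.
rewrite -cat1s Rword_cat green_run_cat (IH (reduced_suffix (p := [:: i]) red)) trop_word_cat.
by have [] := green_run_letter pos.
Qed.

Lemma trop_word_longest ws : reduced ws -> is_longest ws ->
  forall (y : vert t m) w, trop_word unit_vectors ws y w <= 0.
Proof.
move=> red longest y w; pose i := y.1.
have nri : ~ reduced (i :: ws).
  move=> redi; have [u ui us] := longest (i :: ws).
  by have := redi u ui; rewrite leqNgt ltnS us.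
have [u redu uws] := reduced_descent red nri; have pos := nonneg_row_reduced redu.
have [_ [refl _]] := green_run_letter pos.
rewrite -(trop_word_wequiv _ uws) -cat1s trop_word_cat -(vertexK m1 y) refl oppr_le0.
exact: pos.
Qed.

End GreenWords.

Theorem theorem3p7 (t : ctype) (m : nat) :
  valid_ctype t -> 1 < m ->
  (* (1) Coxeter relations (R_i R_j)^{m_ij} = 1 in Gamma_{Q_m(g)} *)
  ((forall i j : 'I_(rank t), trivial_in_Gamma (@epsQ t m) (RiRj_pow m i j))
   (* ... hence s_i |-> R_i is a well-defined action of W(g) *)
   /\ (forall u v : seq 'I_(rank t), wequiv u v ->
         same_in_Gamma (@epsQ t m) (Rword m u) (Rword m v)))
  /\
  (* (2) green / maximal green sequences *)
  (forall ws : seq 'I_(rank t), reduced ws ->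
     green (@epsQ t m) (Rword m ws) /\
     (is_longest ws -> maximal_green (@epsQ t m) (Rword m ws))).
Proof.
move=> vt m1; split; [split=> [i j|u v uv] | move=> ws red; split=> [|longest]].
- exact: (mequiv_same_in_Gamma (v := [::])) (mequiv_RiRj_pow vt m1 _ i j).
- exact: mequiv_same_in_Gamma (mequiv_Rword vt m1 _ uv).
- by rewrite /green (green_run_reduced vt m1 red).
exists (TSeed (@epsQ t m) (trop_word (tx (trop_init (@epsQ t m))) ws)).
  exact: green_run_reduced.
by move=> v; apply/forallP => w; apply: trop_word_longest.
Qed.
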